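(* Let $n\ge 1$ and let $M^n$ be an $n$-dimensional manifold. Then $$2n+1\le N(M^n)\le 4n+1 .$$ Indeed, generically any submanifold $M^n\subset\mathbf{R}^{4n+1}$ is totally skew; that is, a generic $C^1$ embedding $M^n\to\mathbf{R}^{4n+1}$ is totally skew. Further, if $M^n$ is closed (compact, connected, without boundary), then $N(M^n)\ge 2n+2$.
   Context: A pair of lines in $\mathbf{R}^N$ is skew if they are not parallel and do not intersect (in particular, two equal lines are not skew). A submanifold $M^n\subset\mathbf{R}^N$ (with $C^1$ regularity) is totally skew if every pair of (affine) tangent lines of $M$ is skew, unless they are tangent to $M$ at the same point. An embedding $f\colon M^n\to\mathbf{R}^N$ (of class $C^1$) is totally skew if its image is a totally skew submanifold. For a manifold $M^n$, $N(M^n)$ denotes the smallest $N$ such that $M^n$ admits a totally skew embedding in $\mathbf{R}^N$. ''Generic'' means: the set of totally skew embeddings contains a countable intersection of open dense subsets of the space of $C^1$ embeddings $M^n\to\mathbf{R}^{4n+1}$ with the strong (Whitney) $C^1$ topology. *)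

(* Defs.v *)
From HB Require Import structures.
From mathcomp Require Import all_boot all_order all_algebra.
From mathcomp Require Import all_classical all_reals all_analysis borel_hierarchy.

Set Implicit Arguments.
Unset Strict Implicit.
Unset Printing Implicit Defensive.

Import Order.TTheory GRing.Theory Num.Theory.
Import numFieldNormedType.Exports.

Local Open Scope classical_set_scope.
Local Open Scope ring_scope.

(* Manifolds may have boundary, so derivatives are taken along the filter
   [within A (nbhs x)]: for [A] open this is the usual derivative, and for [A]
   relatively open in a half-space it is still uniquely determined. *)

Section C1_on.
Context {R : realType} {n m : nat}.
Implicit Types (A : set 'rV[R]_n) (g : 'rV[R]_n -> 'rV[R]_m).

(* Row-vector convention: the differential is [v |-> v *m jacobian_within A g x]. *)
Definition jacobian_within A g (x : 'rV[R]_n) : 'M[R]_(n, m) :=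
  lin1_mx ('d g (within A (nbhs x))).

Definition C1_on A g : Prop :=
  (forall x, A x -> differentiable g (within A (nbhs x))) /\
  {within A, continuous (jacobian_within A g)}.

End C1_on.

(* The index with value [0] exists only for [0 < n]. *)
Definition halfspace (R : realType) (n : nat) : set 'rV[R]_n :=
  [set x | forall i : 'I_n, i = 0%N :> nat -> 0 <= x ord0 i].

Definition halfspace_boundary (R : realType) (n : nat) : set 'rV[R]_n :=
  [set x | exists2 i : 'I_n, i = 0%N :> nat & x ord0 i = 0].

(* [cmap] and [cinv] are total; their values outside [cdom] and
   [cmap @` cdom] are irrelevant. *)
Record chart (R : realType) (n : nat) (T : topologicalType) := Chart {
  cdom : set T;
  cmap : T -> 'rV[R]_n;
  cinv : 'rV[R]_n -> T;
  open_cdom : open cdom;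
  cimg_open : exists2 V, open V & cmap @` cdom = V `&` @halfspace R n;
  cmapK : forall p, cdom p -> cinv (cmap p) = p;
  cmap_continuous : {within cdom, continuous cmap};
  cinv_continuous : {within cmap @` cdom, continuous cinv} }.

Definition cimg (R : realType) (n : nat) (T : topologicalType)
  (c : chart R n T) : set 'rV[R]_n := cmap c @` cdom c.

Definition C1_compatible (R : realType) (n : nat) (T : topologicalType)
    (c c' : chart R n T) : Prop :=
  C1_on (cmap c @` (cdom c `&` cdom c')) (cmap c' \o cinv c) /\
  C1_on (cmap c' @` (cdom c `&` cdom c')) (cmap c \o cinv c').

(* C^1 manifolds of dimension [n], possibly with boundary, possibly neither
   connected nor compact; [atlas] is the maximal atlas. *)
Record manifold (R : realType) (n : nat) := Manifold {
  manifold_space :> topologicalType;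
  manifold_hausdorff : hausdorff_space manifold_space;
  manifold_second_countable : @second_countable manifold_space;
  atlas : set (chart R n manifold_space);
  atlas_cover : \bigcup_(c in atlas) cdom c = [set: manifold_space];
  atlas_compatible : forall c c', atlas c -> atlas c' -> C1_compatible c c';
  atlas_maximal : forall c,
    (forall c', atlas c' -> C1_compatible c c') -> atlas c }.

Section manifold_theory.
Context {R : realType} {n : nat}.
Implicit Type M : manifold R n.

Definition manifold_boundary M : set M :=
  [set p | exists c : chart R n (manifold_space M),
    [/\ atlas c, cdom c p & @halfspace_boundary R n (cmap c p)]].

Definition closed_manifold M : Prop :=
  [/\ compact [set: M], connected [set: M] & @manifold_boundary M = set0].

Definition is_C1 M (N : nat) (f : M -> 'rV[R]_N) : Prop :=
  forall c : chart R n (manifold_space M), atlas c -> C1_on (cimg c) (f \o cinv c).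

Record C1map M (N : nat) := C1Map {
  C1map_fun :> M -> 'rV[R]_N;
  C1mapP : is_C1 C1map_fun }.

(* The differential of [f] at [p], read in the chart [c] around [p]. *)
Definition chart_jacobian M (N : nat) (f : M -> 'rV[R]_N) (c : chart R n (manifold_space M))
    (p : M) : 'M[R]_(n, N) :=
  jacobian_within (cimg c) (f \o cinv c) (cmap c p).

Definition immersion M (N : nat) (f : C1map M N) : Prop :=
  forall (c : chart R n (manifold_space M)) (p : M), atlas c -> cdom c p ->
    row_free (chart_jacobian f c p).

(* An injective immersion which is a homeomorphism onto its image; [f] being
   continuous, the latter says that [M] carries the topology induced by [f]. *)
Definition embedding M (N : nat) (f : C1map M N) : Prop :=
  [/\ immersion f, injective f &
      forall U : set M, open U -> exists2 V, open V & f @^-1` V = U].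

Definition locally_finite (T : topologicalType) (I : Type) (U : I -> set T) :
    Prop :=
  forall p : T, exists2 W, nbhs p W & finite_set [set i | U i `&` W !=set0].

(* Hirsch, Differential Topology, Section 2.1, with the identity chart on the
   target R^N. *)
Definition strong_nbhd M (N : nat) (f : C1map M N) (I : Type)
    (c : I -> chart R n (manifold_space M)) (K : I -> set M) (e : I -> R) : set (C1map M N) :=
  [set g : C1map M N | forall i p, K i p ->
     `|f p - g p| < e i /\
     `|chart_jacobian f (c i) p - chart_jacobian g (c i) p| < e i].

Definition strong_base M (N : nat) : set (set (C1map M N)) :=
  [set B | exists (f : C1map M N) (I : Type) (c : I -> chart R n (manifold_space M))
      (K : I -> set M) (e : I -> R),
    [/\ forall i, atlas (c i),
        locally_finite (fun i => cdom (c i)),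
        forall i, compact (K i) /\ K i `<=` cdom (c i),
        forall i, 0 < e i &
        B = strong_nbhd f c K e]].

End manifold_theory.

HB.instance Definition _ (R : realType) (n : nat) (M : manifold R n) (N : nat)
  := gen_eqMixin (C1map M N).
HB.instance Definition _ (R : realType) (n : nat) (M : manifold R n) (N : nat)
  := gen_choiceMixin (C1map M N).
HB.instance Definition _ (R : realType) (n : nat) (M : manifold R n) (N : nat)
  := @isSubBaseTopological.Build (C1map M N)
       (set (C1map M N)) (@strong_base R n M N) id.

(* The space of C^1 embeddings; as a [set_type] it has the subspace topology. *)
Definition embeddings (R : realType) (n : nat) (M : manifold R n) (N : nat) :
  set (C1map M N) := [set f | embedding f].
Arguments embeddings {R n} M N.

Section skew.
Context {R : realType}.

Definition line (N : nat) (a v : 'rV[R]_N) : set 'rV[R]_N :=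
  [set a + t *: v | t in [set: R]].

(* Two lines are parallel iff one is a translate of the other; in particular
   a line is parallel to itself. *)
Definition parallel (N : nat) (l1 l2 : set 'rV[R]_N) : Prop :=
  exists u, l2 = [set u + x | x in l1].

Definition skew (N : nat) (l1 l2 : set 'rV[R]_N) : Prop :=
  ~ parallel l1 l2 /\ l1 `&` l2 = set0.

Context {n : nat} (M : manifold R n).

(* The affine lines tangent at [f p] to the image of [f]. *)
Definition tangent_line (N : nat) (f : C1map M N) (p : M)
    (l : set 'rV[R]_N) : Prop :=
  exists (c : chart R n (manifold_space M)) (v : 'rV[R]_n),
    [/\ atlas c, cdom c p, v *m chart_jacobian f c p != 0 &
        l = line (f p) (v *m chart_jacobian f c p)].

(* [f] is used injective, so distinct points of the image are the [f p], [f q]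
   with [p <> q]. *)
Definition totally_skew (N : nat) (f : C1map M N) : Prop :=
  forall (p q : M) (l1 l2 : set 'rV[R]_N), p <> q ->
    tangent_line f p l1 -> tangent_line f q l2 -> skew l1 l2.

Definition has_totally_skew_embedding (N : nat) : Prop :=
  exists2 f : C1map M N, embedding f & totally_skew f.

(* [N] is the number N(M). *)
Definition is_skew_dimension (N : nat) : Prop :=
  has_totally_skew_embedding N /\
  forall N' : nat, has_totally_skew_embedding N' -> (N <= N')%N.

End skew.

(* Main.v *)
(** A C^1 immersion [f] is totally skew iff for all [p <> q] the rows of [Df_p],
    [Df_q] and the vector [f p - f q] are linearly independent; this needs
    [2n + 1 <= N].

    Genericity: for disjoint compact [A], [B] in charts the condition on [A x B]
    is open.  It is dense when [4n + 1 <= N]: first replace [f] near [A] and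
    [B] by a map with Lipschitz derivative, then add affine maps
    [x |-> al + x b] near [A] and [y |-> y b'] near [B].  After a change of
    basis this adds an arbitrary matrix [tau] to a Lipschitz family of
    (2n + 1) x N matrices parametrized by [A x B], of dimension [2n].  The
    matrices of deficient rank have codimension [N - 2n], so the bad [tau] have
    box dimension at most [2n + (2n + 1) N - (N - 2n) < (2n + 1) N] and do not
    fill a ball.  As the C^1 structure need not come with a smoother one, the
    smoothing is only local, and countably many such steps are composed in a
    C^1-convergent sequence.  Small perturbations of an embedding that remain
    injective are embeddings, and starting from a proper C^1 map the same
    construction produces a totally skew embedding.

    Closed manifolds in R^(2n+1): the projection of [f M] to R^(2n) has
    dimension [n < 2n], so some [x] in the interior of the convex hull of the
    projection is not in the projection.  A hyperplane supporting [f M] at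
    the top of the convex hull over [x] touches [f M] at two points; it
    contains the two tangent spaces and the chord, contradicting independence. *)

Require Import Defs.
From HB Require Import structures.
From mathcomp Require Import all_boot all_order all_algebra.
From mathcomp Require Import all_classical all_reals all_analysis borel_hierarchy.
From mathcomp Require Import zify ring lra.

Set Implicit Arguments.
Unset Strict Implicit.
Unset Printing Implicit Defensive.

Import Order.TTheory GRing.Theory Num.Theory.
Import numFieldNormedType.Exports.

Local Open Scope classical_set_scope.
Local Open Scope ring_scope.

(** * Norms of matrices, compactness *)

(** Counting cells needs a Lipschitz family of matrices: the differential of a C^1 map is only
    continuous, and its values over [A x B] may have a box dimension far above [2n]. Smoothing
    supplies exactly this Lipschitz bound, by gluing first order Taylor polynomials with cut-off
    functions. It uses the map only on the chart image, so boundary points need no extension across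
    the boundary of the half-space. The strong topology is handled through [close]: a positive
    tolerance for each member of a locally finite family of compact shells. Every open set contains
    such a neighbourhood of each of its points, and tolerances can be halved, so countably many
    modifications have a C^1 limit. In the closed case the two contact points come from the choice
    of a slope: among all supporting hyperplanes, the one of least height over [x] cannot touch at a
    single point, since tilting it would lower it. That [x] is not in the projection makes the tilt
    nonzero; that it is interior to the convex hull makes the minimum exist. *)

Section matrix_norm.
Context {R : realType}.

Lemma mx_coef_norm m n (A : 'M[R]_(m, n)) i j : `|A i j| <= `|A|.
Proof.
rewrite [leRHS]/Num.norm /= mx_normrE.
exact: (le_bigmax _ (fun ij : 'I_m * 'I_n => `|A ij.1 ij.2|) (i, j)).
Qed.

Lemma mx_norm_le m n (A : 'M[R]_(m, n)) c :
  0 <= c -> (forall i j, `|A i j| <= c) -> `|A| <= c.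
Proof.
move=> c0 h; rewrite [leLHS]/Num.norm /= mx_normrE.
by apply/bigmax_leP; split => // -[i j] _ /=.
Qed.

Lemma mx_norm_mul m n p (A : 'M[R]_(m, n)) (B : 'M[R]_(n, p)) :
  `|A *m B| <= n%:R * `|A| * `|B|.
Proof.
apply: mx_norm_le => [|i j]; first by rewrite !mulr_ge0.
rewrite mxE; apply: (le_trans (ler_norm_sum _ _ _)).
apply: (@le_trans _ _ (\sum_(k < n) `|A| * `|B|)).
  by apply: ler_sum => k _; rewrite normrM ler_pM ?mx_coef_norm.
by rewrite sumr_const card_ord -[X in _ <= X]mulrA mulr_natl.
Qed.

Lemma mulmx_diff m n p (A A' : 'M[R]_(m, n)) (B B' : 'M[R]_(n, p)) :
  A *m B - A' *m B' = (A - A') *m B + A' *m (B - B').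
Proof. by rewrite mulmxBl mulmxBr addrA subrK. Qed.

Lemma normD_le (V : normedZmodType R) (x y : V) (a b : R) :
  `|x| <= a -> `|y| <= b -> `|x + y| <= a + b.
Proof. by move=> h1 h2; apply: le_trans (ler_normD _ _) _; apply: lerD. Qed.

Lemma normB_le (V : normedZmodType R) (x y : V) (a b : R) :
  `|x| <= a -> `|y| <= b -> `|x - y| <= a + b.
Proof. by move=> h1 h2; apply: normD_le; rewrite ?normrN. Qed.

Lemma norm_leD (V : normedZmodType R) (x y : V) (a : R) :
  `|x - y| <= a -> `|x| <= `|y| + a.
Proof. by move=> h; rewrite -(subrK y x) addrC; apply: normD_le. Qed.

Lemma distD (V : normedZmodType R) (x y z : V) (a b : R) :
  `|x - y| <= a -> `|y - z| <= b -> `|x - z| <= a + b.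
Proof.
move=> h1 h2; rewrite -(subrK y x) -addrA.
by apply: le_trans (ler_normD _ _) _; apply: lerD.
Qed.

Lemma norm_col_mx m1 m2 n (A : 'M[R]_(m1, n)) (B : 'M[R]_(m2, n)) :
  `|col_mx A B| <= Num.max `|A| `|B|.
Proof.
apply: mx_norm_le => [|i j]; first by rewrite le_max normr_ge0.
rewrite mxE; case: (fintype.split i) => k; rewrite le_max mx_coef_norm ?orbT //.
Qed.

End matrix_norm.

Section compact_induction.
Context {T : topologicalType}.

(* Otherwise the sets [K `\` S] with [P S] generate a proper filter on [K],
   and no point of [K] can be a cluster point of it. *)
Lemma compact_ind (K : set T) (P : set T -> Prop) :
  compact K -> P set0 ->
  (forall S S', S `<=` S' -> P S' -> P S) ->
  (forall S S', P S -> P S' -> P (S `|` S')) ->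
  (forall p, K p -> exists2 U, nbhs p U & P (U `&` K)) ->
  P K.
Proof.
move=> cK P0 Psub PU Ploc; apply: contrapT => nPK.
pose F : set_system T := [set W | exists2 S, P S & K `\` S `<=` W].
have FF : ProperFilter F.
  apply: Build_ProperFilter_ex.
    move=> W [S PS SW]; apply: contrapT => nW; apply: nPK.
    apply: Psub PS => p Kp; apply: contrapT => nS; apply: nW; exists p.
    by apply: SW.
  split.
  - by exists set0.
  - move=> A B [S PS SA] [S' PS' SB]; exists (S `|` S'); first exact: PU.
    move=> p [Kp /not_orP [nS nS']]; split; [exact: SA|exact: SB].
  - by move=> A B AB [S PS SA]; exists S => //; apply: subset_trans AB.
have FK : F K by exists set0 => // p [].
have [p [Kp clp]] := cK F FF FK.
have [U Up PUK] := Ploc p Kp.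
have FU : F (K `\` U).
  by exists (U `&` K) => // q [Kq nq]; split => // Uq; apply: nq.
by have [q [[_ nU] /nU]] := clp _ _ FU Up.
Qed.

(** Finitely many neighbourhoods with their local radii cover [K], and the minimum of these radii
    serves everywhere. *)
Lemma compact_min_radius (R : realType) (K : set T) (Q : R -> T -> Prop) :
  compact K ->
  (forall c c' p, c' <= c -> Q c p -> Q c' p) ->
  (forall p, K p -> exists2 c, 0 < c & \forall q \near p, K q -> Q c q) ->
  exists2 c, 0 < c & forall p, K p -> Q c p.
Proof.
move=> cK Qm Qloc.
apply: (@compact_ind K (fun S => exists2 c : R, 0 < c & forall p, S p -> Q c p)) => //.
- by exists 1 => // p.
- by move=> S S' SS' [c c0 h]; exists c => // p /SS'/h.
- move=> S S' [c c0 h] [c' c'0 h']; exists (Num.min c c').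
    by rewrite lt_min c0.
  by move=> p [/h|/h']; apply: Qm; rewrite ge_min lexx ?orbT.
- move=> p /Qloc [c c0 h]; exists [set q | K q -> Q c q] => //.
  by exists c => // q [h1 /h1].
Qed.

Lemma compact_norm_bound (R : realType) (V : normedModType R) (K : set T) (phi : T -> V) :
  compact K -> (forall p, K p -> \forall q \near p, `|phi q - phi p| <= 1) ->
  exists2 B : R, 0 < B & forall p, K p -> `|phi p| <= B.
Proof.
move=> cK loc.
apply: (@compact_ind K (fun S => exists2 B : R, 0 < B & forall p, S p -> `|phi p| <= B)) => //.
- by exists 1.
- by move=> S S' SS' [B B0 h]; exists B => // p /SS'/h.
- move=> S S' [B B0 h] [B' B'0 h']; exists (B + B'); first exact: addr_gt0.
  by move=> p [/h|/h'] /le_trans; apply; rewrite ?lerDl ?lerDr ltW.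
- move=> p /loc h; exists [set q | `|phi q - phi p| <= 1] => //.
  by exists (`|phi p| + 1) => [|q [/norm_leD]]; rewrite ?ltr_wpDl.
Qed.

End compact_induction.

(** * Box dimension by counting cells *)

Section cov.
Context {R : realType}.

(* [phi @` S] has upper box dimension at most [d]: at each scale [1 / k.+1] the
   index set [S] is cut into [O(k ^ d)] cells on which [phi] oscillates by at
   most [1 / k.+1]. *)
Definition cov (T : Type) (V : normedModType R) (d : nat) (S : set T)
    (phi : T -> V) : Prop :=
  exists C : nat, forall k : nat, exists cell : T -> nat,
    (forall x, S x -> (cell x < C * k.+1 ^ d)%N) /\
    (forall x y, S x -> S y -> cell x = cell y ->
       `|phi x - phi y| <= k.+1%:R^-1).

(** The factor [L] is absorbed by refining the scale by an integer [l >= L]; this multiplies the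
    number of cells by [l ^ d], which goes into the constant. *)
Lemma cov_lip (T : Type) (V W : normedModType R) d (S : set T)
    (phi : T -> V) (psi : T -> W) (L : R) :
  (forall x y, S x -> S y -> `|psi x - psi y| <= L * `|phi x - phi y|) ->
  cov d S phi -> cov d S psi.
Proof.
move=> hL [C hC].
pose l := (Num.trunc `|L|).+1.
have lL : L <= l%:R.
  by apply: (le_trans (ler_norm _)); apply/ltW; rewrite /l truncnS_gt.
exists (C * l ^ d)%N => k.
(* [cov] uses the scale [1 / k.+1], so the predecessor selects the scale [1 / (l * k.+1)]. *)
have [cell [c1 c2]] := hC (l * k.+1).-1.
have kE : (l * k.+1).-1.+1 = (l * k.+1)%N by rewrite prednK // muln_gt0.
rewrite kE in c1 c2.
exists cell; split=> [x Sx|x y Sx Sy /c2 h].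
  by rewrite -mulnA -expnMn; exact: c1.
apply: (le_trans (hL x y Sx Sy)).
apply: (@le_trans _ _ (l%:R * (l * k.+1)%:R^-1)); last first.
  by rewrite natrM invfM mulrA divff ?mul1r // pnatr_eq0.
apply: (@le_trans _ _ (l%:R * `|phi x - phi y|)); first exact: ler_wpM2r.
by rewrite ler_wpM2l //; apply: h.
Qed.

Lemma cov_sub (T : Type) (V : normedModType R) d (S S' : set T)
    (phi : T -> V) : S `<=` S' -> cov d S' phi -> cov d S phi.
Proof.
move=> SS [C hC]; exists C => k; have [cell [c1 c2]] := hC k; exists cell.
by split=> [x /SS/c1//|x y /SS + /SS]; apply: c2.
Qed.

(** Only values matter: an index of [S'] inherits the cell of some index of [S] with the same
    value. *)
Lemma cov_reindex (T U : Type) (V : normedModType R) d (S : set T)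
    (phi : T -> V) (S' : set U) (psi : U -> V) :
  (forall x, S' x -> exists2 z, S z & phi z = psi x) ->
  cov d S phi -> cov d S' psi.
Proof.
move=> hz [C hC]; exists C => k; have [cell [c1 c2]] := hC k.
have [g gP] : {g : U -> nat & forall x, S' x -> exists2 z, S z /\ phi z = psi x & g x = cell z}.
  apply: (@choice _ _ (fun x n => S' x -> exists2 z, S z /\ phi z = psi x & n = cell z)).
  move=> x; have [/hz [z Sz e]|nS] := pselect (S' x); last by exists 0%N.
  by exists (cell z) => _; exists z.
exists g; split=> [x /gP [z [Sz _] ->]|x y /gP [z [Sz <-] ->] /gP [w [Sw <-] ->]].
  exact: c1.
exact: c2.
Qed.

Lemma cov_pair (T U : Type) (V W : normedModType R) d d' (S : set T) (S' : set U)
    (phi : T -> V) (psi : U -> W) :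
  cov d S phi -> cov d' S' psi ->
  cov (d + d') (S `*` S') (fun z => (phi z.1, psi z.2)).
Proof.
move=> [C hC] [C' hC']; exists (C * C')%N => k.
have [cell [c1 c2]] := hC k; have [cell' [c1' c2']] := hC' k.
pose b := (C * k.+1 ^ d)%N.
(* Mixed radix: as [cell z.1 < b], both cells are recovered as remainder and quotient modulo [b]. *)
exists (fun z => cell z.1 + b * cell' z.2)%N; split=> [[x y] [/= /c1 + /c1']|].
  rewrite -/b expnD mulnACA -/b; nia.
move=> [x y] [x' y'] [/= Sx Sy] [/= Sx' Sy'] e.
have bpos : (0 < b)%N by apply: leq_ltn_trans (c1 _ Sx).
have e1 : cell x = cell x'.
  have := congr1 (modn^~ b) e.
  by rewrite /= ![(b * _)%N]mulnC ![(_ + _ * b)%N]addnC !modnMDl !modn_small ?c1.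
have e2 : cell' y = cell' y' by move/eqP: e; rewrite e1 eqn_add2l eqn_pmul2l // => /eqP.
by rewrite prod_normE /= ge_max c2 // c2'.
Qed.

(** Finite unions, written as disjoint sums, keep the dimension: the rank of [i] separates the cells
    of different summands. *)
Lemma cov_fin (I : finType) (T : Type) (V : normedModType R) d
    (S : I -> set T) (phi : I -> T -> V) :
  (forall i, cov d (S i) (phi i)) ->
  cov d [set z : I * T | S z.1 z.2] (fun z => phi z.1 z.2).
Proof.
move=> /choice [C hC].
pose D := (\max_i C i)%N.
exists (#|I| * D)%N => k.
have /choice [cell hcell] := fun i => hC i k.
pose b := (D * k.+1 ^ d)%N.
have cb i x : S i x -> (cell i x < b)%N.
  move=> Sx; apply: leq_trans ((hcell i).1 x Sx) _.
  by rewrite leq_mul2r leq_bigmax orbT.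
exists (fun z => cell z.1 z.2 + b * enum_rank z.1)%N; split=> [[i x] /= /cb|].
  move=> lt_cell; rewrite -mulnA -/b [ltnRHS]mulnC.
  apply: (@leq_trans (b * (enum_rank i).+1)); first by rewrite mulnS ltn_add2r.
  by rewrite leq_mul2l ltn_ord orbT.
move=> [i x] [j y] /= Sx Sy e.
have bpos : (0 < b)%N by apply: leq_ltn_trans (cb _ _ Sx).
have ei : enum_rank i = enum_rank j.
  apply: val_inj; have := congr1 (divn^~ b) e.
  by rewrite /= ![(b * _)%N]mulnC ![(_ + _ * b)%N]addnC !divnMDl // !divn_small ?cb // !addn0.
move: Sy e; rewrite -(enum_rank_inj ei) => Sy /eqP; rewrite eqn_add2r => /eqP.
exact: (hcell i).2.
Qed.

(** At scale [1], that is for [k = 0], there are at most [C] cells, and [phi] oscillates by at most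
    [1] on each. *)
Lemma cov_bounded (T : Type) (V : normedModType R) d (S : set T) (phi : T -> V) :
  cov d S phi -> exists B : R, forall x, S x -> `|phi x| <= B.
Proof.
move=> [C /(_ 0%N) [cell [c1 c2]]]; rewrite exp1n muln1 in c1.
have /choice [b hb] : forall c : nat, exists b : R, forall x, S x -> cell x = c -> `|phi x| <= b.
  move=> c; have [[x0 [Sx0 e0]]|nx] := pselect (exists x, S x /\ cell x = c); last first.
    by exists 0 => x Sx e; exfalso; apply: nx; exists x.
  exists (`|phi x0| + 1) => x Sx e.
  apply: norm_leD; have := c2 x x0 Sx Sx0; rewrite e e0 invr1; exact.
exists (\sum_(c < C) `|b c|) => x Sx.
rewrite (bigD1 (Ordinal (c1 x Sx))) //=; apply: (@le_trans _ _ (`|b (cell x)|)).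
  by apply: (le_trans (hb _ x Sx erefl)); exact: ler_norm.
by rewrite lerDl sumr_ge0.
Qed.

End cov.

(** * Box dimension of sets of matrices *)

Section cov_matrix.
Context {R : realType}.

Lemma nat_dist_lt1 (a b : nat) : `|a%:R - b%:R : R| < 1 -> a = b.
Proof.
case: (ltngtP a b) => // ab; rewrite ltr_norml => /andP [h1 h2].
  by exfalso; move: ab; rewrite -(ler_nat R) -natr1 => ab; lra.
by exfalso; move: ab; rewrite -(ler_nat R) -natr1 => ab; lra.
Qed.

Lemma cov_mx p q (S : set 'M[R]_(p, q)) (B : R) :
  (forall A, S A -> `|A| <= B) -> cov (p * q) S id.
Proof.
move=> hB; pose b := (Num.trunc `|B|).+1.
have Bb : B <= b%:R.
  by apply: (le_trans (ler_norm _)); apply/ltW; rewrite /b truncnS_gt.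
exists ((2 * b).+1 ^ (p * q))%N => k.
(* Chosen so that [m.+1 = (2 * b).+1 * k.+1]. Each entry, shifted by [b] to be nonnegative, is
   rounded down at scale [1 / k.+1] and gives an integer at most [m]. *)
pose m := (2 * b * k.+1 + k)%N.
pose t (A : 'M[R]_(p, q)) ij := Num.trunc ((A ij.1 ij.2 + b%:R) * k.+1%:R).
have tP A ij : S A -> (t A ij)%:R <= (A ij.1 ij.2 + b%:R) * k.+1%:R < (t A ij).+1%:R.
  move=> /hB AB; apply: truncn_itv; rewrite mulr_ge0 //.
  have := le_trans (mx_coef_norm A ij.1 ij.2) (le_trans AB Bb).
  by rewrite ler_norml => /andP [+ _]; rewrite -subr_ge0 opprK.
have tm A ij : S A -> (t A ij < m.+1)%N.
  move=> SA; have /andP [h _] := tP A ij SA.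
  rewrite ltnS /m; apply: (@leq_trans (2 * b * k.+1)); last exact: leq_addr.
  rewrite -(ler_nat R); apply: (le_trans h); rewrite natrM ler_wpM2r //.
  have := le_trans (mx_coef_norm A ij.1 ij.2) (le_trans (hB _ SA) Bb).
  by rewrite ler_norml => /andP [_ h2]; rewrite mul2n -addnn natrD lerD2r.
exists (fun A => enum_rank [ffun ij : 'I_p * 'I_q => inord (t A ij) : 'I_m.+1] : nat).
split=> [A SA|A A' SA SA' /val_inj /enum_rank_inj e].
  have := ltn_ord (enum_rank [ffun ij : 'I_p * 'I_q => inord (t A ij) : 'I_m.+1]).
  rewrite [ltnRHS]card_ffun card_prod !card_ord => /leq_trans; apply.
  by rewrite -expnMn (_ : m.+1 = (2 * b).+1 * k.+1)%N // /m mulSn; lia.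
apply: mx_norm_le => [|i j]; first by rewrite invr_ge0.
have te : t A (i, j) = t A' (i, j).
  move/ffunP: e => /(_ (i, j)); rewrite !ffunE => /(congr1 val).
  by rewrite /= !inordK ?tm.
have /andP [/= h1 h2] := tP A (i, j) SA; have /andP [/= h3 h4] := tP A' (i, j) SA'.
rewrite te in h1 h2; rewrite !mxE -[leRHS]mul1r ler_pdivlMr //.
rewrite -[X in _ * X]ger0_norm // -normrM ler_norml.
rewrite -natr1 in h2 h4; apply/andP; split; lra.
Qed.

(** Pigeonhole. The ball of radius [e] contains [s.+1 ^ (p * q)] grid matrices at mutual distance at
    least [e / s.+1], which exceeds [1 / (l * s.+1)] because [1 / e < l]; so they lie in distinct
    cells. With [s = C * l ^ d] there are only [s * s.+1 ^ d < s.+1 ^ d.+1] cells. *)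
Lemma not_cov p q d (T : Type) (S : set T) (phi : T -> 'M[R]_(p, q)) (e : R) :
  (d < p * q)%N -> 0 < e ->
  (forall M : 'M[R]_(p, q), `|M| <= e -> exists2 x, S x & phi x = M) ->
  ~ cov d S phi.
Proof.
move=> dpq e0 hS [C hC].
pose l := (Num.trunc e^-1).+1.
have le_l : e^-1 < l%:R by rewrite /l truncnS_gt.
pose s := (C * l ^ d)%N.
have [cell [c1 c2]] := hC (l * s.+1).-1.
have kE : (l * s.+1).-1.+1 = (l * s.+1)%N by rewrite prednK // muln_gt0.
rewrite kE in c1 c2.
pose tau (g : {ffun 'I_p * 'I_q -> 'I_s.+1}) : 'M[R]_(p, q) :=
  \matrix_(i, j) ((g (i, j))%:R * (e / s.+1%:R)).
have tau_e g : `|tau g| <= e.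
  apply: mx_norm_le => [|i j]; first exact: ltW.
  rewrite mxE ger0_norm; last by rewrite mulr_ge0 // divr_ge0 // ltW.
  by rewrite mulrCA ger_pMr // ler_pdivrMr // mul1r ler_nat ltnW.
have /choice [x xP] : forall g, exists x, S x /\ phi x = tau g.
  by move=> g; have [x Sx e1] := hS _ (tau_e g); exists x.
pose N := (C * (l * s.+1) ^ d)%N.
pose F g : 'I_N := Ordinal (c1 _ (xP g).1).
have Finj : injective F.
  move=> g h /(congr1 val) /= /(c2 _ _ (xP g).1 (xP h).1).
  rewrite (xP g).2 (xP h).2 => gh; apply/ffunP => -[i j]; apply/val_inj => /=.
  have := le_trans (mx_coef_norm _ i j) gh.
  rewrite !mxE -mulrBl normrM [X in _ * X]gtr0_norm ?divr_gt0 //.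
  rewrite natrM invfM mulrA ler_pM2r ?invr_gt0 // -ler_pdivlMr //.
  have l1 : l%:R^-1 / e < 1.
    by rewrite ltr_pdivrMr // mul1r invf_plt ?posrE.
  move=> /le_lt_trans /(_ l1).
  exact: nat_dist_lt1.
have := leq_card F Finj; rewrite card_ffun card_prod !card_ord /N.
apply/negP; rewrite -ltnNge expnMn mulnA -/s.
apply: (@leq_trans (s.+1 ^ d.+1)); last exact: leq_pexp2l.
by rewrite expnS ltn_pmul2r ?expn_gt0.
Qed.

End cov_matrix.

(** * Perturbing a family of matrices to full row rank *)

Section perturb_rank.
Context {R : realType}.

Lemma not_row_freeP m N (A : 'M[R]_(m, N)) :
  ~~ row_free A -> exists2 w : 'rV[R]_m, w != 0 & w *m A = 0.
Proof.
rewrite -kermx_eq0 => /rowV0Pn [w /sub_kermxP wA w0]; by exists w.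
Qed.

Lemma row_freeP0 m N (A : 'M[R]_(m, N)) :
  row_free A <-> (forall w : 'rV[R]_m, w *m A = 0 -> w = 0).
Proof.
split=> [/row_free_inj inj w wA|h].
  by apply: inj; rewrite wA mul0mx.
apply/negP => /negP /not_row_freeP [w /eqP w0 /h]; exact: w0.
Qed.

Definition insert_row k N (i : 'I_k.+1) (r : 'rV[R]_N) (B : 'M[R]_(k, N)) :
    'M[R]_(k.+1, N) :=
  \matrix_(l, m) (if unlift i l is Some j then B j m else r ord0 m).

Lemma insert_rowB k N (i : 'I_k.+1) (r r' : 'rV[R]_N) (B B' : 'M[R]_(k, N)) :
  `|insert_row i r B - insert_row i r' B'| <= `|r - r'| + `|B - B'|.
Proof.
apply: mx_norm_le => [|l m]; first by rewrite addr_ge0.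
rewrite !mxE; case: unlift => [j|].
  by have := mx_coef_norm (B - B') j m; rewrite !mxE => /le_trans; apply; rewrite lerDr.
by have := mx_coef_norm (r - r') ord0 m; rewrite !mxE => /le_trans; apply; rewrite lerDl.
Qed.

(** Solving a linear relation for the row whose coefficient is largest in absolute value leaves
    coefficients bounded by [1]. Deficient matrices are thus parametrized by bounded data of
    dimension [k + k * N], which is codimension [N - k]. *)
Lemma not_row_free_insert k N (A : 'M[R]_(k.+1, N)) :
  ~~ row_free A -> exists (i : 'I_k.+1) (w : 'rV[R]_k) (B : 'M[R]_(k, N)),
    [/\ `|w| <= 1, `|B| <= `|A| & A = insert_row i (w *m B) B].
Proof.
move=> /not_row_freeP [w w0 wA].
pose i := [arg max_(i > ord0) `|w ord0 i|]%O.
have wi j : `|w ord0 j| <= `|w ord0 i|.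
  by rewrite /i; case: arg_maxP => // i' _; apply.
have wi0 : w ord0 i != 0.
  apply: contra w0 => /eqP e; apply/eqP/rowP => j; rewrite mxE.
  by apply/eqP; rewrite -normr_le0; apply: le_trans (wi j) _; rewrite e normr0.
exists i, (\row_j (- (w ord0 (lift i j) / w ord0 i))), (row' i A); split.
- apply: mx_norm_le => // u j; rewrite mxE normrN normrM normfV ler_pdivrMr ?normr_gt0 //.
  by rewrite mul1r.
- by apply: mx_norm_le => // l m; rewrite mxE mx_coef_norm.
- apply/matrixP => l m; rewrite mxE; case: unliftP => [j ->|->]; first by rewrite !mxE.
  have /rowP /(_ m) := wA; rewrite !mxE (bigD1_ord i) //= => e.
  have {e} : w ord0 i * A i m = - \sum_(j < k) w ord0 (lift i j) * A (lift i j) m.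
    by apply/eqP; rewrite -addr_eq0 e.
  move=> /(congr1 ( *%R (w ord0 i)^-1)); rewrite mulKf // => ->.
  rewrite mulrN mulr_sumr -sumrN; apply: eq_bigr => j _; rewrite !mxE.
  by field.
Qed.

(** A bad [tau] is a value of one of the [k.+1] maps [psi i], which are Lipschitz on a parameter set
    of dimension [k + k * N + d]. This is less than [k.+1 * N] by hypothesis, so [not_cov] excludes
    that all small [tau] are bad. *)
Lemma perturb_row_free k N d (T : Type) (S : set T) (phi : T -> 'M[R]_(k.+1, N))
    (eps : R) :
  (d + k < N)%N -> 0 < eps -> cov d S phi ->
  exists2 tau : 'M[R]_(k.+1, N), `|tau| <= eps &
    forall x, S x -> row_free (phi x + tau).
Proof.
move=> dkN eps0 covS; have [B hB] := cov_bounded covS; apply: contrapT => nex.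
have bad (tau : 'M[R]_(k.+1, N)) : `|tau| <= eps ->
    exists2 x, S x & ~~ row_free (phi x + tau).
  move=> te; apply: contrapT => nx; apply: nex; exists tau => // x Sx.
  by apply: contrapT => /negP nr; apply: nx; exists x.
pose S1 : set 'rV[R]_k := [set w | `|w| <= 1].
pose S2 : set 'M[R]_(k, N) := [set A | `|A| <= B + eps].
pose Z := ((S1 `*` S2) `*` S).
pose psi (i : 'I_k.+1) (z : ('rV[R]_k * 'M[R]_(k, N)) * T) :=
  insert_row i (z.1.1 *m z.1.2) z.1.2 - phi z.2.
have covZ : forall i, cov (1 * k + k * N + d) Z (psi i).
  move=> i.
  have c1 : cov (1 * k) S1 id by apply: cov_mx => w; apply.
  have c2 : cov (k * N) S2 id by apply: cov_mx => A; apply.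
  have := cov_pair (cov_pair c1 c2) covS.
  (* The product [w *m A] contributes [k * |B + eps| + k] on the bounded parameter sets; the
     inserted block [A] and [phi] contribute [1] each. *)
  pose L : R := 2 + k%:R * `|B + eps| + k%:R.
  apply: (@cov_lip _ _ _ _ _ _ _ _ L).
  move=> [[w A] x] [[w' A'] x'] [[/= Sw SA] Sx] [[/= Sw' SA'] Sx'].
  rewrite /psi /= opprD opprK addrACA [- phi x + _]addrC.
  set D := `|_ : 'rV_k * _ * _|.
  have Dw : `|w - w'| <= D by rewrite /D !prod_normE /= !le_max lexx.
  have DA : `|A - A'| <= D by rewrite /D !prod_normE /= !le_max lexx orbT.
  have Dx : `|phi x - phi x'| <= D by rewrite /D !prod_normE /= !le_max lexx !orbT.
  apply: (le_trans (ler_normD _ _)); rewrite /L.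
  have -> : (2 + k%:R * `|B + eps| + k%:R) * D = (k%:R * `|B + eps| * D + k%:R * D) + D + D by ring.
  apply: lerD; last by rewrite distrC.
  apply: (le_trans (insert_rowB _ _ _ _ _)); apply: lerD => //.
  have -> : w *m A - w' *m A' = (w - w') *m A + w' *m (A - A').
    by rewrite mulmxBl mulmxBr addrA subrK.
  apply: normD_le.
    apply: (le_trans (mx_norm_mul _ _)); rewrite mulrAC.
    apply: ler_pM => //.
    by rewrite ler_wpM2l // (le_trans SA) // ler_norm.
  apply: (le_trans (mx_norm_mul _ _)).
  by apply: ler_pM => //; rewrite ?mulr_ge0 // -[leRHS]mulr1 ler_wpM2l.
have := cov_fin covZ; apply: (@not_cov _ _ _ _ _ _ _ eps) => // [|tau te].
  by rewrite mul1n mulSn; lia.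
have [x Sx /not_row_free_insert [i [w [A [w1 AB e]]]]] := bad tau te.
exists (i, ((w, A), x)); rewrite /psi /=; last by rewrite -e addrAC subrr add0r.
split=> //; split=> //=; rewrite /S2 /=; apply: (le_trans AB).
by apply: normD_le => //; apply: hB.
Qed.

End perturb_rank.

(** * Differential calculus on relatively open subsets of a half-space *)

Section is_jac.
Context {R : realType}.

Definition cont_on (V W : normedModType R) (A : set V) (G : V -> W) : Prop :=
  forall x, A x -> forall e : R, 0 < e ->
    exists2 d : R, 0 < d & forall y, A y -> `|y - x| < d -> `|G y - G x| <= e.

Lemma cont_onP (V W : normedModType R) (A : set V) (G : V -> W) :
  {within A, continuous G} <-> cont_on A G.
Proof.
rewrite subspace_continuousP; split=> h x Ax.
  move=> e e0; have /(_ _ Ax) /cvgrPdist_le /(_ e e0) := h.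
  rewrite near_withinE => /nbhs_ballP [d d0 hd]; exists d => // y Ay yx.
  by rewrite distrC; apply: hd => //; rewrite -ball_normE /= distrC.
apply/cvgrPdist_le => e e0; rewrite near_withinE; have [d d0 hd] := h x Ax e e0.
apply/nbhs_ballP; exists d => // y; rewrite -ball_normE /= => yx Ay.
by rewrite distrC; apply: hd => //; rewrite distrC.
Qed.

Lemma cont_on_sub (V W : normedModType R) (A B : set V) (G : V -> W) :
  B `<=` A -> cont_on A G -> cont_on B G.
Proof.
move=> BA cG x Bx e e0; have [d d0 h] := cG x (BA _ Bx) e e0.
by exists d => // y /BA; apply: h.
Qed.

Context {n : nat}.
Local Notation H := (@halfspace R n).

(** The differential as a relation given by an explicit estimate: candidates can be exhibited and
    combined freely, and are identified with [jacobian_within] only where uniqueness holds. *)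
Definition is_jac (m : nat) (A : set 'rV[R]_n) (g : 'rV[R]_n -> 'rV[R]_m)
    (x : 'rV[R]_n) (J : 'M[R]_(n, m)) : Prop :=
  forall e : R, 0 < e -> exists2 d : R, 0 < d &
    forall y, A y -> `|y - x| < d -> `|g y - g x - (y - x) *m J| <= e * `|y - x|.

Definition C1w (m : nat) (A : set 'rV[R]_n) (g : 'rV[R]_n -> 'rV[R]_m)
    (G : 'rV[R]_n -> 'M[R]_(n, m)) : Prop :=
  (forall x, A x -> is_jac A g x (G x)) /\ cont_on A G.

Definition hopen (A : set 'rV[R]_n) : Prop :=
  A `<=` H /\ forall x, A x -> exists2 r : R, 0 < r &
    forall y, H y -> `|y - x| < r -> A y.

Lemma halfspace_convex x y (t : R) : H x -> H y -> 0 <= t <= 1 ->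
  H (x + t *: (y - x)).
Proof.
move=> hx hy /andP [t0 t1] i i0; rewrite !mxE.
have := hx i i0; have := hy i i0; nra.
Qed.

Lemma hopen_openI V : open V -> hopen (V `&` H).
Proof.
move=> oV; split=> [x []//|x [Vx _]].
have /nbhs_ballP [r /= r0 h] := open_nbhs_nbhs (conj oV Vx).
by exists r => // y Hy yx; split=> //; apply: h; rewrite -ball_normE /= distrC.
Qed.

Lemma is_jac_lip m A (g : 'rV[R]_n -> 'rV[R]_m) x J : is_jac A g x J ->
  exists2 d : R, 0 < d & forall y, A y -> `|y - x| < d ->
    `|g y - g x| <= (n%:R * `|J| + 1) * `|y - x|.
Proof.
move=> /(_ 1 ltr01) [d d0 h]; exists d => // y Ay yx.
rewrite -(subrK ((y - x) *m J) (g y - g x)).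
apply: (le_trans (ler_normD _ _)); rewrite mulrDl addrC; apply: lerD; last exact: h.
by apply: (le_trans (mx_norm_mul _ _)); rewrite mulrAC.
Qed.

Lemma is_jac_cont m A (g : 'rV[R]_n -> 'rV[R]_m) x J : is_jac A g x J ->
  forall e : R, 0 < e -> exists2 d : R, 0 < d &
    forall y, A y -> `|y - x| < d -> `|g y - g x| <= e.
Proof.
move=> /is_jac_lip [d d0 h] e e0.
have k0 : 0 < n%:R * `|J| + 1 :> R by rewrite ltr_wpDl // mulr_ge0.
exists (Num.min d (e / (n%:R * `|J| + 1))) => [|y Ay].
  by rewrite lt_min d0 divr_gt0.
rewrite lt_min => /andP [/(h _ Ay) h1]; rewrite ltr_pdivlMr // => h2.
by apply: (le_trans h1); rewrite mulrC ltW.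
Qed.

Lemma C1w_cont m A (g : 'rV[R]_n -> 'rV[R]_m) G : C1w A g G -> cont_on A g.
Proof. by move=> [h _] x /h /is_jac_cont. Qed.

(** From a point of a relatively open subset of the half-space, a small positive multiple of each
    basis vector can be added without leaving the subset, since no coordinate decreases. This
    determines every row of the Jacobian. *)
Lemma is_jac_uniq m A (g : 'rV[R]_n -> 'rV[R]_m) x J J' : hopen A -> A x ->
  is_jac A g x J -> is_jac A g x J' -> J = J'.
Proof.
move=> [AH oA] Ax h h'; apply/eqP; rewrite -subr_eq0; apply/eqP/row_matrixP => i.
rewrite row0 rowE; set v : 'rV[R]_n := delta_mx 0 i.
have v1 : `|v| = 1.
  apply/le_anti/andP; split.
    by apply: mx_norm_le => // u j; rewrite mxE; case: (_ && _); rewrite ?normr1 ?normr0.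
  by have := mx_coef_norm v ord0 i; rewrite mxE !eqxx normr1.
apply/eqP; rewrite -normr_le0; apply/ler_addgt0Pr => e e0; rewrite add0r.
have e20 : 0 < e / 2 by rewrite divr_gt0.
have [d d0 hd] := h _ e20; have [d' d'0 hd'] := h' _ e20.
have [r r0 hr] := oA x Ax.
pose t := Num.min (Num.min d d') r / 2.
have t0 : 0 < t by rewrite divr_gt0 // !lt_min d0 d'0.
have tlt : t < Num.min (Num.min d d') r by rewrite ltr_pdivrMr // ltr_pMr ?ltr1n // !lt_min d0 d'0.
move: tlt; rewrite !lt_min => /andP [/andP [td td'] tr].
have nt : `|x + t *: v - x| = t by rewrite addrC addKr normrZ v1 mulr1 gtr0_norm.
have Hxt : H (x + t *: v).
  move=> j j0; rewrite !mxE; apply: addr_ge0; first exact: AH.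
  by apply: mulr_ge0; [exact: ltW|exact: ler0n].
have Axt : A (x + t *: v) by apply: hr; rewrite ?nt.
have := hd _ Axt; rewrite nt => /(_ td) E1.
have := hd' _ Axt; rewrite nt => /(_ td') E2.
move: E1 E2; rewrite (addrC x) addrK -!scalemxAl; set D := g _ - g x => E1 E2.
have : t * `|v *m (J - J')| <= t * e.
  rewrite -{1}(gtr0_norm t0) -normrZ mulmxBr scalerBr.
  have -> : t *: (v *m J) - t *: (v *m J') = (D - t *: (v *m J')) - (D - t *: (v *m J)).
    by rewrite opprB [RHS]addrC addrA subrK.
  apply: (le_trans (ler_normB _ _)); lra.
by rewrite ler_pM2l.
Qed.

Lemma is_jac_local m A A' (g g' : 'rV[R]_n -> 'rV[R]_m) x J : A x ->
  (exists2 r : R, 0 < r & forall y, A y -> `|y - x| < r -> A' y /\ g y = g' y) ->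
  is_jac A' g' x J -> is_jac A g x J.
Proof.
move=> Ax [r r0 hr] h e e0; have [d d0 hd] := h e e0.
exists (Num.min d r); first by rewrite lt_min d0.
move=> y Ay; rewrite lt_min => /andP [yd yr].
have [A'y ->] := hr y Ay yr.
have [|_ ->] := hr x Ax; first by rewrite subrr normr0.
exact: hd.
Qed.

Lemma is_jac_sub m A A' (g : 'rV[R]_n -> 'rV[R]_m) x J : A `<=` A' ->
  is_jac A' g x J -> is_jac A g x J.
Proof.
move=> AA h e e0; have [d d0 hd] := h e e0.
by exists d => // y /AA; apply: hd.
Qed.

Lemma is_jac_add m A (g g' : 'rV[R]_n -> 'rV[R]_m) x J J' :
  is_jac A g x J -> is_jac A g' x J' -> is_jac A (fun y => g y + g' y) x (J + J').
Proof.
move=> h h' e e0; have e20 : 0 < e / 2 by rewrite divr_gt0.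
have [d d0 hd] := h _ e20; have [d' d'0 hd'] := h' _ e20.
exists (Num.min d d'); first by rewrite lt_min d0.
move=> y Ay; rewrite lt_min => /andP [/(hd _ Ay) E1 /(hd' _ Ay) E2].
have -> : g y + g' y - (g x + g' x) - (y - x) *m (J + J') =
    (g y - g x - (y - x) *m J) + (g' y - g' x - (y - x) *m J').
  by rewrite mulmxDr; apply/rowP => j; rewrite !mxE; ring.
apply: (le_trans (ler_normD _ _)); lra.
Qed.

Lemma is_jac_affine m A (b : 'rV[R]_m) (B : 'M[R]_(n, m)) x :
  is_jac A (fun y => b + y *m B) x B.
Proof.
move=> e e0; exists 1 => // y _ _.
have -> : b + y *m B - (b + x *m B) - (y - x) *m B = 0.
  by rewrite mulmxBl; apply/rowP => j; rewrite !mxE; ring.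
by rewrite normr0 mulr_ge0 // ltW.
Qed.

Lemma is_jac_cst m A (b : 'rV[R]_m) x : is_jac A (fun=> b) x 0.
Proof.
by move=> e e0; exists 1 => // y _ _; rewrite subrr mulmx0 subr0 normr0 mulr_ge0 // ltW.
Qed.

Definition is_grad (A : set 'rV[R]_n) (a : 'rV[R]_n -> R) (x : 'rV[R]_n)
    (d : 'cV[R]_n) : Prop :=
  forall e : R, 0 < e -> exists2 r : R, 0 < r &
    forall y, A y -> `|y - x| < r ->
      `|a y - a x - ((y - x) *m d) ord0 ord0| <= e * `|y - x|.

Lemma is_grad_jac A a x d :
  is_grad A a x d <-> is_jac A (fun y => (a y)%:M : 'rV_1) x d.
Proof.
have E y : `|(a y)%:M - (a x)%:M - (y - x) *m d : 'rV[R]_1| =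
           `|a y - a x - ((y - x) *m d) ord0 ord0|.
  set u := a y - _ - _.
  have -> : (a y)%:M - (a x)%:M - (y - x) *m d = u%:M :> 'rV_1.
    by rewrite [_ *m d]mx11_scalar -!raddfB.
  apply/le_anti/andP; split.
    by apply: mx_norm_le => // i j; rewrite !ord1 mxE eqxx.
  by have := mx_coef_norm (u%:M : 'rV[R]_1) ord0 ord0; rewrite mxE eqxx.
split=> h e e0; have [r r0 hr] := h e e0; exists r => // y Ay yx.
  by rewrite E; apply: hr.
by rewrite -E; apply: hr.
Qed.

Lemma is_grad_lip A a x d : is_grad A a x d ->
  exists2 r : R, 0 < r & forall y, A y -> `|y - x| < r ->
    `|a y - a x| <= (n%:R * `|d| + 1) * `|y - x|.
Proof.
move=> /(_ 1 ltr01) [r r0 h]; exists r => // y Ay yx.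
rewrite -(subrK (((y - x) *m d) ord0 ord0) (a y - a x)).
apply: (le_trans (ler_normD _ _)); rewrite mulrDl addrC; apply: lerD; last exact: h.
apply: (le_trans (mx_coef_norm _ _ _)); apply: (le_trans (mx_norm_mul _ _)).
by rewrite mulrAC.
Qed.

Lemma is_jac_scale m A (a : 'rV[R]_n -> R) (g : 'rV[R]_n -> 'rV[R]_m) x d J :
  is_grad A a x d -> is_jac A g x J ->
  is_jac A (fun y => a y *: g y) x (a x *: J + d *m g x).
Proof.
move=> ha hg e e0.
have [r1 r10 h1] := is_grad_lip ha.
set L := _ + 1 in h1; have L0 : 0 < L by rewrite ltr_wpDl // mulr_ge0.
have [r2 r20 h2] : exists2 r : R, 0 < r & forall y, A y -> `|y - x| < r ->
    `|g y - g x - (y - x) *m J| <= e / 3 / (`|a x| + 1) * `|y - x|.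
  by apply: hg; rewrite !divr_gt0 // ltr_wpDl.
have [r3 r30 h3] : exists2 r : R, 0 < r & forall y, A y -> `|y - x| < r ->
    `|a y - a x - ((y - x) *m d) ord0 ord0| <= e / 3 / (`|g x| + 1) * `|y - x|.
  by apply: ha; rewrite !divr_gt0 // ltr_wpDl.
have [r4 r40 h4] : exists2 r : R, 0 < r & forall y, A y -> `|y - x| < r ->
    `|g y - g x| <= e / 3 / L.
  by apply: (is_jac_cont hg); rewrite !divr_gt0.
exists (Num.min (Num.min r1 r2) (Num.min r3 r4)); first by rewrite !lt_min r10 r20 r30.
move=> y Ay; rewrite !lt_min => /andP [/andP [/(h1 _ Ay) {}h1 /(h2 _ Ay) {}h2]].
move=> /andP [/(h3 _ Ay) {}h3 /(h4 _ Ay) {}h4].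
have -> : a y *: g y - a x *: g x - (y - x) *m (a x *: J + d *m g x) =
    a x *: (g y - g x - (y - x) *m J) +
    (a y - a x - ((y - x) *m d) ord0 ord0) *: g x + (a y - a x) *: (g y - g x).
  rewrite mulmxDr mulmxA {1}[(y - x) *m d]mx11_scalar mul_scalar_mx -scalemxAr.
  apply/rowP => j; rewrite !mxE; ring.
have q1 : `|a x| * (e / 3 / (`|a x| + 1)) <= e / 3.
  by rewrite mulrCA ger_pMr ?divr_gt0 // ler_pdivrMr ?ltr_wpDl // mul1r lerDl.
have q2 : `|g x| * (e / 3 / (`|g x| + 1)) <= e / 3.
  by rewrite mulrCA ger_pMr ?divr_gt0 // ler_pdivrMr ?ltr_wpDl // mul1r lerDl.
have q3 : L * (e / 3 / L) = e / 3 by rewrite mulrC divfK // gt_eqF.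
have -> : e * `|y - x| = e / 3 * `|y - x| + e / 3 * `|y - x| + e / 3 * `|y - x| by field.
apply: normD_le.
  apply: (le_trans (ler_normD _ _)); rewrite !normrZ; apply: lerD.
    apply: (le_trans (ler_wpM2l _ h2)) => //; rewrite mulrA; exact: ler_wpM2r.
  rewrite mulrC; apply: (le_trans (ler_wpM2l _ h3)) => //; rewrite mulrA; exact: ler_wpM2r.
rewrite normrZ -q3; apply: (le_trans (ler_pM _ _ h1 h4)) => //.
by rewrite [leRHS]mulrAC.
Qed.

Lemma is_jac_comp p A B (g : 'rV[R]_n -> 'rV[R]_n) (k : 'rV[R]_n -> 'rV[R]_p) x J J' :
  (forall y, A y -> B (g y)) -> is_jac A g x J -> is_jac B k (g x) J' ->
  is_jac A (k \o g) x (J *m J').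
Proof.
move=> AB hg hk e e0.
have [r1 r10 h1] := is_jac_lip hg.
set L := _ + 1 in h1; have L0 : 0 < L by rewrite ltr_wpDl // mulr_ge0.
have [r2 r20 h2] : exists2 r : R, 0 < r & forall y, B y -> `|y - g x| < r ->
    `|k y - k (g x) - (y - g x) *m J'| <= e / 2 / L * `|y - g x|.
  by apply: hk; rewrite !divr_gt0.
have M0 : 0 < n%:R * `|J'| + 1 :> R by rewrite ltr_wpDl // mulr_ge0.
have [r3 r30 h3] : exists2 r : R, 0 < r & forall y, A y -> `|y - x| < r ->
    `|g y - g x - (y - x) *m J| <= e / 2 / (n%:R * `|J'| + 1) * `|y - x|.
  by apply: hg; rewrite !divr_gt0.
exists (Num.min (Num.min r1 r3) (r2 / L)).
  by rewrite !lt_min r10 r30 divr_gt0.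
move=> y Ay; rewrite !lt_min => /andP [/andP [/(h1 _ Ay) {}h1 /(h3 _ Ay) {}h3]].
rewrite ltr_pdivlMr // mulrC => /(le_lt_trans h1) /(h2 _ (AB _ Ay)) {}h2 /=.
have -> : k (g y) - k (g x) - (y - x) *m (J *m J') =
    (k (g y) - k (g x) - (g y - g x) *m J') + (g y - g x - (y - x) *m J) *m J'.
  by rewrite [(_ - (y - x) *m J) *m J']mulmxBl mulmxA addrA subrK.
have -> : e * `|y - x| = e / 2 * `|y - x| + e / 2 * `|y - x| by field.
apply: normD_le.
  apply: (le_trans h2); rewrite [leRHS](_ : _ = e / 2 / L * (L * `|y - x|)); last first.
    by rewrite mulrA divfK // gt_eqF.
  by rewrite ler_wpM2l // !divr_ge0 // ltW.
apply: (le_trans (mx_norm_mul _ _)).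
rewrite mulrAC; apply: (le_trans (ler_wpM2l _ h3)); first by rewrite mulr_ge0.
rewrite mulrA ler_wpM2r // mulrCA ger_pMr ?divr_gt0 // ler_pdivrMr // mul1r lerDl //.
Qed.

End is_jac.

(** * Comparison of [is_jac] with the differential along a filter *)

Section bridge.
Context {R : realType} {n : nat}.
Local Notation H := (@halfspace R n).

(** The differential along a filter is based at the limit of the filter; this identifies the base
    point. *)
Lemma lim_within (A : set 'rV[R]_n) x : A x -> lim (within A (nbhs x)) = x.
Proof.
move=> Ax.
have PF : ProperFilter (within A (nbhs x)).
  by apply: Build_ProperFilter_ex => P /nbhs_singleton Px; exists x; exact: Px.
apply: (@cvg_lim _ (@norm_hausdorff R _) _ _ PF id x).
exact: cvg_within.
Qed.

Lemma mulmxr_continuous m (J : 'M[R]_(n, m)) : continuous (fun v : 'rV[R]_n => v *m J).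
Proof.
move=> v; apply/(@cvgrPdist_le _ _ _ (nbhs v) _ _ (v *m J)) => e e0.
have k0 : 0 < n%:R * `|J| + 1 :> R by rewrite ltr_wpDl // mulr_ge0.
apply/nbhs_ballP; exists (e / (n%:R * `|J| + 1)) => /= [|w]; first by rewrite divr_gt0.
rewrite -ball_normE /= ltr_pdivlMr // => vw.
rewrite -mulmxBl; apply: (le_trans (mx_norm_mul _ _)).
rewrite mulrAC mulrC; apply: le_trans (ltW vw).
by rewrite ler_wpM2l // lerDl.
Qed.

Lemma is_jacP m (A : set 'rV[R]_n) (g : 'rV[R]_n -> 'rV[R]_m) x J :
  is_jac A g x J <->
  (forall e : R, 0 < e -> \forall y \near within A (nbhs x),
    `|g y - g x - (y - x) *m J| <= e * `|y - x|).
Proof.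
split=> h e e0.
  rewrite near_withinE; have [d d0 hd] := h e e0; apply/nbhs_ballP; exists d => //= y.
  by rewrite -ball_normE /= distrC => yx Ay; apply: hd.
have := h e e0; rewrite near_withinE => /nbhs_ballP [d d0 hd]; exists d => // y Ay yx.
by apply: hd => //; rewrite -ball_normE /= distrC.
Qed.

Lemma differentiable_is_jac m (A : set 'rV[R]_n) (g : 'rV[R]_n -> 'rV[R]_m) x :
  A x -> differentiable g (within A (nbhs x)) ->
  is_jac A g x (jacobian_within A g x).
Proof.
move=> Ax [[_ dg]]; apply/is_jacP => e e0.
move/eqaddoP: dg => /(_ e e0); rewrite lim_within //.
apply: filterS => y /=.
by rewrite /jacobian_within mul_rV_lin1 !fctE /= opprD addrA.
Qed.

Lemma is_jac_differentiable m (A : set 'rV[R]_n) (g : 'rV[R]_n -> 'rV[R]_m) x J :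
  A x -> is_jac A g x J -> differentiable g (within A (nbhs x)).
Proof.
move=> Ax /is_jacP hJ.
(* The differential is selected by choice among the linear maps with property [P]; exhibiting
   [mulmxr J] shows that the selected one has it. *)
pose P (df : {linear 'rV[R]_n -> 'rV[R]_m}) := continuous df /\
  forall y, g y = g (lim (within A (nbhs x))) + df (y - lim (within A (nbhs x)))
    +o_(y \near within A (nbhs x)) (y - lim (within A (nbhs x))).
have ex : exists df, P df.
  exists (mulmxr J : {linear 'rV[R]_n -> 'rV[R]_m}); split.
    exact: mulmxr_continuous.
  pose F := within A (nbhs x).
  have E : g = (fun y => g (lim F) + (y - lim F) *m J) +o_F (fun y => y - lim F).
    apply/eqaddoP => e e0; have := hJ e e0; rewrite lim_within //.
    by apply: filterS => y; rewrite !fctE /= opprD addrA.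
  by move=> y; have := congr1 (fun f => f y) E.
have [c1 c2] := getPex ex.
by split; split; [exact: c1|rewrite funeqE].
Qed.

Lemma C1_onP m (A : set 'rV[R]_n) (g : 'rV[R]_n -> 'rV[R]_m) :
  C1_on A g <-> C1w A g (jacobian_within A g).
Proof.
split=> -[h1 h2]; split; try exact/cont_onP.
  by move=> x Ax; apply: differentiable_is_jac => //; apply: h1.
by move=> x Ax; apply: is_jac_differentiable (h1 x Ax).
Qed.

Lemma jacobian_withinE m (A : set 'rV[R]_n) (g : 'rV[R]_n -> 'rV[R]_m) x J :
  hopen A -> A x -> is_jac A g x J -> jacobian_within A g x = J.
Proof.
move=> hA Ax hJ; apply: (is_jac_uniq hA Ax _ hJ).
by apply: differentiable_is_jac => //; apply: is_jac_differentiable hJ.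
Qed.

End bridge.

(** * The mean value inequality *)

Section mean_value.
Context {R : realType}.

Lemma is_derive_eps (f : R -> R) (t v : R) :
  (forall e : R, 0 < e -> exists2 d : R, 0 < d & forall s, `|s - t| < d ->
     `|f s - f t - (s - t) * v| <= e * `|s - t|) ->
  is_derive t 1 f v.
Proof.
move=> h.
have c : (fun k => k^-1 *: ((f \o shift t) (k *: 1) - f t)) @ 0^' --> v.
  apply/cvgrPdist_le => e e0; have [d d0 hd] := h e e0.
  rewrite near_withinE; apply/nbhs_ballP; exists d => //= k.
  rewrite -ball_normE /= sub0r normrN => kd k0.
  have := hd (k + t); rewrite addrK => /(_ kd) hk.
  have -> : k *: 1 = k :> R by rewrite /GRing.scale /= mulr1.
  rewrite distrC -(ler_pM2r (x := `|k|)) ?normr_gt0 // -normrM.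
  have -> : (k^-1 *: (f (k + t) - f t) - v) * k = f (k + t) - f t - k * v.
    by rewrite /GRing.scale /=; field.
  exact: hk.
by apply: DeriveDef; [apply/cvg_ex; exists v|apply: cvg_lim].
Qed.

(** The maximum norm allows one coordinate at a time: the one-variable theorem is applied to
    coordinate [j] of [g - J0] along the segment. Derivatives are taken along [D], which only has to
    contain the segment. *)
Lemma mvt_ineq n m (D : set 'rV[R]_n) (g : 'rV[R]_n -> 'rV[R]_m)
    (G : 'rV[R]_n -> 'M[R]_(n, m)) (J0 : 'M[R]_(n, m)) (w : R) x y :
  (forall t, 0 <= t <= 1 -> D (x + t *: (y - x))) ->
  (forall z, D z -> is_jac D g z (G z)) -> (forall z, D z -> `|G z - J0| <= w) ->
  `|g y - g x - (y - x) *m J0| <= n%:R * w * `|y - x|.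
Proof.
move=> Dseg hG hw.
have Dx : D x by have := Dseg 0; rewrite scale0r addr0 lexx ler01; apply.
have w0 : 0 <= w by apply: le_trans (hw x Dx).
apply: mx_norm_le => [|i j]; first by rewrite !mulr_ge0.
rewrite ord1 => {i}.
pose c (t : R) := x + t *: (y - x).
pose f (t : R) := g (c t) ord0 j - t * ((y - x) *m J0) ord0 j.
pose df (t : R) := ((y - x) *m (G (c t) - J0)) ord0 j.
have est (t e : R) : 0 <= t <= 1 -> 0 < e -> exists2 d : R, 0 < d & forall s,
    0 <= s <= 1 -> `|s - t| < d -> `|f s - f t - (s - t) * df t| <= e * `|s - t|.
  move=> t01 e0; have k0 : 0 < `|y - x| + 1 by rewrite ltr_wpDl.
  have [d d0 hd] := hG _ (Dseg t t01) _ (divr_gt0 e0 k0).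
  exists (d / (`|y - x| + 1)) => [|s s01]; first by rewrite divr_gt0.
  rewrite ltr_pdivlMr // => st.
  have cst : c s - c t = (s - t) *: (y - x).
    by rewrite /c opprD addrACA subrr add0r scalerBl.
  have ncst : `|c s - c t| <= `|s - t| * (`|y - x| + 1).
    by rewrite cst normrZ ler_wpM2l // lerDl.
  have := hd (c s) (Dseg s s01) (le_lt_trans ncst st).
  move=> /(le_trans (mx_coef_norm _ ord0 j)) h.
  have -> : f s - f t - (s - t) * df t =
      (g (c s) - g (c t) - (c s - c t) *m G (c t)) ord0 j.
    rewrite /f /df cst mulmxBr -!scalemxAl !mxE; ring.
  apply: (le_trans h); rewrite -mulrA ler_wpM2l ?(ltW e0) //.
  by rewrite mulrC ler_pdivrMr.
have [||t t01] := @MVT_segment R f df 0 1 ler01.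
- move=> t; rewrite in_itv /= => /andP [t0 t1].
  apply: is_derive_eps => e e0; have [|d d0 hd] := est t e _ e0.
    by rewrite !ltW.
  exists (Num.min d (Num.min t (1 - t))) => [|s].
    by rewrite !lt_min d0 t0 subr_gt0.
  rewrite !lt_min => /and3P [sd st1 st2]; apply: hd => //.
  by move: st1 st2; rewrite !ltr_norml => /andP [? ?] /andP [? ?]; apply/andP; split; lra.
- apply/(@cont_onP R R R) => t; rewrite /= in_itv /= => t01 e e0.
  have [d d0 hd] := est t 1 t01 ltr01.
  have k0 : 0 < `|df t| + 1 by rewrite ltr_wpDl.
  exists (Num.min d (e / (`|df t| + 1))) => [|s]; first by rewrite lt_min d0 divr_gt0.
  rewrite /= in_itv /= => s01; rewrite lt_min ltr_pdivlMr // => /andP [/(hd _ s01) h1 h2].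
  apply: le_trans (ltW h2); rewrite -(subrK ((s - t) * df t) (f s - f t)).
  apply: (le_trans (ler_normD _ _)); rewrite mulrDr mulr1 addrC -normrM lerD2l.
  by rewrite -[leRHS]mul1r.
have c1 : c 1 = y by rewrite /c scale1r addrC subrK.
have c0 : c 0 = x by rewrite /c scale0r addr0.
rewrite subr0 mulr1 /f c1 c0 mul1r mul0r subr0 => e.
have -> : (g y - g x - (y - x) *m J0) ord0 j = df t.
  rewrite -e !mxE; ring.
rewrite /df; apply: (le_trans (mx_coef_norm _ _ _)); apply: (le_trans (mx_norm_mul _ _)).
rewrite -!mulrA ler_wpM2l // [leRHS]mulrC ler_wpM2l //; apply: hw; apply: Dseg.
by move: t01; rewrite in_itv.
Qed.

End mean_value.

(** * Bump functions with Lipschitz derivatives *)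

Section blip.
Context {R : realType} {V : normedModType R}.
Implicit Type Y : set V.

(** Bounded and Lipschitz with a common constant: the bound is what makes the class stable under
    products. *)
Definition blip (W : normedModType R) Y (g : V -> W) : Prop :=
  exists2 C : R, 0 <= C & (forall x, Y x -> `|g x| <= C) /\
    forall x y, Y x -> Y y -> `|g x - g y| <= C * `|x - y|.

Lemma blip_ext (W : normedModType R) Y (g g' : V -> W) :
  (forall x, Y x -> g x = g' x) -> blip Y g -> blip Y g'.
Proof.
move=> e [C C0 [h1 h2]]; exists C => //; split=> [x Yx|x y Yx Yy].
  by rewrite -e //; apply: h1.
by rewrite -!e //; apply: h2.
Qed.

Lemma blip_cst (W : normedModType R) Y (b : W) : blip Y (fun=> b).
Proof.
by exists `|b| => //; split=> // x y _ _; rewrite subrr normr0 mulr_ge0.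
Qed.

Lemma blip_id Y (B : R) : (forall x, Y x -> `|x| <= B) -> blip Y id.
Proof.
move=> hB; exists (`|B| + 1); first by rewrite addr_ge0.
split=> [x /hB h|x y _ _ /=].
  by apply: (le_trans h); apply: (le_trans (ler_norm _)); rewrite lerDl.
by rewrite -[leLHS]mul1r ler_wpM2r // lerDr.
Qed.

Lemma blip_add (W : normedModType R) Y (g g' : V -> W) :
  blip Y g -> blip Y g' -> blip Y (fun x => g x + g' x).
Proof.
move=> [C C0 [h1 h2]] [C' C'0 [h1' h2']]; exists (C + C'); first exact: addr_ge0.
split=> [x Yx|x y Yx Yy].
  by apply: normD_le; [exact: h1|exact: h1'].
by rewrite opprD addrACA mulrDl; apply: normD_le; [exact: h2|exact: h2'].
Qed.

Lemma blip_bilinear (W1 W2 W : normedModType R) (b : W1 -> W2 -> W) (K : R) Y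
    (g : V -> W1) (g' : V -> W2) :
  (forall u v, `|b u v| <= K * `|u| * `|v|) ->
  (forall u u' v, b (u - u') v = b u v - b u' v) ->
  (forall u v v', b u (v - v') = b u v - b u v') ->
  blip Y g -> blip Y g' -> blip Y (fun x => b (g x) (g' x)).
Proof.
move=> hK bl br [C C0 [h1 h2]] [C' C'0 [h1' h2']].
have {}hK u v : `|b u v| <= `|K| * `|u| * `|v|.
  by apply: (le_trans (hK _ _)); rewrite !ler_wpM2r // ler_norm.
exists (2 * (`|K| * C * C')); first by rewrite !mulr_ge0.
split=> [x Yx|x y Yx Yy].
  apply: (le_trans (hK _ _)).
  apply: (@le_trans _ _ (`|K| * C * C')).
    by apply: ler_pM; rewrite ?mulr_ge0 ?h1' // ler_wpM2l ?h1.
  by rewrite ler_peMl ?mulr_ge0 // ler1n.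
have -> : b (g x) (g' x) - b (g y) (g' y) = b (g x - g y) (g' x) + b (g y) (g' x - g' y).
  by rewrite bl br addrA subrK.
have -> : 2 * (`|K| * C * C') * `|x - y| =
    `|K| * C * C' * `|x - y| + `|K| * C * C' * `|x - y| by ring.
apply: normD_le.
  apply: (le_trans (hK _ _)).
  have -> : `|K| * C * C' * `|x - y| = `|K| * (C * `|x - y|) * C' by ring.
  by apply: ler_pM; rewrite ?mulr_ge0 ?h1' // ler_wpM2l ?h2.
apply: (le_trans (hK _ _)); rewrite -[leRHS]mulrA.
by apply: ler_pM; rewrite ?mulr_ge0 ?h2' // ler_wpM2l ?h1.
Qed.

Lemma blip_scale (W : normedModType R) Y (a : V -> R) (g : V -> W) :
  blip Y a -> blip Y g -> blip Y (fun x => a x *: g x).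
Proof.
apply: (@blip_bilinear R W W ( *:%R) 1) => [u v|u u' v|u v v'].
- by rewrite normrZ mul1r.
- by rewrite scalerBl.
- by rewrite scalerBr.
Qed.

Lemma blip_mul Y (a b : V -> R) : blip Y a -> blip Y b -> blip Y (fun x => a x * b x).
Proof. exact: (@blip_scale R). Qed.

Lemma blip_mulmx m n p Y (A : V -> 'M[R]_(m, n)) (B : V -> 'M[R]_(n, p)) :
  blip Y A -> blip Y B -> blip Y (fun x => A x *m B x).
Proof.
apply: (@blip_bilinear _ _ _ _ n%:R) => [u v|u u' v|u v v'].
- exact: mx_norm_mul.
- by rewrite mulmxBl.
- by rewrite mulmxBr.
Qed.

Lemma blip_lip (W W' : normedModType R) Y (k : W -> W') (L c : R) (g : V -> W) :
  0 <= L -> (forall u v, `|k u - k v| <= L * `|u - v|) -> `|k 0| <= c ->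
  blip Y g -> blip Y (fun x => k (g x)).
Proof.
move=> L0 kL kc [C C0 [h1 h2]]; exists (L * C + c).
  by rewrite addr_ge0 ?mulr_ge0 // (le_trans _ kc).
split=> [x Yx|x y Yx Yy].
  rewrite -(subrK (k 0) (k _)); apply: (le_trans (ler_normD _ _)).
  apply: lerD => //; apply: (le_trans (kL _ _)); rewrite subr0.
  by rewrite ler_wpM2l ?h1.
apply: (le_trans (kL _ _)); apply: (@le_trans _ _ (L * C * `|x - y|)).
  by rewrite -mulrA ler_wpM2l ?h2.
by rewrite ler_wpM2r // lerDl (le_trans _ kc).
Qed.

Lemma blip_cont (W : normedModType R) (g : V -> W) :
  (forall x, exists2 r : R, 0 < r & blip [set y | `|y - x| < r] g) ->
  forall A : set V, cont_on A g.
Proof.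
move=> h A x Ax e e0; have [r r0 [C C0 [_ hC]]] := h x.
have C1 : 0 < C + 1 by rewrite ltr_wpDl.
exists (Num.min r (e / (C + 1))) => [|y _]; first by rewrite lt_min r0 divr_gt0.
rewrite lt_min ltr_pdivlMr // => /andP [yr ye].
apply: (le_trans (hC _ _ yr _)); first by rewrite /= subrr normr0.
by apply: le_trans (ltW ye); rewrite mulrC ler_wpM2l // lerDl.
Qed.

End blip.

Section bump.
Context {R : realType}.

Definition pos_part (u : R) : R := Num.max 0 u.

Lemma pos_partB (u v : R) : `|pos_part u - pos_part v| <= 1 * `|u - v|.
Proof.
rewrite /pos_part mul1r; case: (leP 0 u) => hu; case: (leP 0 v) => hv;
  rewrite ?subrr ?normr0 ?subr0 ?sub0r ?normrN //.
- by rewrite (ger0_norm hu) ler_normr; apply/orP; left; lra.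
- by rewrite (ger0_norm hv) ler_normr; apply/orP; right; lra.
Qed.

(** The square of the positive part is C^1 with the Lipschitz derivative [2 * pos_part u]. This is
    the regularity required of the bump functions, which are built from it. *)
Lemma sqr_pos_taylor (u v : R) :
  `|pos_part v ^+ 2 - pos_part u ^+ 2 - 2 * pos_part u * (v - u)| <= (v - u) ^+ 2.
Proof.
have s1 := sqr_ge0 u; have s2 := sqr_ge0 v; have s3 := sqr_ge0 (v - u).
rewrite /pos_part ler_norml; case: (leP 0 u) => hu; case: (leP 0 v) => hv.
- by apply/andP; split; lra.
- have uv : u * v <= 0 by apply: mulr_ge0_le0 => //; exact: ltW.
  by apply/andP; split; lra.
- have uv : u * v <= 0 by apply: mulr_le0_ge0 => //; exact: ltW.
  by apply/andP; split; lra.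
- by apply/andP; split; lra.
Qed.

Lemma blip_pos (V : normedModType R) (Y : set V) (a : V -> R) :
  blip Y a -> blip Y (fun x => pos_part (a x)).
Proof.
apply: (@blip_lip _ _ _ _ _ _ 1 0) => //; first exact: pos_partB.
by rewrite /pos_part maxxx normr0.
Qed.

Context {n : nat}.

Lemma is_grad_sqr_pos (A : set 'rV[R]_n) a x d : is_grad A a x d ->
  is_grad A (fun y => pos_part (a y) ^+ 2) x ((2 * pos_part (a x)) *: d).
Proof.
move=> ha e e0; have [r1 r10 h1] := is_grad_lip ha.
set L := _ + 1 in h1; have L0 : 0 < L by rewrite ltr_wpDl // mulr_ge0.
set p := pos_part (a x); have p0 : 0 <= p by rewrite /p /pos_part le_max lexx.
have k0 : 0 < 2 * p + 1 by rewrite ltr_wpDl // mulr_ge0.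
have [r2 r20 h2] := ha _ (divr_gt0 (divr_gt0 e0 (ltr0n _ 2)) k0).
exists (Num.min (Num.min r1 r2) (e / 2 / (L * L))).
  by rewrite !lt_min r10 r20 !divr_gt0 ?mulr_gt0.
move=> y Ay; rewrite !lt_min => /andP [/andP [/(h1 _ Ay) {}h1 /(h2 _ Ay) {}h2]].
rewrite ltr_pdivlMr ?mulr_gt0 // => h3.
set q := ((y - x) *m d) ord0 ord0 in h2.
have -> : ((y - x) *m ((2 * p) *: d)) ord0 ord0 = 2 * p * q.
  by rewrite -scalemxAr mxE.
have -> : pos_part (a y) ^+ 2 - p ^+ 2 - 2 * p * q =
    (pos_part (a y) ^+ 2 - p ^+ 2 - 2 * p * (a y - a x)) + 2 * p * (a y - a x - q).
  ring.
apply: (le_trans (ler_normD _ _)).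
have -> : e * `|y - x| = e / 2 * `|y - x| + e / 2 * `|y - x| by field.
apply: lerD.
  apply: (le_trans (sqr_pos_taylor _ _)).
  rewrite -real_normK ?num_real // expr2.
  apply: (le_trans (ler_pM _ _ h1 h1)) => //.
  have -> : L * `|y - x| * (L * `|y - x|) = (`|y - x| * (L * L)) * `|y - x| by ring.
  by rewrite ler_wpM2r // ltW.
rewrite normrM ger0_norm; last by rewrite mulr_ge0.
apply: (le_trans (ler_wpM2l _ h2)); first by rewrite mulr_ge0.
rewrite mulrA ler_wpM2r // mulrCA ger_pMr ?divr_gt0 // ler_pdivrMr // mul1r lerDl //.
Qed.

Lemma is_grad_affine_comp (A : set 'rV[R]_n) a x d (b c : R) : is_grad A a x d ->
  is_grad A (fun y => b + c * a y) x (c *: d).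
Proof.
move=> ha e e0; have k0 : 0 < `|c| + 1 by rewrite ltr_wpDl.
have [r r0 h] := ha _ (divr_gt0 e0 k0); exists r => // y Ay /(h y Ay) {}h.
have -> : b + c * a y - (b + c * a x) - ((y - x) *m (c *: d)) ord0 ord0 =
    c * (a y - a x - ((y - x) *m d) ord0 ord0).
  have -> : ((y - x) *m (c *: d)) ord0 ord0 = c * ((y - x) *m d) ord0 ord0.
    by rewrite -scalemxAr mxE.
  ring.
rewrite normrM; apply: (le_trans (ler_wpM2l _ h)) => //.
by rewrite mulrA ler_wpM2r // mulrCA ger_pMr // ler_pdivrMr // mul1r lerDl.
Qed.

(** Euclidean, because the norm on row vectors is the maximum norm, whose square is not
    differentiable in general. *)
Definition sqdist (v x : 'rV[R]_n) : R := ((x - v) *m (x - v)^T) ord0 ord0.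

Lemma sqdistE v x : sqdist v x = \sum_i (x ord0 i - v ord0 i) ^+ 2.
Proof. by rewrite /sqdist mxE; apply: eq_bigr => i _; rewrite !mxE expr2. Qed.

Lemma sqdist_le v x : sqdist v x <= n%:R * `|x - v| ^+ 2.
Proof.
rewrite sqdistE mulr_natl; apply: (@le_trans _ _ (\sum_(i < n) `|x - v| ^+ 2)).
  apply: ler_sum => i _; rewrite -real_normK ?num_real // ler_pXn2r ?nnegrE //.
  by have := mx_coef_norm (x - v) ord0 i; rewrite !mxE.
by rewrite sumr_const card_ord.
Qed.

Lemma is_grad_sqdist (A : set 'rV[R]_n) v x : is_grad A (sqdist v) x (2 *: (x - v)^T).
Proof.
move=> e e0; have k0 : 0 < n%:R + 1 :> R by rewrite ltr_wpDl.
exists (e / (n%:R + 1)) => [|y Ay]; first by rewrite divr_gt0.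
rewrite ltr_pdivlMr // => h.
have -> : sqdist v y - sqdist v x - ((y - x) *m (2 *: (x - v)^T)) ord0 ord0 = sqdist x y.
  rewrite !sqdistE mxE -!sumrB; apply: eq_bigr => i _; rewrite !mxE; ring.
rewrite ger0_norm; last by rewrite sqdistE sumr_ge0 // => i _; rewrite sqr_ge0.
apply: (le_trans (sqdist_le _ _)); rewrite expr2 mulrA ler_wpM2r //.
by apply: le_trans (ltW h); rewrite mulrC ler_wpM2l // lerDl.
Qed.

Lemma mul_rowT_le (u : 'rV[R]_n) : `|u^T| <= `|u|.
Proof. by apply: mx_norm_le => // i j; rewrite mxE mx_coef_norm. Qed.

(** With [s] the squared Euclidean distance to [v], [psi = (1 - (s / d^2 - 1)_+^2)_+^2] is [1] for
    [s <= d^2] and [0] for [s >= 2 d^2]. In the maximum norm these follow from [n |x - v| <= d] and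
    [|x - v| >= 2 d]. The chain rule bounds the gradient by [2 * 2 * d^-2 * 2 * 2 d = 16 / d]. *)
Lemma bump_exists (v : 'rV[R]_n) (d : R) : 0 < d -> (0 < n)%N ->
  exists (psi : 'rV[R]_n -> R) (D : 'rV[R]_n -> 'cV[R]_n),
  [/\ (forall A x, is_grad A psi x (D x)),
      (forall x, 0 <= psi x <= 1),
      (forall x, n%:R * `|x - v| <= d -> psi x = 1 /\ D x = 0) /\
      (forall x, 2 * d <= `|x - v| -> psi x = 0 /\ D x = 0),
      (forall x, `|D x| <= 16 / d) &
      forall (Y : set 'rV[R]_n) B, (forall x, Y x -> `|x| <= B) -> blip Y psi /\ blip Y D].
Proof.
move=> d0 n0.
pose u x := -1 + (d ^+ 2)^-1 * sqdist v x.
pose w x := 1 + (-1) * pos_part (u x) ^+ 2.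
pose psi x := pos_part (w x) ^+ 2.
pose D x : 'cV[R]_n := (2 * pos_part (w x)) *: ((-1) *: ((2 * pos_part (u x)) *:
   ((d ^+ 2)^-1 *: (2 *: (x - v)^T)))).
have d20 : 0 < d ^+ 2 by rewrite exprn_gt0.
have pp0 (z : R) : 0 <= pos_part z by rewrite /pos_part le_max lexx.
have w1 x : pos_part (w x) <= 1.
  rewrite /pos_part ge_max ler01 /w mulN1r gerBl //; exact: sqr_ge0.
have far x : 2 * d ^+ 2 <= sqdist v x -> pos_part (w x) = 0.
  move=> h; have u1 : 1 <= u x.
    rewrite /u mulrC -(@lerD2l _ 1) addrA subrr add0r ler_pdivlMr //; lra.
  apply/eqP; rewrite eq_le pp0 andbT /pos_part ge_max lexx /w /pos_part.
  rewrite max_r; last lra.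
  nra.
exists psi, D; split.
- move=> A x; apply: is_grad_sqr_pos; apply: is_grad_affine_comp.
  by apply: is_grad_sqr_pos; apply: is_grad_affine_comp; apply: is_grad_sqdist.
- by move=> x; rewrite /psi sqr_ge0 /= expr_le1.
- split=> x h.
    have u0 : pos_part (u x) = 0.
      apply/eqP; rewrite eq_le pp0 andbT /pos_part ge_max lexx /u.
      rewrite mulrC -(@lerD2l _ 1) addrA subrr add0r addr0 ler_pdivrMr // mul1r.
      apply: (le_trans (sqdist_le _ _)).
      have n1 : 1 <= n%:R :> R by rewrite ler1n.
      apply: (@le_trans _ _ ((n%:R * `|x - v|) ^+ 2)); last first.
        by rewrite ler_pXn2r // nnegrE ?mulr_ge0 // ltW.
      by rewrite exprMn ler_wpM2r ?sqr_ge0 // expr2 ler_peMl.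
    rewrite /psi /D /w u0 expr0n /= !mulr0 addr0 scale0r !scaler0.
    by rewrite /pos_part max_r ?ler01 // expr1n.
  have /far p0 : 2 * d ^+ 2 <= sqdist v x.
    rewrite leNgt; apply/negP => hlt.
    have : `|x - v| <= 3 / 2 * d.
      apply: mx_norm_le => [|i j]; first by rewrite mulr_ge0 ?ltW // divr_gt0.
      rewrite ord1 !mxE -ler_sqr ?nnegrE //; last by rewrite mulr_ge0 ?ltW // divr_gt0.
      rewrite real_normK ?num_real //.
      apply: (@le_trans _ _ (sqdist v x)); last nra.
      rewrite sqdistE (bigD1 j) //= lerDl sumr_ge0 // => k _; exact: sqr_ge0.
    lra.
  by rewrite /psi /D p0 expr0n mulr0 scale0r.
- move=> x; have [/far p0|hlt] := leP (2 * d ^+ 2) (sqdist v x).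
    by rewrite /D p0 mulr0 scale0r normr0 divr_ge0 // ltW.
  have -> : `|D x| = (2 * pos_part (w x)) * ((2 * pos_part (u x)) *
      ((d ^+ 2)^-1 * (2 * `|(x - v)^T|))).
    rewrite /D normrZ (ger0_norm (mulr_ge0 _ (pp0 _))) //.
    rewrite normrZ normrN1 mul1r normrZ (ger0_norm (mulr_ge0 _ (pp0 _))) //.
    by rewrite normrZ normrZ normr_nat ger0_norm // invr_ge0 ltW.
  have u1 : pos_part (u x) <= 1.
    rewrite /pos_part ge_max ler01 /u /=.
    rewrite mulrC -(@lerD2l _ 1) addrA subrr add0r ler_pdivrMr //; lra.
  have xv : `|(x - v)^T| <= 2 * d.
    apply: (le_trans (mul_rowT_le _)).
    apply: mx_norm_le => [|i j]; first by rewrite mulr_ge0 ?ltW.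
    rewrite ord1 !mxE -ler_sqr ?nnegrE //; last by rewrite mulr_ge0 ?ltW.
    rewrite real_normK ?num_real //.
    apply: (@le_trans _ _ (sqdist v x)); last nra.
    rewrite sqdistE (bigD1 j) //= lerDl sumr_ge0 // => k _; exact: sqr_ge0.
  have -> : 16 / d = (2 * 1) * ((2 * 1) * ((d ^+ 2)^-1 * (2 * (2 * d)))).
    by field; rewrite gt_eqF.
  have i0 : 0 <= (d ^+ 2)^-1 by rewrite invr_ge0 ltW.
  apply: ler_pM; rewrite ?mulr_ge0 //; first by rewrite ler_wpM2l.
  apply: ler_pM; rewrite ?mulr_ge0 //; first by rewrite ler_wpM2l.
  by rewrite ler_wpM2l // ler_wpM2l.
- move=> Y B hB.
  have bT : blip Y (fun x : 'rV[R]_n => (x - v)^T).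
    apply: (@blip_lip _ _ _ _ Y (fun x : 'rV[R]_n => (x - v)^T) 1 `|(0 - v)^T| id) => //.
      move=> x y; rewrite mul1r -linearB /= opprB addrA subrK; exact: mul_rowT_le.
    exact: blip_id hB.
  have bX : blip Y (fun x : 'rV[R]_n => x - v).
    by apply: blip_add; [exact: blip_id hB|exact: blip_cst].
  have bu : blip Y u.
    apply: blip_add; first exact: blip_cst.
    apply: blip_mul; first exact: blip_cst.
    apply: (@blip_lip _ _ _ _ Y (fun A : 'M[R]_1 => A ord0 ord0) 1 0 (fun x => (x - v) *m (x - v)^T)) => //.
    + by move=> A A'; rewrite mul1r; have := mx_coef_norm (A - A') ord0 ord0; rewrite !mxE.
    + by rewrite mxE normr0.
    + exact: blip_mulmx.
  have bpu : blip Y (fun x => pos_part (u x)) by apply: blip_pos.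
  have bpw : blip Y (fun x => pos_part (w x)).
    apply: blip_pos; apply: blip_add; first exact: blip_cst.
    apply: blip_mul; first exact: blip_cst.
    by apply: blip_ext (blip_mul bpu bpu) => x _; rewrite expr2.
  split.
    by apply: blip_ext (blip_mul bpw bpw) => x _; rewrite /psi expr2.
  apply: blip_scale; first by apply: blip_mul => //; exact: blip_cst.
  apply: blip_scale; first exact: blip_cst.
  apply: blip_scale; first by apply: blip_mul => //; exact: blip_cst.
  apply: blip_scale; first exact: blip_cst.
  by apply: blip_scale; first exact: blip_cst.
Qed.

End bump.

(** * Algebra of continuous and of C^1 maps *)

Section cont_on_algebra.
Context {R : realType} {V : normedModType R}.
Implicit Type A : set V.

Lemma cont_on_cst (W : normedModType R) A (b : W) : cont_on A (fun=> b).
Proof. by move=> x _ e e0; exists 1 => // y _ _; rewrite subrr normr0 ltW. Qed.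

Lemma cont_on_add (W : normedModType R) A (g g' : V -> W) :
  cont_on A g -> cont_on A g' -> cont_on A (fun x => g x + g' x).
Proof.
move=> h h' x Ax e e0; have e20 : 0 < e / 2 by rewrite divr_gt0.
have [d d0 hd] := h x Ax _ e20; have [d' d'0 hd'] := h' x Ax _ e20.
exists (Num.min d d'); first by rewrite lt_min d0.
move=> y Ay; rewrite lt_min => /andP [/(hd _ Ay) E1 /(hd' _ Ay) E2].
rewrite opprD addrACA; apply: (le_trans (ler_normD _ _)); lra.
Qed.

Lemma cont_on_bilinear (W1 W2 W : normedModType R) (b : W1 -> W2 -> W) (K : R) A
    (g : V -> W1) (g' : V -> W2) :
  (forall u v, `|b u v| <= K * `|u| * `|v|) ->
  (forall u u' v, b (u - u') v = b u v - b u' v) ->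
  (forall u v v', b u (v - v') = b u v - b u v') ->
  cont_on A g -> cont_on A g' -> cont_on A (fun x => b (g x) (g' x)).
Proof.
move=> hK bl br h h' x Ax e e0.
have {}hK u v : `|b u v| <= `|K| * `|u| * `|v|.
  by apply: (le_trans (hK _ _)); rewrite !ler_wpM2r // ler_norm.
have k1 : 0 < `|K| * (`|g' x| + 1) + 1 by rewrite ltr_wpDl // mulr_ge0 // addr_ge0.
have k2 : 0 < `|K| * `|g x| + 1 by rewrite ltr_wpDl // mulr_ge0.
have e20 : 0 < e / 2 by rewrite divr_gt0.
have [d d0 hd] := h x Ax _ (divr_gt0 e20 k1).
have [d' d'0 hd'] := h' x Ax _ (divr_gt0 e20 k2).
have [d'' d''0 hd''] := h' x Ax 1 ltr01.
exists (Num.min d (Num.min d' d'')); first by rewrite !lt_min d0 d'0.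
move=> y Ay; rewrite !lt_min => /and3P [/(hd _ Ay) E1 /(hd' _ Ay) E2 /(hd'' _ Ay) E3].
have -> : b (g y) (g' y) - b (g x) (g' x) = b (g y - g x) (g' y) + b (g x) (g' y - g' x).
  by rewrite bl br addrA subrK.
have n1 : `|g' y| <= `|g' x| + 1.
  exact: norm_leD.
have -> : e = e / 2 + e / 2 by field.
apply: normD_le.
  apply: (le_trans (hK _ _)); rewrite mulrAC.
  apply: (le_trans (ler_pM _ _ (ler_wpM2l _ n1) E1)); rewrite ?mulr_ge0 //.
  by rewrite mulrCA ger_pMr // ler_pdivrMr // mul1r lerDl.
apply: (le_trans (hK _ _)); apply: (le_trans (ler_wpM2l _ E2)); rewrite ?mulr_ge0 //.
by rewrite mulrCA ger_pMr // ler_pdivrMr // mul1r lerDl.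
Qed.

Lemma cont_on_scale (W : normedModType R) A (a : V -> R) (g : V -> W) :
  cont_on A a -> cont_on A g -> cont_on A (fun x => a x *: g x).
Proof.
apply: (@cont_on_bilinear R W W ( *:%R) 1) => [u v|u u' v|u v v'].
- by rewrite normrZ mul1r.
- by rewrite scalerBl.
- by rewrite scalerBr.
Qed.

Lemma cont_on_mulmx m n p A (g : V -> 'M[R]_(m, n)) (g' : V -> 'M[R]_(n, p)) :
  cont_on A g -> cont_on A g' -> cont_on A (fun x => g x *m g' x).
Proof.
apply: (@cont_on_bilinear _ _ _ _ n%:R) => [u v|u u' v|u v v'].
- exact: mx_norm_mul.
- by rewrite mulmxBl.
- by rewrite mulmxBr.
Qed.

Lemma cont_on_opp (W : normedModType R) A (g : V -> W) :
  cont_on A g -> cont_on A (fun x => - g x).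
Proof.
move=> h x Ax e e0; have [d d0 hd] := h x Ax e e0; exists d => // y Ay /(hd _ Ay).
by rewrite -opprD normrN.
Qed.

End cont_on_algebra.

Section C1w_algebra.
Context {R : realType} {n : nat}.

Lemma is_jac_opp m A (g : 'rV[R]_n -> 'rV[R]_m) x J :
  is_jac A g x J -> is_jac A (fun y => - g y) x (- J).
Proof.
move=> h e e0; have [d d0 hd] := h e e0; exists d => // y Ay /(hd _ Ay).
by rewrite mulmxN -!opprD normrN.
Qed.

Lemma C1w_add m A (g g' : 'rV[R]_n -> 'rV[R]_m) G G' : C1w A g G -> C1w A g' G' ->
  C1w A (fun y => g y + g' y) (fun y => G y + G' y).
Proof.
move=> [h1 h2] [h1' h2']; split; last exact: cont_on_add.
by move=> x Ax; apply: is_jac_add; [exact: h1|exact: h1'].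
Qed.

Lemma C1w_opp m A (g : 'rV[R]_n -> 'rV[R]_m) G : C1w A g G ->
  C1w A (fun y => - g y) (fun y => - G y).
Proof.
move=> [h1 h2]; split; last exact: cont_on_opp.
by move=> x Ax; apply: is_jac_opp; exact: h1.
Qed.

Lemma C1w_affine m A (b : 'rV[R]_m) (B : 'M[R]_(n, m)) :
  C1w A (fun y => b + y *m B) (fun=> B).
Proof. by split; [move=> x _; exact: is_jac_affine|exact: cont_on_cst]. Qed.

Lemma is_grad_cont (A : set 'rV[R]_n) a D :
  (forall x, is_grad A a x (D x)) -> cont_on A a.
Proof.
move=> h x Ax e e0.
have := is_jac_cont ((is_grad_jac _ _ _ _).1 (h x)) e0.
move=> [d d0 hd]; exists d => // y Ay /(hd _ Ay).
rewrite -raddfB /=; apply: le_trans.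
by have := mx_coef_norm ((a y - a x)%:M : 'rV[R]_1) ord0 ord0; rewrite mxE.
Qed.

Lemma C1w_scale m (A : set 'rV[R]_n) (a : 'rV[R]_n -> R) D
    (g : 'rV[R]_n -> 'rV[R]_m) G :
  (forall x, is_grad A a x (D x)) -> cont_on A D -> C1w A g G ->
  C1w A (fun y => a y *: g y) (fun y => a y *: G y + D y *m g y).
Proof.
move=> ha cD gG; have [h1 h2] := gG; split.
  by move=> x Ax; apply: is_jac_scale => //; exact: h1.
apply: cont_on_add; first by apply: cont_on_scale => //; exact: is_grad_cont ha.
by apply: cont_on_mulmx => //; exact: C1w_cont gG.
Qed.

End C1w_algebra.

(** * Smoothing *)

Section smoothing.
Context {R : realType} {n : nat} (n_gt0 : (0 < n)%N).
Local Notation H := (@halfspace R n).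

Lemma blip_cont_bounded (W : normedModType R) (g : 'rV[R]_n -> W) :
  (forall (Y : set 'rV[R]_n) B, (forall x, Y x -> `|x| <= B) -> blip Y g) ->
  forall A : set 'rV[R]_n, cont_on A g.
Proof.
move=> h; apply: blip_cont => x; exists 1 => //; apply: (h _ (`|x| + 1)) => y /= yx.
exact: norm_leD (ltW yx).
Qed.

(* Successive replacement of [F], near each point of [l], by its first order
   Taylor polynomial at a nearby point.  On the set where the cut-off function
   of a list element equals [1] the result is affine when that element is
   processed, and the later modifications have Lipschitz derivatives, so the
   derivative becomes Lipschitz there.  An element changes the derivative at
   [x] only if [x] is within [2 * d]. *)
Lemma smooth_seq m (X : set 'rV[R]_n) (F : 'rV[R]_n -> 'rV[R]_m)
    (DF : 'rV[R]_n -> 'M[R]_(n, m)) (d w K : R) (l : seq ('rV[R]_n * 'rV[R]_n)) :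
  C1w X F DF -> 0 < d -> 0 <= w -> 0 <= K ->
  (forall p x, p \in l -> X x -> `|x - p.1| < 2 * d ->
    `|F p.2 + (x - p.2) *m DF p.2 - F x| <= K /\ `|DF p.2 - DF x| <= w) ->
  exists s S, [/\ C1w X s S, (forall x, X x -> `|s x - F x| <= K),
    (forall x, X x -> `|S x - DF x| <=
       w + (count (fun p => `|x - p.1| < 2 * d) l)%:R * (32 * K / d)),
    (forall x, X x -> (forall p, p \in l -> 2 * d <= `|x - p.1|) -> s x = F x) &
    forall p, p \in l -> blip [set x | n%:R * `|x - p.1| <= d] s /\
                         blip [set x | n%:R * `|x - p.1| <= d] S].
Proof.
move=> hF d0 w0 K0; elim: l => [_|p l IH hl].
  exists F, DF; split=> // x Xx; first by rewrite subrr normr0.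
  by rewrite subrr normr0 mul0r addr0.
have [|s [S [c1 sF SF far bl]]] := IH.
  by move=> q x ql; apply: hl; rewrite inE ql orbT.
have [psi [D [gpsi psi01 [psi1 psi0] Dle blD]]] := bump_exists p.1 d0 n_gt0.
pose T x := F p.2 + (x - p.2) *m DF p.2.
have TE x : T x = (F p.2 - p.2 *m DF p.2) + x *m DF p.2.
  by rewrite /T mulmxBl addrCA addrC.
have cT : C1w X T (fun=> DF p.2).
  have -> : T = fun x => (F p.2 - p.2 *m DF p.2) + x *m DF p.2 by apply/funext.
  exact: C1w_affine.
pose s' x := s x + psi x *: (T x - s x).
pose S' x := S x + (psi x *: (DF p.2 - S x) + D x *m (T x - s x)).
have bounded_ball (q : 'rV[R]_n) x : n%:R * `|x - q| <= d -> `|x| <= `|q| + d.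
  by move=> h; apply: norm_leD; apply: le_trans h; rewrite ler_peMl // ler1n.
have hlp x : X x -> `|x - p.1| < 2 * d -> `|T x - F x| <= K /\ `|DF p.2 - DF x| <= w.
  by move=> Xx xp; apply: hl => //; rewrite inE eqxx.
exists s', S'; split.
- apply: C1w_add => //; apply: C1w_scale.
  + by move=> x; apply: gpsi.
  + by apply: blip_cont_bounded => Y B hB; exact: (blD Y B hB).2.
  + by apply: C1w_add => //; apply: C1w_opp.
- move=> x Xx; have [xp|xp] := ltP `|x - p.1| (2 * d); last first.
    by rewrite /s' (psi0 x xp).1 scale0r addr0 sF.
  have /andP [p0 p1] := psi01 x.
  have -> : s' x - F x = (1 - psi x) *: (s x - F x) + psi x *: (T x - F x).
    by rewrite /s'; apply/rowP => j; rewrite !mxE; ring.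
  apply: (le_trans (ler_normD _ _)); rewrite !normrZ (ger0_norm p0) ger0_norm ?subr_ge0 //.
  have := sF x Xx; have := (hlp x Xx xp).1.
  move: `|s x - F x| `|T x - F x| => u v hu hv.
  have -> : K = (1 - psi x) * K + psi x * K by ring.
  by apply: lerD; apply: ler_wpM2l; rewrite ?subr_ge0.
- move=> x Xx; have [xp|xp] := ltP `|x - p.1| (2 * d); last first.
    rewrite /S' (psi0 x xp).1 (psi0 x xp).2 scale0r mul0mx !addr0 /=.
    by rewrite (ltNge (`|x - p.1|)) xp add0n SF.
  rewrite /= xp natrD mulrDl mul1r.
  have /andP [p0 p1] := psi01 x.
  set cnt := (count _ l)%:R * _.
  have cnt0 : 0 <= cnt by rewrite mulr_ge0 // !mulr_ge0 // invr_ge0 ltW.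
  (* The convex combination does not accumulate [w]. The last term is bounded by [16 / d] times
     [|T x - s x| <= 2 * K], which is the increment [32 * K / d] of one active element. *)
  have -> : S' x - DF x = (1 - psi x) *: (S x - DF x) + psi x *: (DF p.2 - DF x)
      + D x *m (T x - s x).
    rewrite /S'; set M := D x *m _; apply/matrixP => i j; rewrite !mxE; ring.
  have -> : w + (32 * K / d + cnt) = (w + cnt) + 32 * K / d by ring.
  apply: normD_le.
    apply: (le_trans (ler_normD _ _)); rewrite !normrZ (ger0_norm p0) ger0_norm ?subr_ge0 //.
    have -> : w + cnt = (1 - psi x) * (w + cnt) + psi x * (w + cnt) by ring.
    apply: lerD; apply: ler_wpM2l; rewrite ?subr_ge0 //; first exact: SF.
    by apply: (le_trans (hlp x Xx xp).2); rewrite lerDl.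
  apply: (le_trans (mx_norm_mul _ _)); rewrite mul1r.
  have -> : 32 * K / d = 16 / d * (K + K) by ring.
  apply: ler_pM => //.
  have -> : T x - s x = (T x - F x) - (s x - F x) by rewrite opprB addrA subrK.
  apply: normB_le; last exact: sF.
  exact: (hlp x Xx xp).1.
- move=> x Xx hfar; rewrite /s'.
  have [-> _] := psi0 x (hfar p (mem_head _ _)); rewrite scale0r addr0.
  by apply: far => // q ql; apply: hfar; rewrite inE ql orbT.
- move=> q; rewrite inE => /orP [/eqP ->|/bl [bs bS]].
    have bx : blip [set x | n%:R * `|x - p.1| <= d] (fun x : 'rV[R]_n => x).
      by apply: (@blip_id _ _ _ (`|p.1| + d)) => x; apply: bounded_ball.
    split.
      apply: (@blip_ext _ _ _ _ (fun x => (F p.2 - p.2 *m DF p.2) + x *m DF p.2)).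
        by move=> x /psi1 [e _]; rewrite /s' e scale1r [RHS]addrC subrK TE.
      apply: blip_add; first exact: blip_cst.
      by apply: blip_mulmx => //; exact: blip_cst.
    apply: (@blip_ext _ _ _ _ (fun=> DF p.2)); last exact: blip_cst.
    by move=> x /psi1 [e1 e2]; rewrite /S' e1 e2 scale1r mul0mx addr0 [RHS]addrC subrK.
  set Y := [set x | _].
  have bY x : Y x -> `|x| <= `|q.1| + d by apply: bounded_ball.
  have [bp bD] := blD Y _ bY.
  have bopp (W : normedModType R) (g : 'rV[R]_n -> W) : blip Y g -> blip Y (fun x => - g x).
    move=> hg; apply: (@blip_ext _ _ _ _ (fun x => (-1) *: g x)).
      by move=> x _; rewrite scaleN1r.
    by apply: blip_scale => //; exact: blip_cst.
  have bT : blip Y T.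
    apply: (@blip_ext _ _ _ _ (fun x => (F p.2 - p.2 *m DF p.2) + x *m DF p.2)).
      by move=> x _; rewrite TE.
    apply: blip_add; first exact: blip_cst.
    by apply: blip_mulmx; [exact: blip_id bY|exact: blip_cst].
  split.
    by apply: blip_add => //; apply: blip_scale => //; apply: blip_add => //; apply: bopp.
  apply: blip_add => //; apply: blip_add.
    apply: blip_scale => //; apply: blip_add; [exact: blip_cst|exact: bopp].
  by apply: blip_mulmx => //; apply: blip_add => //; apply: bopp.
Qed.

End smoothing.

(** * Smoothing along a grid *)

Section grid.
Context {R : realType}.

Context {n : nat} (n_gt0 : (0 < n)%N).

Definition grid_pt (B eta : R) m (k : {ffun 'I_n -> 'I_m}) : 'rV[R]_n :=
  \row_i (- B + eta * (k i)%:R).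

(** Two grid points within [2 n eta] of [x] have indices that differ by less than [4 n] in each
    coordinate, so reduction modulo [4 n] separates them. The bound is independent of the mesh. *)
Lemma grid_overlap (B eta : R) m (x : 'rV[R]_n) : 0 < eta ->
  (#|[set k : {ffun 'I_n -> 'I_m} | (`|x - grid_pt B eta k| < 2 * (n%:R * eta))%R]|
    <= (4 * n) ^ n)%N.
Proof.
move=> eta0; have n4 : (0 < 4 * n)%N by rewrite muln_gt0.
pose f (k : {ffun 'I_n -> 'I_m}) : {ffun 'I_n -> 'I_(4 * n)} :=
  [ffun i => Ordinal (ltn_pmod (k i) n4)].
set S := [set k | _]; have finj : {in S &, injective f}.
  move=> k k'; rewrite !inE => hk hk' /ffunP e; apply/ffunP => i.
  have := e i; rewrite !ffunE => /(congr1 val) /= {}e.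
  have := le_lt_trans (mx_coef_norm _ ord0 i) hk.
  have := le_lt_trans (mx_coef_norm _ ord0 i) hk'.
  rewrite !mxE => h1 h2.
  have : `|(k i)%:R - (k' i)%:R| * eta < (4 * n)%:R * eta.
    rewrite -(gtr0_norm eta0) -normrM (gtr0_norm eta0).
    have -> : ((k i)%:R - (k' i)%:R) * eta =
      (x ord0 i - (- B + eta * (k' i)%:R)) - (x ord0 i - (- B + eta * (k i)%:R)) by ring.
    apply: le_lt_trans (ler_normB _ _) _; rewrite natrM; lra.
  rewrite ltr_pM2r // => h.
  apply/val_inj => /=; move: h e; move: (nat_of_ord (k i)) (nat_of_ord (k' i)) => a b.
  move: (4 * n)%N => q h e.
  have [ab|ab] := leqP a b.
    have : (b - a < q)%N.
      by rewrite -(ltr_nat R) natrB // -[ltLHS]ger0_norm ?subr_ge0 ?ler_nat // distrC.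
    move/eqP: e; rewrite eq_sym eqn_mod_dvd // => /dvdn_leq; lia.
  have : (a - b < q)%N.
    rewrite -(ltr_nat R) natrB ?(ltnW ab) // -[ltLHS]ger0_norm //.
    by rewrite subr_ge0 ler_nat ltnW.
  move/eqP: e; rewrite eqn_mod_dvd ?(ltnW ab) // => /dvdn_leq; lia.
rewrite -(card_in_imset finj); apply: leq_trans (max_card _) _.
by rewrite card_ffun !card_ord.
Qed.

Local Notation H := (@halfspace R n).

(** Cut-offs reach to [2 * dl] and Taylor centres lie within [eta <= dl] of the nodes, so Taylor
    remainders are taken over distances up to [3 * dl] and are at most [K = 3 n w dl]. Each active
    element then adds [32 * K / dl = 96 n w] to the derivative error: the mesh cancels. With at most
    [N0] active elements the total is [c * w], and [w] is chosen accordingly. *)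
Lemma smoothing m (X : set 'rV[R]_n) (F : 'rV[R]_n -> 'rV[R]_m)
    (DF : 'rV[R]_n -> 'M[R]_(n, m)) (a : set 'rV[R]_n) (r B eps : R) :
  hopen X -> C1w X F DF -> 0 < r -> 0 < eps ->
  (forall x, a x -> `|x| <= B) -> (forall x, a x -> H x) ->
  (forall x y, a x -> H y -> `|y - x| < r -> X y) ->
  (forall e, 0 < e -> exists2 d, 0 < d & forall x y, a x -> X y -> `|y - x| < d ->
     `|DF x - DF y| <= e) ->
  exists s S, [/\ C1w X s S,
    (forall x, X x -> `|s x - F x| <= eps /\ `|S x - DF x| <= eps),
    (forall x, X x -> (forall y, a y -> r <= `|x - y|) -> s x = F x) &
    cov n a (fun x => (S x, s x - x *m S x))].
Proof.
move=> hX hF r0 eps0 aB aH aX ucont.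
have n1 : 1 <= n%:R :> R by rewrite ler1n.
pose N0 : R := ((4 * n) ^ n)%:R.
pose c : R := 1 + N0 * (96 * n%:R).
have N00 : 0 <= N0 by [].
have c0 : 0 < c by rewrite ltr_wpDr // !mulr_ge0.
pose w := eps / (c * (3 * n%:R)).
have w0 : 0 < w by rewrite divr_gt0 // !mulr_gt0 // ltr0n.
have [d d0 hd] := ucont w w0.
pose dl := Num.min (Num.min d r) 1 / 4.
have dl0 : 0 < dl by apply: divr_gt0 => //; rewrite !lt_min d0 r0 ltr01.
have [dld dlr dl1] : [/\ 3 * dl < d, 3 * dl < r & 3 * dl < 1].
  have : 3 * dl < Num.min (Num.min d r) 1.
    have : 0 < Num.min (Num.min d r) 1 by rewrite !lt_min d0 r0 /=.
    by rewrite /dl; lra.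
  by rewrite !lt_min => /andP [/andP []].
pose eta := dl / n%:R.
have eta0 : 0 < eta by rewrite divr_gt0 ?ltr0n.
have n_eta : n%:R * eta = dl by rewrite mulrC divfK // pnatr_eq0 -lt0n.
have eta_dl : eta <= dl by rewrite -n_eta ler_peMl // ltW.
pose K := n%:R * w * (3 * dl).
have K0 : 0 <= K by apply: mulr_ge0; apply: mulr_ge0 => //; exact: ltW.
pose q := (Num.trunc (2 * `|B| / eta)).+1.
pose g := grid_pt `|B| eta (m := q).
(* A node may lie outside [X], so the Taylor polynomial is taken at a point of [a] near the node.
   Nodes without such a point are discarded by [good], and [0] is only a default. *)
have /choice [anc hanc] : forall k : {ffun 'I_n -> 'I_q}, exists z, 
    (exists2 y, a y & `|y - g k| <= eta) -> a z /\ `|z - g k| <= eta.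
  move=> k; have [[y ay yk]|nx] := pselect (exists2 y, a y & `|y - g k| <= eta).
    by exists y.
  by exists 0 => /nx.
pose good k := `[< exists2 y, a y & `|y - g k| <= eta >].
pose l := [seq (g k, anc k) | k <- enum {ffun 'I_n -> 'I_q} & good k].
have lP p : p \in l -> exists2 k, good k & p = (g k, anc k).
  by move=> /mapP [k]; rewrite mem_filter => /andP [gk _] ->; exists k.
have near_anc p x : p \in l -> `|x - p.1| < 2 * dl -> a p.2 /\ `|x - p.2| < 3 * dl.
  move=> /lP [k /asboolP /hanc [az zk] -> /=] xk; split=> //.
  have -> : x - anc k = (x - g k) - (anc k - g k) by rewrite opprB addrA subrK.
  apply: le_lt_trans (ler_normB _ _) _; lra.
have [|s [S [c1 sF SF far bl]]] := @smooth_seq _ _ n_gt0 _ X F DF dl w K l hF dl0 (ltW w0) K0.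
  move=> p x pl Xx xp; have [ap xp3] := near_anc p x pl xp.
  have Xp : X p.2 by apply: (aX p.2) => //; [exact: aH|rewrite subrr normr0].
  split; last by apply: hd => //; apply: lt_trans dld.
  have -> : F p.2 + (x - p.2) *m DF p.2 - F x =
      - (F x - F p.2 - (x - p.2) *m DF p.2).
    by apply/rowP => j; rewrite !mxE; ring.
  rewrite normrN; apply: (@le_trans _ _ (n%:R * w * `|x - p.2|)); last first.
    by apply: ler_wpM2l; [apply: mulr_ge0 => //|]; exact: ltW.
  apply: (@mvt_ineq _ _ _ (fun z => X z /\ `|DF z - DF p.2| <= w) F DF).
  - move=> t t01; set z := p.2 + _.
    have zp : `|z - p.2| < 3 * dl.
      rewrite /z addrC addKr normrZ; apply: le_lt_trans xp3.
      move/andP: (t01) => [t0 t1]; rewrite ger0_norm //; exact: ler_piMl.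
    have Xz : X z.
      apply: (aX p.2) => //; last by apply: lt_trans dlr.
      by apply: halfspace_convex => //; [exact: aH|exact: hX.1].
    by split=> //; rewrite distrC; apply: hd => //; apply: lt_trans dld.
  - by move=> z [Xz _]; apply: is_jac_sub (hF.1 z Xz) => y [].
  - by move=> z [].
have wc : w * (c * (3 * n%:R)) = eps.
  by rewrite /w divfK // !mulf_neq0 ?gt_eqF // ltr0n.
exists s, S; split=> //.
- move=> x Xx; split.
    apply: (le_trans (sF x Xx)); rewrite /K -wc.
    have -> : n%:R * w * (3 * dl) = w * ((3 * dl) * n%:R) by ring.
    have -> : w * (c * (3 * n%:R)) = w * (3 * c * n%:R) by ring.
    rewrite ler_pM2l // ler_wpM2r //.
    have : 1 <= c by rewrite /c lerDl !mulr_ge0.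
    lra.
  apply: (le_trans (SF x Xx)).
  apply: (@le_trans _ _ (w + N0 * (32 * K / dl))).
    rewrite lerD2l; apply: ler_wpM2r.
      by apply: mulr_ge0; [apply: mulr_ge0|rewrite invr_ge0 ltW].
    rewrite /N0 ler_nat.
    apply: leq_trans (@grid_overlap `|B| eta q x eta0).
    rewrite /l count_map n_eta -size_filter cardE; apply: uniq_leq_size.
      by do 2 apply: filter_uniq; exact: enum_uniq.
    move=> k; rewrite mem_filter => /andP [h _]; rewrite mem_enum inE; exact: h.
  have -> : w + N0 * (32 * K / dl) = w * c.
    by rewrite /K /c; field; rewrite gt_eqF.
  rewrite -wc ler_pM2l // ler_peMr ?(ltW c0) //; lra.
- move=> x Xx hfar; apply: far => // p pl; rewrite leNgt; apply/negP => xp.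
  have [ap] := near_anc p x pl xp; have := hfar p.2 ap; lra.
(* On each of these sets the cut-off of one node equals [1], so [s] and [S] are Lipschitz there.
   They cover [a]: rounding down moves a point by at most [eta], and [n * eta = dl]. *)
- pose cell k := [set x | good k /\ (a x /\ n%:R * `|x - g k| <= dl)].
  pose jet x := (S x, s x - x *m S x).
  have cell_cov k : cov n (cell k) jet.
    have [gk|ngk] := boolP (good k); last first.
      exists 0%N => z; exists (fun=> 0%N); split=> x.
        by rewrite /cell /= (negbTE ngk) => -[].
      by move=> ? []; rewrite (negbTE ngk).
    have [bs bS] : blip (cell k) s /\ blip (cell k) S.
      have sub : cell k `<=` [set x | n%:R * `|x - (g k, anc k).1| <= dl].
        by move=> x [_ []].
      have [|[C C0 [h1 h2]] [C' C'0 [h1' h2']]] := bl (g k, anc k).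
        by apply: map_f; rewrite mem_filter gk mem_enum.
      split; [exists C|exists C'] => //; split=> [x /sub|x y /sub ? /sub ?];
        [exact: h1|exact: h2|exact: h1'|exact: h2'].
    have cB x : cell k x -> `|x| <= B by move=> [_ [/aB]].
    have b2 : blip (cell k) (fun x => s x - x *m S x).
      apply: blip_add => //; apply: (@blip_ext _ _ _ _ (fun x => (-1) *: (x *m S x))).
        by move=> x _; rewrite scaleN1r.
      apply: blip_scale; first exact: blip_cst.
      by apply: blip_mulmx => //; exact: blip_id cB.
    have [C C0 [_ h2]] := bS; have [C' C'0 [_ h2']] := b2.
    have := @cov_mx R 1 n (cell k) B cB; rewrite mul1n.
    apply: (@cov_lip _ _ _ _ _ _ _ _ (C + C')) => x y cx cy.
    rewrite prod_normE /= ge_max mulrDl; apply/andP; split.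
      by apply: (le_trans (h2 x y cx cy)); rewrite lerDl mulr_ge0.
    by apply: (le_trans (h2' x y cx cy)); rewrite lerDr mulr_ge0.
  apply: cov_reindex (cov_fin cell_cov) => x ax.
  have xB := aB x ax.
  have xi i : 0 <= (x ord0 i + `|B|) / eta < q%:R.
    have := le_trans (mx_coef_norm x ord0 i) (le_trans xB (ler_norm _)).
    rewrite ler_norml => /andP [h1 h2]; apply/andP; split.
      by rewrite divr_ge0 ?(ltW eta0) //; lra.
    rewrite /q; apply: le_lt_trans (truncnS_gt _); rewrite ler_pM2r ?invr_gt0 //; lra.
  have kt i : (Num.trunc ((x ord0 i + `|B|) / eta) < q)%N.
    have /andP [h1 h2] := xi i; have /andP [h3 _] := truncn_itv h1.
    by rewrite -(ltr_nat R); apply: le_lt_trans h2.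
  pose k : {ffun 'I_n -> 'I_q} := [ffun i => Ordinal (kt i)].
  have xk : `|x - g k| <= eta.
    apply: mx_norm_le => [|i j]; first exact: ltW.
    rewrite ord1 !mxE ffunE /=; have /andP [h1 h2] := xi j.
    have /andP [h3 h4] := truncn_itv h1.
    rewrite ler_pdivlMr // in h3; rewrite ltr_pdivrMr // -natr1 in h4.
    by rewrite ler_norml; apply/andP; split; lra.
  exists (k, x) => //=; split; first by apply/asboolP; exists x.
  by split=> //; rewrite -n_eta ler_wpM2l.
Qed.

End grid.

(** * Functions on manifolds *)

#[local] Opaque jacobian_within.

Section charts.
Context {R : realType} {n : nat} {T : topologicalType}.
Implicit Type c : chart R n T.

Lemma cimg_hopen c : hopen (cimg c).
Proof. by have [V oV e] := cimg_open c; rewrite /cimg e; exact: hopen_openI. Qed.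

Lemma cimgP c p : cdom c p -> cimg c (cmap c p).
Proof. by exists p. Qed.

Lemma cinv_dom c x : cimg c x -> cdom c (cinv c x) /\ cmap c (cinv c x) = x.
Proof. by move=> [p cp <-]; rewrite cmapK. Qed.

Lemma cdom_near c p : cdom c p -> \forall q \near p, cdom c q.
Proof. by move=> cp; apply: open_nbhs_nbhs; split=> //; exact: open_cdom. Qed.

Lemma cmap_near c p (e : R) : cdom c p -> 0 < e ->
  \forall q \near p, `|cmap c q - cmap c p| < e.
Proof.
move=> cp e0.
have /subspace_continuousP /(_ p cp) /cvgrPdist_lt /(_ e e0) := @cmap_continuous _ _ _ c.
rewrite near_withinE => h; near=> q; rewrite distrC; near: q.
apply: filterS2 h (cdom_near cp) => q h cq; exact: h.
Unshelve. all: by end_near. Qed.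

Lemma cinv_near c p (U : set T) : cdom c p -> nbhs p U ->
  exists2 r : R, 0 < r & forall y, cimg c y -> `|y - cmap c p| < r -> U (cinv c y).
Proof.
move=> cp Up.
have /subspace_continuousP /(_ _ (cimgP cp)) := @cinv_continuous _ _ _ c.
rewrite /from_subspace cmapK // => /(_ U Up) /=.
move=> h0; have : within (cmap c @` cdom c) (nbhs (cmap c p)) [set y | U (cinv c y)] by exact: h0.
move=> /nbhs_ballP [r r0 h]; exists r => // y iy yr.
by apply: h => //; rewrite -ball_normE /= distrC.
Qed.

Lemma near_cinv c p (P : set T) : cdom c p ->
  (exists2 r : R, 0 < r & forall y, cimg c y -> `|y - cmap c p| < r -> P (cinv c y)) ->
  \forall q \near p, P q.
Proof.
move=> cp [r r0 h]; apply: filterS2 (cdom_near cp) (cmap_near cp r0) => q cq qr.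
by rewrite -(cmapK cq); apply: h => //; exact: cimgP.
Qed.

End charts.

Section functions.
Context {R : realType} {n : nat} {M : manifold R n}.
Local Notation chartM := (chart R n (manifold_space M)).
Implicit Types (c : chartM) (p q : M).

Lemma chart_at p : exists2 c : chartM, atlas c & cdom c p.
Proof.
have : (\bigcup_(c in @atlas _ _ M) cdom c) p by rewrite atlas_cover.
by move=> [c ac cp]; exists c.
Qed.

Definition has_jac N (f : M -> 'rV[R]_N) c p (J : 'M[R]_(n, N)) : Prop :=
  is_jac (cimg c) (f \o cinv c) (cmap c p) J.

Lemma chart_jacobianE N (f : M -> 'rV[R]_N) c p J : cdom c p ->
  has_jac f c p J -> chart_jacobian f c p = J.
Proof. by move=> cp; apply: jacobian_withinE; [exact: cimg_hopen|exact: cimgP]. Qed.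

Lemma chart_jacobian_cinv N (f : M -> 'rV[R]_N) c y : cimg c y ->
  chart_jacobian f c (cinv c y) = jacobian_within (cimg c) (f \o cinv c) y.
Proof.
move=> /cinv_dom [_ e].
exact: (congr1 (fun z => jacobian_within (cimg c) (f \o cinv c) z) e).
Qed.

Lemma C1map_has_jac N (f : C1map M N) c p : atlas c -> cdom c p ->
  has_jac f c p (chart_jacobian f c p).
Proof.
by move=> ac cp; have /C1_onP [h _] := C1mapP f ac; exact: h (cimgP cp).
Qed.

Lemma has_jac_cont N (f : M -> 'rV[R]_N) c p J (e : R) : cdom c p ->
  has_jac f c p J -> 0 < e -> \forall q \near p, `|f q - f p| <= e.
Proof.
move=> cp h e0; have [d d0 hd] := is_jac_cont h e0.
apply: (near_cinv cp); exists d => // y iy yd.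
by have := hd y iy yd; rewrite /= cmapK.
Qed.

Lemma C1map_near N (f : C1map M N) p (e : R) : 0 < e ->
  \forall q \near p, `|f q - f p| <= e.
Proof.
have [c ac cp] := chart_at p; exact: has_jac_cont (C1map_has_jac f ac cp).
Qed.

Lemma chart_jacobian_near N (f : C1map M N) c p (e : R) : atlas c -> cdom c p ->
  0 < e -> \forall q \near p, `|chart_jacobian f c q - chart_jacobian f c p| <= e.
Proof.
move=> ac cp e0; have /C1_onP [_ h] := C1mapP f ac.
have [d d0 hd] := h _ (cimgP cp) e e0.
apply: (@near_cinv _ _ _ c p
  (fun q => `|chart_jacobian f c q - chart_jacobian f c p| <= e) cp).
exists d; [exact: d0|move=> y iy yd].
rewrite chart_jacobian_cinv //.
exact: hd.
Qed.

Lemma has_jac_local N (f g : M -> 'rV[R]_N) c p J : cdom c p ->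
  (\forall q \near p, f q = g q) -> has_jac g c p J -> has_jac f c p J.
Proof.
move=> cp fg; apply: is_jac_local; first exact: cimgP.
have [r r0 h] := cinv_near cp fg; exists r => // y iy yr; split=> //=.
exact: h.
Qed.

Lemma has_jac_add N (f g : M -> 'rV[R]_N) c p J K : has_jac f c p J ->
  has_jac g c p K -> has_jac (fun q => f q + g q) c p (J + K).
Proof. exact: is_jac_add. Qed.

Definition transition c c' p : 'M[R]_n :=
  jacobian_within (cmap c @` (cdom c `&` cdom c')) (cmap c' \o cinv c) (cmap c p).

Lemma transition_C1 c c' : atlas c -> atlas c' ->
  C1w (cmap c @` (cdom c `&` cdom c')) (cmap c' \o cinv c)
    (jacobian_within (cmap c @` (cdom c `&` cdom c')) (cmap c' \o cinv c)).
Proof. by move=> ac ac'; apply/C1_onP; have [h _] := atlas_compatible ac ac'. Qed.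

Lemma transition_near c c' p (e : R) : atlas c -> atlas c' -> cdom c p -> cdom c' p ->
  0 < e -> \forall q \near p, `|transition c c' q - transition c c' p| <= e.
Proof.
move=> ac ac' cp cp' e0; have [_ h] := transition_C1 ac ac'.
have [|d d0 hd] := h (cmap c p) _ e e0; first by exists p.
apply: filterS3 (cdom_near cp) (cdom_near cp') (cmap_near cp d0) => q cq cq' qd.
by apply: hd => //; exists q.
Qed.

#[local] Opaque transition.

Lemma has_jac_transition N (f : M -> 'rV[R]_N) c c' p J : atlas c -> atlas c' ->
  cdom c p -> cdom c' p -> has_jac f c' p J ->
  has_jac f c p (transition c c' p *m J).
Proof.
move=> ac ac' cp cp' h; have [h1 _] := transition_C1 ac ac'.
have A : (cmap c @` (cdom c `&` cdom c')) (cmap c p) by exists p.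
have [r r0 hr] := cinv_near cp (cdom_near cp').
apply: (@is_jac_local _ _ _ _ (cmap c @` (cdom c `&` cdom c')) _
  ((f \o cinv c') \o (cmap c' \o cinv c))); first exact: cimgP.
  exists r => // y iy yr; have cy' := hr y iy yr.
  have [cy ey] := cinv_dom iy; split; first by exists (cinv c y).
  by rewrite /= cmapK.
apply: (@is_jac_comp R n N _ (cimg c') _ _ _ _ _ _ (h1 _ A)).
  by move=> _ [q [cq cq'] <-]; rewrite /= cmapK //; exact: cimgP.
by rewrite /= cmapK.
Qed.

Lemma chart_jacobian_transition N (f : C1map M N) c c' p : atlas c -> atlas c' ->
  cdom c p -> cdom c' p ->
  chart_jacobian f c p = transition c c' p *m chart_jacobian f c' p.
Proof.
move=> ac ac' cp cp'; apply: chart_jacobianE => //.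
by apply: has_jac_transition => //; exact: C1map_has_jac.
Qed.

(** One chart around each point suffices: in any other chart the Jacobian is [transition *m G], a
    product of factors continuous at the point. *)
Lemma is_C1_local N (f : M -> 'rV[R]_N) :
  (forall p, exists c, [/\ atlas c, cdom c p & exists2 G : M -> 'M[R]_(n, N),
     \forall q \near p, has_jac f c q (G q) &
     forall e : R, 0 < e -> \forall q \near p, `|G q - G p| <= e]) ->
  is_C1 f.
Proof.
move=> h c ac; apply/C1_onP.
have key p : cdom c p -> exists c', [/\ atlas c', cdom c' p &
  exists2 G : M -> 'M[R]_(n, N), \forall q \near p, 
      chart_jacobian f c q = transition c c' q *m G q /\
      has_jac f c q (transition c c' q *m G q) &
    forall e : R, 0 < e -> \forall q \near p, `|G q - G p| <= e].
  move=> cp; have [c' [ac' cp' [G hG cG]]] := h p.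
  exists c'; split=> //; exists G => //.
  apply: filterS3 (cdom_near cp) (cdom_near cp') hG => q cq cq' hq.
  have hj : has_jac f c q (transition c c' q *m G q) by exact: has_jac_transition.
  by split=> //; apply: chart_jacobianE.
split=> [x ix|x ix e e0].
  have [cx ex] := cinv_dom ix; have [c' [ac' cp' [G hG cG]]] := key _ cx.
  have [hE hj] := nbhs_singleton hG.
  have : has_jac f c (cinv c x) (chart_jacobian f c (cinv c x)) by rewrite hE.
  by rewrite /has_jac ex chart_jacobian_cinv.
have [cx ex] := cinv_dom ix; have [c' [ac' cp' [G hG cG]]] := key _ cx.
have := nbhs_singleton hG; set p := cinv c x in hG cG cp' cx ex *; move=> [hE0 _].
set B := `|G p|; set C := `|transition c c' p|.
have B0 : 0 <= B by exact: normr_ge0.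
have C0 : 0 <= C by exact: normr_ge0.
have k1 : 0 < n%:R * (B + 1) + 1 by rewrite ltr_wpDl // mulr_ge0 // addr_ge0.
have k2 : 0 < n%:R * C + 1 by rewrite ltr_wpDl // mulr_ge0.
have e20 : 0 < e / 2 by rewrite divr_gt0.
have near1 := transition_near ac ac' cx cp' (divr_gt0 e20 k1).
have near2 := cG _ (divr_gt0 e20 k2).
have near3 := cG 1 ltr01.
have : \forall q \near p, `|chart_jacobian f c q - chart_jacobian f c p| <= e.
  apply: filterS2 (filterI near1 near2) (filterI near3 hG) => q [h1 h2] [h3 [hE _]].
  rewrite hE hE0 mulmx_diff.
  have -> : e = e / 2 + e / 2 by field.
  have Gq : `|G q| <= B + 1.
    exact: norm_leD.
  apply: normD_le.
    apply: (le_trans (mx_norm_mul _ _)); rewrite mulrAC.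
    apply: (le_trans (ler_pM _ _ (ler_wpM2l _ Gq) h1)); rewrite ?mulr_ge0 //.
    by rewrite mulrCA ger_pMr // ler_pdivrMr // mul1r lerDl.
  apply: (le_trans (mx_norm_mul _ _)).
  apply: (le_trans (ler_wpM2l _ h2)); rewrite ?mulr_ge0 //.
  by rewrite mulrCA ger_pMr // ler_pdivrMr // mul1r lerDl.
move=> /(cinv_near cx) [r r0 hr]; exists r => // y iy yr.
have := hr y iy; rewrite ex => /(_ yr); rewrite (chart_jacobian_cinv f iy).
by have -> : chart_jacobian f c p = _ := chart_jacobian_cinv f ix.
Qed.

End functions.

(** * Countable families of compact sets and closeness of maps *)

Section covers.
Context {R : realType} {n : nat} {M : manifold R n}.
Local Notation chartM := (chart R n (manifold_space M)).
Implicit Types (c : chartM) (p q : M) (S : set M).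

Lemma compact_closedM S : compact S -> closed S.
Proof. by apply: compact_closed; exact: manifold_hausdorff. Qed.

Lemma near_notin S p : closed S -> ~ S p -> \forall q \near p, ~ S q.
Proof.
by move=> cS nSp; apply: open_nbhs_nbhs; split => //; exact: closed_openC.
Qed.

Lemma closed_halfspace : closed (@halfspace R n).
Proof.
move=> x hx i i0; rewrite leNgt; apply/negP => xi.
have /hx [y [Hy]] : nbhs x [set y | `|y - x| < - x ord0 i].
  apply/nbhs_ballP; exists (- x ord0 i) => /=; first by rewrite oppr_gt0.
  by move=> y; rewrite -ball_normE /= distrC.
move=> /= /(le_lt_trans (mx_coef_norm _ ord0 i)); rewrite !mxE ltr_norml => /andP [_].
by rewrite ltrBlDr addNr ltNge Hy.
Qed.

Lemma compact_chart_ball c p (U : set M) : cdom c p -> nbhs p U ->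
  exists r : R, [/\ 0 < r,
    (forall y, @halfspace R n y -> `|y - cmap c p| <= r -> cimg c y /\ U (cinv c y)) &
    compact (cinv c @` [set y | @halfspace R n y /\ `|y - cmap c p| <= r])].
Proof.
move=> cp Up; have [iH i2] := cimg_hopen c.
have [r r0 hr] := cinv_near cp Up; have [r' r'0 hr'] := i2 _ (cimgP cp).
pose t := Num.min r r' / 2.
have m0 : 0 < Num.min r r' by rewrite lt_min r0.
have t0 : 0 < t by rewrite divr_gt0.
have [tr tr'] : t < r /\ t < r'.
  by apply/andP; rewrite -lt_min /t; lra.
have sub y : @halfspace R n y -> `|y - cmap c p| <= t -> cimg c y /\ U (cinv c y).
  move=> Hy yt; have iy : cimg c y by apply: hr' => //; apply: le_lt_trans tr'.
  by split=> //; apply: hr => //; apply: le_lt_trans tr.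
exists t; split=> //; apply: continuous_compact.
  apply: (@continuous_subspaceW _ _ _ (cimg c)) (@cinv_continuous _ _ _ c).
  by move=> y [Hy yt]; exact: (sub y Hy yt).1.
apply: bounded_closed_compact.
  exists (`|cmap c p| + t); split; first exact: num_real.
  move=> b hb y [_ yt]; apply: le_trans (ltW hb).
  exact: norm_leD.
have -> : [set y | @halfspace R n y /\ `|y - cmap c p| <= t] =
    @halfspace R n `&` closed_ball (cmap c p) t.
  rewrite closed_ballE //; apply/seteqP; split=> y [Hy]; rewrite /closed_ball_ /=;
  by rewrite distrC; split.
by apply: closedI; [exact: closed_halfspace|exact: closed_ball_closed].
Qed.

Lemma transition_bound c c' S : atlas c -> atlas c' -> compact S ->
  S `<=` cdom c -> S `<=` cdom c' ->
  exists2 C : R, 0 < C & forall p, S p -> `|transition c c' p| <= C.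
Proof.
move=> ac ac' cS Sc Sc'; apply: compact_norm_bound => // p Sp.
exact: transition_near ac ac' (Sc _ Sp) (Sc' _ Sp) ltr01.
Qed.

Lemma cmap_bound c S : compact S -> S `<=` cdom c ->
  exists2 C : R, 0 < C & forall p, S p -> `|cmap c p| <= C.
Proof.
move=> cS Sc; apply: compact_norm_bound => // p Sp.
by apply: filterS (cmap_near (Sc _ Sp) ltr01) => q /ltW.
Qed.

(** The last clause asks for a neighbourhood base at every point rather than a mere cover: disjoint
    pairs [L a], [L b] then separate any two points, so countably many rank conditions control all
    pairs of points. *)
Definition nice_cover (d : nat -> chartM) (L : nat -> set M) : Prop :=
  [/\ forall a, atlas (d a), forall a, compact (L a), forall a, L a `<=` cdom (d a) &
      forall p U, nbhs p U -> exists2 a, nbhs p (L a) & L a `<=` U].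

(** Take the closures of those members of a countable base that are compact and lie in one chart
    domain; coordinate balls show that there are arbitrarily small ones around every point. *)
Lemma nice_cover_exists : [set: M] !=set0 -> exists d L, nice_cover d L.
Proof.
move=> [p0 _]; have [c0 ac0 _] := chart_at p0.
have [B cB [oB basB]] := @manifold_second_countable _ _ M.
have [f finj] := countable_injP _ cB.
have /choice [dL hdL] : forall a : nat, exists dL : chartM * set M,
    [/\ atlas dL.1, compact dL.2, dL.2 `<=` cdom dL.1 &
      forall O, B O -> f O = a -> compact (closure O) ->
       (exists2 c : chartM, atlas c & closure O `<=` cdom c) -> dL.2 = closure O].
  move=> a; have [[W [BO fO cO [c ac Oc]]]|nx] := pselect (exists W, [/\ B W, f W = a,
    compact (closure W) & exists2 c : chartM, atlas c & closure W `<=` cdom c]).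
    exists (c, closure W); split=> // O' BO' fO' _ _ /=; congr closure.
    by apply: finj; rewrite ?inE // fO.
  (* Indices that come from no admissible basic set carry the empty set and an arbitrary chart. *)
  exists (c0, set0); split=> //=; first exact: compact0.
  by move=> O BO fO cO cc; exfalso; apply: nx; exists O.
exists (fun a => (dL a).1), (fun a => (dL a).2); split.
- by move=> a; have [] := hdL a.
- by move=> a; have [] := hdL a.
- by move=> a; have [] := hdL a.
move=> p U Up; have [c ac cp] := chart_at p.
have [r [r0 hr cP]] := compact_chart_ball cp (filterI Up (cdom_near cp)).
set P := cinv c @` _ in cP.
have PU : P `<=` U `&` cdom c by move=> _ [y [Hy yr] <-]; exact: (hr y Hy yr).2.
have Pp : nbhs p P.
  apply: filterS2 (cdom_near cp) (cmap_near cp r0) => q cq qr.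
  exists (cmap c q); last exact: cmapK.
  by split; [exact: (cimg_hopen c).1 (cimgP cq)|exact: ltW].
have [W [BO Op] OP] := basB p P Pp.
have clO : closure W `<=` P.
  by have := closure_subset OP; rewrite -((closure_id P).1 (compact_closedM cP)).
have cO : compact (closure W) by apply: subclosed_compact cP clO; exact: closed_closure.
have [_ _ _ /(_ W BO erefl cO) e] := hdL (f W).
exists (f W); rewrite e; try by exists c => //; move=> q /clO /PU [].
  by apply: filterS (open_nbhs_nbhs (conj (oB _ BO) Op)); exact: subset_closure.
by move=> q /clO /PU [].
Qed.

(** The [L i] need not be locally finite. Removing the earlier interiors makes them so, while the
    sets stay compact and still cover the manifold. *)
Definition shell (L : nat -> set M) i : set M :=
  L i `\` \bigcup_(j in [set j | (j < i)%N]) (L j)°.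

(** The tolerance may tend to zero along the shells, which makes these neighbourhoods fine enough
    for the strong topology. Derivatives are compared in the chart attached to the shell. *)
Definition close d L rho N (f g : C1map M N) : Prop :=
  forall i p, shell L i p -> `|f p - g p| <= rho i /\
    `|chart_jacobian f (d i) p - chart_jacobian g (d i) p| <= rho i :> R.

Section nice.
Context (d : nat -> chartM) (L : nat -> set M) (dL : nice_cover d L).

Lemma shell_compact i : compact (shell L i).
Proof.
have [_ cL _ _] := dL; rewrite /shell setDE; apply: compact_closedI => //.
by apply: open_closedC; apply: bigcup_open => j _; exact: open_interior.
Qed.

Lemma shell_cover p : exists i, shell L i p.
Proof.
have [_ _ _ hb] := dL.
have ex : exists i, `[< (L i)° p >].
  by have [a ha _] := hb p setT filterT; exists a; apply/asboolP.
have /asboolP pi := ex_minnP ex; case: (ex_minnP ex) => i /asboolP Lp imin.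
exists i; split; first exact: interior_subset.
by move=> [j /= ji Ljp]; have := imin j (asboolT Ljp); rewrite leqNgt ji.
Qed.

Lemma shell_locally_finite S : compact S ->
  exists m, forall i p, S p -> shell L i p -> (i < m)%N.
Proof.
move=> cS; have [_ _ _ hb] := dL.
apply: (@compact_ind _ S (fun S => exists m, forall i p, S p -> shell L i p -> (i < m)%N)) => //.
- by exists 0%N.
- by move=> S1 S2 SS [m hm]; exists m => i p /SS; exact: hm.
- move=> S1 S2 [m hm] [m' hm']; exists (maxn m m') => i p [/hm h|/hm' h] /h;
  by rewrite leq_max => ->; rewrite ?orbT.
move=> p _; have [a ha _] := hb p setT filterT.
exists (L a)°; first by apply: nbhs_interior.
exists a.+1 => i q [Laq _] [_ nq]; rewrite ltnS leqNgt; apply/negP => ai.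
by apply: nq; exists a.
Qed.

(** Only finitely many shells meet the compact set [S], and the transition matrices from [c] to
    their charts are bounded there; [D] dominates all these bounds. *)
Lemma close_transfer c S N (e : R) : atlas c -> compact S -> S `<=` cdom c -> 0 < e ->
  exists2 rho : R, 0 < rho & forall f g : C1map M N,
    (forall i p, shell L i p -> S p -> `|f p - g p| <= rho /\
      `|chart_jacobian f (d i) p - chart_jacobian g (d i) p| <= rho) ->
    forall p, S p -> `|f p - g p| <= e /\
      `|chart_jacobian f c p - chart_jacobian g c p| <= e.
Proof.
move=> ac cS Sc e0; have [ad cL Ld hb] := dL.
have [m hm] := shell_locally_finite cS.
have /choice [C hC] : forall i, exists C : R, 0 < C /\
    forall p, (shell L i `&` S) p -> `|transition c (d i) p| <= C.
  move=> i; have [|p [[Lp _] Sp]|p [[Lp _] _]|C C0 h] :=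
      @transition_bound c (d i) (shell L i `&` S) ac (ad i).
  - by apply: compact_closedI; [exact: shell_compact|exact: compact_closedM].
  - exact: Sc.
  - exact: Ld.
  - by exists C.
pose D := 1 + \sum_(i < m) n%:R * C i.
have nC i : 0 <= n%:R * C i by rewrite mulr_ge0 //; have [/ltW] := hC i.
have D1 : 1 <= D by rewrite lerDl sumr_ge0.
have D0 : 0 < D by apply: lt_le_trans D1.
exists (e / D) => [|f g h p Sp]; first by rewrite divr_gt0.
have [i Kp] := shell_cover p; have [h1 h2] := h i p Kp Sp.
have im := hm i p Sp Kp; split.
  by apply: (le_trans h1); rewrite ler_pdivrMr // ler_peMr // ltW.
have [Lp _] := Kp.
rewrite !(chart_jacobian_transition _ ac (ad i) (Sc _ Sp) (Ld _ _ Lp)) -mulmxBr.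
apply: (le_trans (mx_norm_mul _ _)).
apply: (@le_trans _ _ (n%:R * C i * (e / D))).
  apply: ler_pM => //.
  by rewrite ler_wpM2l //; apply: (hC i).2.
rewrite mulrCA ger_pMr // ler_pdivrMr // mul1r /D (bigD1 (Ordinal im)) //=.
by rewrite addrCA lerDl addr_ge0 // sumr_ge0.
Qed.

End nice.

End covers.

#[local] Opaque transition.

(** * Extending modifications in a chart to the manifold *)

Section extension.
Context {R : realType} {n : nat} {M : manifold R n}.
Local Notation chartM := (chart R n (manifold_space M)).
Implicit Types (c : chartM) (p q : M) (S : set M).

(** Extension by zero. The complement of the compact, hence closed, set [S] is open and [g = f]
    there; on [cdom c] the map is a sum of C^1 maps; the two open sets cover the manifold. *)
Lemma add_extend N (f : C1map M N) c (u : 'rV[R]_n -> 'rV[R]_N) U S :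
  atlas c -> C1w (cimg c) u U -> compact S -> S `<=` cdom c ->
  (forall p, cdom c p -> ~ S p -> u (cmap c p) = 0) ->
  exists g : C1map M N,
   [/\ forall p, cdom c p -> g p = f p + u (cmap c p),
       forall p, ~ S p -> g p = f p,
       forall p, cdom c p ->
         chart_jacobian g c p = chart_jacobian f c p + U (cmap c p) &
       forall c' p, atlas c' -> cdom c' p -> ~ S p ->
         chart_jacobian g c' p = chart_jacobian f c' p].
Proof.
move=> ac cu cS Sc u0.
pose g0 (p : M) : 'rV[R]_N := f p + (if `[< cdom c p >] then u (cmap c p) else 0).
have g0c p : cdom c p -> g0 p = f p + u (cmap c p).
  by move=> cp; rewrite /g0 asboolT.
have g0S p : ~ S p -> g0 p = f p.
  move=> nS; rewrite /g0; case: asboolP => cp; last by rewrite addr0.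
  by rewrite u0 // addr0.
have jc p : cdom c p -> has_jac g0 c p (chart_jacobian f c p + U (cmap c p)).
  move=> cp; apply: (@has_jac_local _ _ _ _ _ (fun q => f q + u (cmap c q))) => //.
    by apply: filterS (cdom_near cp) => q; exact: g0c.
  apply: has_jac_add; first exact: C1map_has_jac.
  apply: (@is_jac_local _ _ _ _ (cimg c) _ u); first exact: cimgP.
    by exists 1 => // y iy _; split=> //=; rewrite (cinv_dom iy).2.
  exact: cu.1 (cimgP cp).
have jS c' p : atlas c' -> cdom c' p -> ~ S p -> has_jac g0 c' p (chart_jacobian f c' p).
  move=> ac' cp nS; apply: (@has_jac_local _ _ _ _ _ f) => //.
    by apply: filterS (near_notin (compact_closedM cS) nS) => q; exact: g0S.
  exact: C1map_has_jac.
have g0C1 : is_C1 g0.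
  apply: is_C1_local => p; have [cp|ncp] := pselect (cdom c p).
    exists c; split=> //; exists (fun q => chart_jacobian f c q + U (cmap c q)).
      by apply: filterS (cdom_near cp) => q; exact: jc.
    move=> e e0; have e20 : 0 < e / 2 by rewrite divr_gt0.
    have [r r0 hr] := cu.2 _ (cimgP cp) _ e20.
    apply: filterS3 (cdom_near cp) (cmap_near cp r0)
      (chart_jacobian_near f ac cp e20) => q cq qr hq.
    have := hr _ (cimgP cq) qr => hU.
    rewrite opprD addrACA; apply: (le_trans (ler_normD _ _)).
    have -> : e = e / 2 + e / 2 by field.
    exact: lerD.
  have [c' ac' cp'] := chart_at p.
  have nS : ~ S p by move=> /Sc.
  exists c'; split=> //; exists (fun q => chart_jacobian f c' q).
    apply: filterS2 (cdom_near cp') (near_notin (compact_closedM cS) nS) => q cq nSq.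
    exact: jS.
  by move=> e e0; exact: chart_jacobian_near.
exists (C1Map g0C1); split; [exact: g0c|exact: g0S| |].
- by move=> p cp; exact: chart_jacobianE cp (jc p cp).
- by move=> c' p ac' cp nS; exact: chart_jacobianE cp (jS c' p ac' cp nS).
Qed.

Lemma is_grad_mul (A : set 'rV[R]_n) a b x da db : is_grad A a x da ->
  is_grad A b x db -> is_grad A (fun y => a y * b y) x (a x *: db + b x *: da).
Proof.
move=> ha /is_grad_jac hb; apply/is_grad_jac.
have := is_jac_scale ha hb; rewrite mul_mx_scalar.
have -> : (fun y => a y *: (b y)%:M) = (fun y => (a y * b y)%:M : 'rV[R]_1).
  by apply/funext => y; rewrite scale_scalar_mx.
exact.
Qed.

(** The normalization [0] on [A] and [1] off [S] lets the functions [1 - psi] of a finite cover be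
    combined by multiplication. *)
Lemma cutoff_exists c (A B : set M) : (0 < n)%N -> atlas c -> compact A -> A `<=` cdom c ->
  closed B -> A `&` B = set0 ->
  exists (k : 'rV[R]_n -> R) (D : 'rV[R]_n -> 'cV[R]_n) (S : set M) (C : R),
  [/\ (forall X x, is_grad X k x (D x)) /\ cont_on setT D,
      forall x, 0 <= k x <= 1 /\ `|D x| <= C,
      [/\ compact S, S `<=` cdom c & S `&` B = set0],
      forall p, A p -> k (cmap c p) = 0 /\ D (cmap c p) = 0 &
      forall p, cdom c p -> ~ S p -> k (cmap c p) = 1 /\ D (cmap c p) = 0].
Proof.
move=> n0 ac cA Ac clB AB0.
have AB p : A p -> ~ B p by move=> Ap Bp; have : (A `&` B) p by []; rewrite AB0.
pose P (A : set M) := exists (k : 'rV[R]_n -> R) (D : 'rV[R]_n -> 'cV[R]_n) (S : set M) (C : R),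
  [/\ (forall X x, is_grad X k x (D x)) /\ cont_on setT D,
      forall x, 0 <= k x <= 1 /\ `|D x| <= C,
      [/\ compact S, S `<=` cdom c & S `&` B = set0],
      forall p, A p -> k (cmap c p) = 0 /\ D (cmap c p) = 0 &
      forall p, cdom c p -> ~ S p -> k (cmap c p) = 1 /\ D (cmap c p) = 0].
rewrite -/(P A); apply: compact_ind => //.
- exists (fun=> 1), (fun=> 0), set0, 0; split=> //.
  + split; last exact: cont_on_cst.
    by move=> X x e e0; exists 1 => // y _ _; rewrite subrr mulmx0 mxE subr0 normr0 mulr_ge0 // ltW.
  + by move=> x; rewrite ler01 lexx normr0.
  + by split=> //; [exact: compact0|rewrite set0I].
- move=> A1 A2 A12 [k [D [S [C [h1 h2 h3 h4 h5]]]]]; exists k, D, S, C; split=> //.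
  by move=> p /A12; exact: h4.
- move=> A1 A2 [k [D [S [C [[g cD] h2 [cS Sc SB] h4 h5]]]]].
  move=> [k' [D' [S' [C' [[g' cD'] h2' [cS' Sc' SB'] h4' h5']]]]].
  exists (fun x => k x * k' x), (fun x => k x *: D' x + k' x *: D x), (S `|` S'), (C + C').
  split.
  + split; first by move=> X x; apply: is_grad_mul; [exact: g|exact: g'].
    apply: cont_on_add; apply: cont_on_scale => //; apply: is_grad_cont => x; [exact: g|exact: g'].
  + move=> x; have [/andP [k0 k1] DC] := h2 x; have [/andP [k0' k1'] DC'] := h2' x; split.
      by rewrite mulr_ge0 //= mulr_ile1.
    rewrite addrC; apply: (le_trans (ler_normD _ _)); rewrite !normrZ !ger0_norm //.
    by apply: lerD; [apply: le_trans DC|apply: le_trans DC']; exact: ler_piMl.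
  + split; first exact: compactU.
      by move=> p []; [exact: Sc|exact: Sc'].
    by rewrite setIUl SB SB' setU0.
  + move=> p [/h4 [-> ->]|/h4' [-> ->]]; first by rewrite mul0r scale0r scaler0 addr0.
    by rewrite mulr0 scale0r scaler0 addr0.
  + move=> p cp /not_orP [nS nS']; have [-> ->] := h5 p cp nS; have [-> ->] := h5' p cp nS'.
    by rewrite mulr1 !scaler0 addr0.
move=> p Ap; have cp := Ac _ Ap.
have [r [r0 hr cS]] := compact_chart_ball cp (near_notin clB (AB _ Ap)).
have d0 : 0 < r / 2 by rewrite divr_gt0.
have [psi [D [gpsi psi01 [psi1 psi0] Dle blD]]] := bump_exists (cmap c p) d0 n0.
have rn : 0 < r / 2 / n%:R by rewrite divr_gt0 // ltr0n.
exists [set q | cdom c q /\ `|cmap c q - cmap c p| < r / 2 / n%:R].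
  by apply: filterS2 (cdom_near cp) (cmap_near cp rn) => q.
exists (fun x => 1 + (-1) * psi x), (fun x => (-1) *: D x),
  (cinv c @` [set y | @halfspace R n y /\ `|y - cmap c p| <= r]), (16 / (r / 2)).
split.
- split; first by move=> X x; exact: is_grad_affine_comp.
  apply: cont_on_scale; first exact: cont_on_cst.
  by apply: blip_cont_bounded => // Y B0 hB0; exact: (blD Y B0 hB0).2.
- move=> x; split; first by have /andP [p0 p1] := psi01 x; apply/andP; split; lra.
  by rewrite scaleN1r normrN.
- split=> //.
    by move=> _ [y [Hy yr] <-]; have [iy _] := hr y Hy yr; exact: (cinv_dom iy).1.
  apply/seteqP; split=> // _ [[y [Hy yr] <-]]; exact: (hr y Hy yr).2.
- move=> q [[cq qr] _]; have [|-> ->] := psi1 (cmap c q).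
    by rewrite mulrC -ler_pdivlMr ?ltr0n // ltW.
  by rewrite mulr1 subrr scaler0.
- move=> q cq nS; have [|-> ->] := psi0 (cmap c q); last by rewrite mulr0 addr0 scaler0.
  have -> : 2 * (r / 2) = r by field.
  rewrite leNgt; apply/negP => qr; apply: nS; exists (cmap c q); last exact: cmapK.
  by split; [exact: (cimg_hopen c).1 (cimgP cq)|exact: ltW].
Qed.

Section nice.
Context (d : nat -> chartM) (L : nat -> set M) (dL : nice_cover d L).

Lemma close_trans N rho rho' (f g h : C1map M N) : close d L rho f g ->
  close d L rho' g h -> close d L (fun i => rho i + rho' i) f h.
Proof.
move=> fg gh i p sp; have [a1 a2] := fg i p sp; have [b1 b2] := gh i p sp.
by split; [exact: distD a1 b1|exact: distD a2 b2].
Qed.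

(** The opposite direction to [close_transfer]: smallness in the single chart [c] implies smallness
    in the charts of the finitely many shells that meet [S]. *)
Lemma extend_small c S (rho : nat -> R) : atlas c -> compact S -> S `<=` cdom c ->
  (forall i, 0 < rho i) ->
  exists2 eta : R, 0 < eta & forall N (f g : C1map M N) (u : 'rV[R]_n -> 'rV[R]_N) U,
    (forall p, S p -> g p = f p + u (cmap c p)) ->
    (forall p, ~ S p -> g p = f p) ->
    (forall p, S p -> chart_jacobian g c p = chart_jacobian f c p + U (cmap c p)) ->
    (forall c' p, atlas c' -> cdom c' p -> ~ S p ->
         chart_jacobian g c' p = chart_jacobian f c' p) ->
    (forall p, S p -> `|u (cmap c p)| <= eta /\ `|U (cmap c p)| <= eta) ->
    close d L rho f g.
Proof.
move=> ac cS Sc rho0; have [ad cL Ld hb] := dL.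
have [m hm] := shell_locally_finite dL cS.
have /choice [C hC] : forall i, exists C : R, 0 < C /\
    forall p, (shell L i `&` S) p -> `|transition (d i) c p| <= C.
  move=> i; have [|p [[Lp _] _]|p [[Lp _] Sp]|C C0 h] :=
      @transition_bound _ _ _ (d i) c (shell L i `&` S) (ad i) ac.
  - by apply: compact_closedI; [exact: shell_compact|exact: compact_closedM].
  - exact: Ld.
  - exact: Sc.
  - by exists C.
(* [E] exceeds each [t i] with [i < m], hence [(n * C i + 1) / E <= rho i] on every shell that meets
   [S]. *)
pose t i := (n%:R * C i + 1) / rho i.
have t0 i : 0 < t i.
  by rewrite divr_gt0 // ltr_wpDl // mulr_ge0 // ltW //; exact: (hC i).1.
pose E := 1 + \sum_(i < m) t i.
have E0 : 0 < E by rewrite ltr_pwDl // sumr_ge0 // => i _; exact: ltW.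
exists E^-1 => [|N f g u U gS gnS jS jnS small i p sp]; first by rewrite invr_gt0.
have [Lp _] := sp.
have [Sp|nSp] := pselect (S p); last first.
  rewrite (gnS _ nSp) (jnS _ _ (ad i) (Ld _ _ Lp) nSp) !subrr !normr0.
  by split; exact: ltW.
have im := hm i p Sp sp.
have key : (n%:R * C i + 1) * E^-1 <= rho i.
  rewrite ler_pdivrMr // -ler_pdivrMl // [leLHS]mulrC -/(t i) /E.
  rewrite (bigD1 (Ordinal im)) //= addrCA lerDl addr_ge0 // sumr_ge0 // => j _.
  exact: ltW.
have nC : 0 <= n%:R * C i by rewrite mulr_ge0 // ltW //; exact: (hC i).1.
have Ei : 0 <= E^-1 by rewrite invr_ge0 ltW.
have [su sU] := small p Sp; split.
  rewrite gS // opprD addrA subrr sub0r normrN; apply: (le_trans su).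
  by apply: le_trans key; rewrite ler_peMl // lerDr.
rewrite (chart_jacobian_transition f (ad i) ac (Ld _ _ Lp) (Sc _ Sp)).
rewrite (chart_jacobian_transition g (ad i) ac (Ld _ _ Lp) (Sc _ Sp)).
rewrite jS // -mulmxBr opprD addrA subrr sub0r mulmxN normrN.
apply: (le_trans (mx_norm_mul _ _)); apply: le_trans key.
apply: (@le_trans _ _ (n%:R * C i * E^-1)); last by rewrite ler_wpM2r // lerDl.
apply: ler_pM => //; rewrite ler_wpM2l //; exact: (hC i).2.
Qed.

End nice.
End extension.

(** * Stability of full row rank *)

Section rank_stability.
Context {R : realType}.

(** If [B] is a right inverse of [A] and [w *m A' = 0], then [w = w *m (A - A') *m B], whose norm is
    at most [|w| * C / (C + 1)]. *)
Lemma row_free_open m N (A : 'M[R]_(m, N)) : row_free A ->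
  exists2 mu : R, 0 < mu & forall A' : 'M[R]_(m, N), `|A' - A| <= mu -> row_free A'.
Proof.
move=> /row_freeP [B AB].
pose C := m%:R * N%:R * `|B|.
have C0 : 0 <= C by rewrite !mulr_ge0.
have C1 : 0 < C + 1 by rewrite ltr_wpDl.
exists (C + 1)^-1 => [|A' h]; first by rewrite invr_gt0.
apply/row_freeP0 => w wA'; apply/eqP; rewrite -normr_le0.
have wE : w = w *m (A - A') *m B by rewrite mulmxBr wA' subr0 -mulmxA AB mulmx1.
have : `|w| <= `|w| * (C * (C + 1)^-1).
  rewrite {1}wE; apply: (le_trans (mx_norm_mul _ _)).
  have h' : `|A - A'| <= (C + 1)^-1 by rewrite distrC.
  have -> : `|w| * (C * (C + 1)^-1) = (N%:R * (m%:R * `|w| * (C + 1)^-1)) * `|B|.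
    by rewrite /C; ring.
  rewrite ler_wpM2r // ler_wpM2l //; apply: (le_trans (mx_norm_mul _ _)).
  by rewrite ler_wpM2l // mulr_ge0.
have c1 : C * (C + 1)^-1 < 1 by rewrite ltr_pdivrMr // mul1r ltrDl.
have := normr_ge0 w; set u := `|w|; set c := C * _ in c1 *; nra.
Qed.

Lemma perturb_row_free_le m N d (T : Type) (S : set T) (phi : T -> 'M[R]_(m, N))
    (eps : R) :
  (d + m <= N)%N -> 0 < eps -> cov d S phi ->
  exists2 tau : 'M[R]_(m, N), `|tau| <= eps & forall x, S x -> row_free (phi x + tau).
Proof.
case: m phi => [|k] phi dm eps0 cS.
  exists 0 => [|x _]; first by rewrite normr0 ltW.
  by apply/row_freeP0 => w _; apply/rowP => -[].
by apply: perturb_row_free cS; rewrite ?addnS // -addnS.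
Qed.

(* The change of basis [(a, b, c) |-> (a + c x, b - c y, c)] of coefficient
   vectors. *)
Lemma row_free_shear n N (J1 J2 b1 b2 : 'M[R]_(n, N)) (v1 v2 al : 'rV[R]_N)
    (x y : 'rV[R]_n) :
  row_free (col_mx J1 (col_mx J2 ((v1 - x *m J1) - (v2 - y *m J2))) +
            col_mx b1 (col_mx b2 al)) ->
  row_free (col_mx (J1 + b1) (col_mx (J2 + b2) ((v1 + (al + x *m b1)) - (v2 + (0 + y *m b2))))).
Proof.
move=> /row_freeP0 h; apply/row_freeP0 => w.
rewrite -(hsubmxK w) -(hsubmxK (rsubmx w)).
set a := lsubmx w; set b := lsubmx (rsubmx w); set c := rsubmx (rsubmx w).
rewrite !mul_row_col => e.
have /h : row_mx (a + c *m x) (row_mx (b - c *m y) c) *m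
  (col_mx J1 (col_mx J2 ((v1 - x *m J1) - (v2 - y *m J2))) + col_mx b1 (col_mx b2 al)) = 0.
  rewrite !add_col_mx !mul_row_col -[RHS]e add0r.
  rewrite !(mulmxDl, mulmxDr, mulNmx, mulmxN) !mulmxA.
  move: (a *m J1) (a *m b1) (c *m x *m J1) (c *m x *m b1) (b *m J2) (b *m b2) => t1 t2 t3 t4 t5 t6.
  move: (c *m y *m J2) (c *m y *m b2) (c *m v1) (c *m v2) (c *m al) => t7 t8 t9 t10 t11.
  by apply/rowP => j; rewrite !mxE; ring.
rewrite -[X in _ = X -> _]row_mx0.
move=> /eq_row_mx [e1]; rewrite -[X in _ = X -> _]row_mx0 => /eq_row_mx [e2 e3].
rewrite e3 mul0mx addr0 in e1; rewrite e3 mul0mx subr0 in e2.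
by rewrite e1 e2 e3 !row_mx0.
Qed.

End rank_stability.

(** * Density of the rank condition on two disjoint compact sets *)

Section density.
Context {R : realType} {n : nat} {M : manifold R n}.
Local Notation chartM := (chart R n (manifold_space M)).
Implicit Types (c : chartM) (p q : M) (S A B : set M).

Definition tangents N (f : C1map M N) c c' p q : 'M[R]_(n + (n + 1), N) :=
  col_mx (chart_jacobian f c p) (col_mx (chart_jacobian f c' q) (f p - f q)).

Lemma norm_tangentsB N (f g : C1map M N) c c' p q p' q' (e : R) :
  `|chart_jacobian f c p - chart_jacobian g c p'| <= e ->
  `|chart_jacobian f c' q - chart_jacobian g c' q'| <= e ->
  `|f p - g p'| <= e -> `|f q - g q'| <= e ->
  `|tangents f c c' p q - tangents g c c' p' q'| <= 2 * e.
Proof.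
move=> h1 h2 h3 h4; have e0 : 0 <= e by apply: le_trans h3.
have e2 : e <= 2 * e by rewrite ler_peMl // ler1n.
rewrite /tangents opp_col_mx add_col_mx opp_col_mx add_col_mx.
apply: (le_trans (norm_col_mx _ _)); rewrite ge_max (le_trans h1) //=.
apply: (le_trans (norm_col_mx _ _)); rewrite ge_max (le_trans h2) //=.
have -> : f p - f q - (g p' - g q') = (f p - g p') - (f q - g q').
  by apply/rowP => j; rewrite !mxE; ring.
by apply: (le_trans (ler_normB _ _)); rewrite mulr_natl mulr2n lerD.
Qed.

(** Openness of full rank, made uniform over the compact product of [A] and [B]. The slack is halved
    because [tangents] changes by at most twice the change of its ingredients. *)
Lemma row_free_stable N (f : C1map M N) c c' A B : atlas c -> atlas c' ->
  compact A -> compact B -> A `<=` cdom c -> B `<=` cdom c' ->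
  (forall p q, A p -> B q -> row_free (tangents f c c' p q)) ->
  exists2 mu : R, 0 < mu & forall g : C1map M N,
    (forall p, A p -> `|f p - g p| <= mu /\
       `|chart_jacobian f c p - chart_jacobian g c p| <= mu) ->
    (forall q, B q -> `|f q - g q| <= mu /\
       `|chart_jacobian f c' q - chart_jacobian g c' q| <= mu) ->
    forall p q, A p -> B q -> row_free (tangents g c c' p q).
Proof.
move=> ac ac' cA cB Ac Bc hf.
have [||[p q] [/= Ap Bq]|mu mu0 h] := @compact_min_radius _ R (A `*` B)
  (fun mu z => forall A' : 'M[R]_(n + (n + 1), N), `|A' - tangents f c c' z.1 z.2| <= mu -> row_free A').
- exact: compact_setX.
- by move=> b b' z bb h A' hA'; apply: h; apply: le_trans bb.
- have [mu mu0 h] := row_free_open (hf p q Ap Bq).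
  exists (mu / 2); first by rewrite divr_gt0.
  have m4 : 0 < mu / 4 by rewrite divr_gt0.
  have muE : mu / 2 + 2 * (mu / 4) = mu by field.
  exists ([set p' | `|f p' - f p| <= mu / 4 /\
      `|chart_jacobian f c p' - chart_jacobian f c p| <= mu / 4],
    [set q' | `|f q' - f q| <= mu / 4 /\
      `|chart_jacobian f c' q' - chart_jacobian f c' q| <= mu / 4]) => /=.
    split; apply: filterI; try exact: C1map_near.
      exact: chart_jacobian_near ac (Ac _ Ap) m4.
    exact: chart_jacobian_near ac' (Bc _ Bq) m4.
  move=> [p' q'] /= [[h1 h2] [h3 h4]] _ A' hA'; apply: h.
  rewrite -muE; exact: distD hA' (norm_tangentsB h2 h4 h1 h3).
have muE : 2 * (mu / 2) = mu by field.
exists (mu / 2) => [|g hA hB p q Ap Bq]; first by rewrite divr_gt0.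
apply: (h (p, q)); first by split.
have [a1 a2] := hA p Ap; have [b1 b2] := hB q Bq.
by rewrite distrC -muE; exact: norm_tangentsB a2 b2 a1 b1.
Qed.

(** Provides room to modify a map near [A] in coordinates while leaving it unchanged on [B]. *)
Lemma separated_neighborhood c A B : compact A -> A `<=` cdom c -> closed B ->
  A `&` B = set0 ->
  exists (r : R) (S : set M), [/\ 0 < r, compact S, S `<=` cdom c, S `&` B = set0 &
    forall p y, A p -> @halfspace R n y -> `|y - cmap c p| < r ->
      cimg c y /\ S (cinv c y)].
Proof.
move=> cA Ac clB AB0.
have AB p : A p -> ~ B p by move=> Ap Bp; have : (A `&` B) p by []; rewrite AB0.
apply: (@compact_ind _ A (fun A => exists (r : R) (S : set M),
  [/\ 0 < r, compact S, S `<=` cdom c, S `&` B = set0 &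
    forall p y, A p -> @halfspace R n y -> `|y - cmap c p| < r ->
      cimg c y /\ S (cinv c y)])) => //.
- by exists 1, set0; split=> //; [exact: compact0|rewrite set0I].
- move=> A1 A2 A12 [r [S [h1 h2 h3 h4 h5]]]; exists r, S; split=> //.
  by move=> p y /A12; exact: h5.
- move=> A1 A2 [r [S [h1 h2 h3 h4 h5]]] [r' [S' [h1' h2' h3' h4' h5']]].
  exists (Num.min r r'), (S `|` S'); split.
  + by rewrite lt_min h1.
  + exact: compactU.
  + by move=> p []; [exact: h3|exact: h3'].
  + by rewrite setIUl h4 h4' setU0.
  + move=> p y [Ap|Ap] Hy; rewrite lt_min => /andP [yr yr'].
      by have [? ?] := h5 p y Ap Hy yr; split=> //; left.
    by have [? ?] := h5' p y Ap Hy yr'; split=> //; right.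
move=> p Ap; have cp := Ac _ Ap.
have [r [r0 hr cS]] := compact_chart_ball cp (near_notin clB (AB _ Ap)).
have r20 : 0 < r / 2 by rewrite divr_gt0.
exists [set q | `|cmap c q - cmap c p| < r / 2]; first exact: cmap_near.
exists (r / 2), (cinv c @` [set y | @halfspace R n y /\ `|y - cmap c p| <= r]); split=> //.
- by move=> _ [y [Hy yr] <-]; have [iy _] := hr y Hy yr; exact: (cinv_dom iy).1.
- apply/seteqP; split=> // _ [[y [Hy yr] <-]]; exact: (hr y Hy yr).2.
move=> q y [/= qr _] Hy yq.
have yr : `|y - cmap c p| <= r.
  have -> : r = r / 2 + r / 2 by field.
  exact: distD (ltW yq) (ltW qr).
by split; [exact: (hr y Hy yr).1|exists y].
Qed.

Section nice.
Context (d : nat -> chartM) (L : nat -> set M) (dL : nice_cover d L) (n_gt0 : (0 < n)%N).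

Definition agree_on N B (f g : C1map M N) : Prop :=
  forall q, B q -> f q = g q /\ forall c, atlas c -> cdom c q ->
    chart_jacobian f c q = chart_jacobian g c q.

(* The pairs [(Df, f - x Df)] are the first order Taylor polynomials of [g] at the
   points of [A]. *)
Lemma smooth_near N (f : C1map M N) c A B (rho : nat -> R) : atlas c -> compact A ->
  A `<=` cdom c -> closed B -> A `&` B = set0 -> (forall i, 0 < rho i) ->
  exists g : C1map M N, [/\ close d L rho f g, agree_on B f g &
    cov n A (fun p => (chart_jacobian g c p, g p - cmap c p *m chart_jacobian g c p))].
Proof.
move=> ac cA Ac clB AB0 rho0.
have [r [S [r0 cS Sc SB hS]]] := separated_neighborhood cA Ac clB AB0.
have [eta eta0 small] := extend_small dL ac cS Sc rho0.
have iA p : A p -> cimg c (cmap c p) by move=> /Ac /cimgP.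
have AS p : A p -> S p.
  move=> Ap; have [|_] := hS p (cmap c p) Ap ((cimg_hopen c).1 _ (iA p Ap)).
    by rewrite subrr normr0.
  by rewrite cmapK //; exact: Ac.
pose F := f \o cinv c; pose DF := jacobian_within (cimg c) F.
have cF : C1w (cimg c) F DF by apply/C1_onP; exact: (C1mapP f ac).
have [B0 B00 hB0] := cmap_bound cA Ac.
have ucont e : 0 < e -> exists2 dd, 0 < dd & forall x y, (cmap c @` A) x -> cimg c y ->
    `|y - x| < dd -> `|DF x - DF y| <= e.
  move=> e0; have [||p Ap|dd dd0 h] := @compact_min_radius _ R A (fun dd p =>
    forall y, cimg c y -> `|y - cmap c p| < dd -> `|DF (cmap c p) - DF y| <= e) => //.
  - by move=> b b' p bb h y iy yb; apply: h => //; apply: lt_le_trans bb.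
  - have e20 : 0 < e / 2 by rewrite divr_gt0.
    have eE : e / 2 + e / 2 = e by field.
    have [b b0 hb] := cF.2 _ (iA p Ap) _ e20.
    have b3 : 0 < b / 4 by rewrite divr_gt0.
    have b4 : b / 4 + b / 4 < b by lra.
    exists (b / 4) => //.
    apply: filterS (cmap_near (Ac _ Ap) b3) => q qb Aq y iy yb.
    have q2 : `|y - cmap c p| < b by apply: le_lt_trans b4; exact: distD (ltW yb) (ltW qb).
    have q1 : `|cmap c q - cmap c p| < b.
      by apply: lt_trans qb _; apply: le_lt_trans b4; rewrite lerDl ltW.
    have E1 := hb _ (iA q Aq) q1; have E2 := hb _ iy q2.
    by rewrite distrC in E2; rewrite -eE; exact: distD E1 E2.
  by exists dd => // _ y [p Ap <-]; exact: h.
have [|||s [S' [c1 sF far covA]]] := @smoothing _ _ n_gt0 _ (cimg c) F DF (cmap c @` A) r B0 eta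
  (cimg_hopen c) cF r0 eta0 _ _ _ ucont.
- by move=> _ [p Ap <-]; exact: hB0.
- by move=> _ [p Ap <-]; apply: (cimg_hopen c).1; exact: iA.
- by move=> _ y [p Ap <-] Hy yr; exact: (hS p y Ap Hy yr).1.
pose u x := s x - F x; pose U x := S' x - DF x.
have cu : C1w (cimg c) u U by apply: C1w_add => //; exact: C1w_opp.
have [|g [g1 g2 g3 g4]] := @add_extend _ _ _ _ f c u U S ac cu cS Sc.
  move=> p cp nS; rewrite /u far ?subrr //; first exact: cimgP.
  move=> _ [q Aq <-]; rewrite leNgt; apply/negP => qr; apply: nS.
  have := (hS q (cmap c p) Aq ((cimg_hopen c).1 _ (cimgP cp)) qr).2.
  by rewrite cmapK.
have FE p : cdom c p -> F (cmap c p) = f p by move=> cp; rewrite /F /= cmapK.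
exists g; split.
- apply: (small _ f g u U) => //.
  + by move=> p /Sc; exact: g1.
  + by move=> p /Sc; exact: g3.
  + by move=> p /Sc /cimgP; exact: sF.
- move=> q Bq; have nS : ~ S q by move=> Sq; have : (S `&` B) q by []; rewrite SB.
  split; first by rewrite g2.
  by move=> c' ac' cq; rewrite (g4 c' q ac' cq nS).
apply: cov_reindex covA => p Ap; exists (cmap c p); first by exists p.
have cp := Ac _ Ap.
have e1 : chart_jacobian g c p = S' (cmap c p).
  by rewrite (g3 p cp) /U addrC subrK.
by rewrite e1 (g1 p cp) /u FE // [f p + _]addrC subrK.
Qed.

(** The affine map is multiplied by [1 - k], so it is unchanged on [A] and vanishes off [S]. The
    bound [t] precedes [f]: it depends only on the cut-off and on the size of the chart on [S], so
    [tau] can be selected after the smoothing. *)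
Lemma affine_near c A B (rho : nat -> R) : atlas c -> compact A ->
  A `<=` cdom c -> closed B -> A `&` B = set0 -> (forall i, 0 < rho i) ->
  exists2 t : R, 0 < t & forall N (f : C1map M N) (al : 'rV[R]_N) (be : 'M[R]_(n, N)),
    `|al| <= t -> `|be| <= t ->
    exists g : C1map M N, [/\ close d L rho f g, agree_on B f g &
      forall p, A p -> g p = f p + (al + cmap c p *m be) /\
        chart_jacobian g c p = chart_jacobian f c p + be].
Proof.
move=> ac cA Ac clB AB0 rho0.
have [k [D [S [C [[gk cD] kC [cS Sc SB] kA kS]]]]] :=
  cutoff_exists n_gt0 ac cA Ac clB AB0.
have [eta eta0 small] := extend_small dL ac cS Sc rho0.
have [B0 B00 hB0] := cmap_bound cS Sc.
have C0 : 0 <= C by have [_] := kC 0; apply: le_trans.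
pose Q : R := 1 + n%:R * B0.
have Q1 : 1 <= Q by rewrite lerDl mulr_ge0 // ltW.
have Q0 : 0 < Q by apply: lt_le_trans Q1.
(* [Q * t] bounds the added value, and [t + C * Q * t] the added derivative, whose second term comes
   from the gradient of the cut-off. *)
pose K := Q + (1 + C * Q).
have CQ0 : 0 <= C * Q by rewrite mulr_ge0 // ltW.
have K0 : 0 < K by apply: addr_gt0 => //; rewrite ltr_pwDl.
exists (eta / K) => [|N f al be alt bet]; first by rewrite divr_gt0.
set t := eta / K in alt bet.
have t0 : 0 <= t by apply: le_trans alt.
pose T x := al + x *m be.
pose k' x := 1 + (-1) * k x; pose D' x : 'cV[R]_n := (-1) *: D x.
pose u x := k' x *: T x; pose U x := k' x *: be + D' x *m T x.
have cu : C1w (cimg c) u U.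
  apply: C1w_scale.
  - by move=> x; apply: is_grad_affine_comp; exact: gk.
  - by apply: cont_on_scale; [exact: cont_on_cst|exact: cont_on_sub cD].
  - exact: C1w_affine.
have [|g [g1 g2 g3 g4]] := @add_extend _ _ _ _ f c u U S ac cu cS Sc.
  by move=> p cp nS; rewrite /u /k' (kS p cp nS).1 mulr1 subrr scale0r.
exists g; split.
- apply: (small _ f g u U) => //.
  + by move=> p /Sc; exact: g1.
  + by move=> p /Sc; exact: g3.
  + move=> p Sp; have /andP [k0 k1] := (kC (cmap c p)).1; have DC := (kC (cmap c p)).2.
    have TQ : `|T (cmap c p)| <= Q * t.
      rewrite /Q mulrDl mul1r; apply: normD_le => //.
      apply: (le_trans (mx_norm_mul _ _)); apply: ler_pM => //.
      by rewrite ler_wpM2l //; exact: hB0.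
    have k'01 : `|k' (cmap c p)| <= 1.
      by rewrite /k' mulN1r ler_norml; apply/andP; split; lra.
    have QK : Q * t <= eta.
      rewrite /t mulrCA ger_pMr // ler_pdivrMr // mul1r /K lerDl.
      by rewrite addr_ge0 // mulr_ge0 // ltW.
    split.
      rewrite /u normrZ; apply: le_trans QK; apply: le_trans TQ.
      exact: ler_piMl.
    have -> : eta = Q * t + (1 + C * Q) * t.
      by rewrite -mulrDl -/K /t mulrC divfK // gt_eqF.
    apply: (@le_trans _ _ ((1 + C * Q) * t)); last by rewrite lerDr mulr_ge0 // ltW.
    rewrite mulrDl mul1r; apply: normD_le.
      by rewrite normrZ; apply: le_trans bet; exact: ler_piMl.
    apply: (le_trans (mx_norm_mul _ _)); rewrite mul1r -mulrA.
    by apply: ler_pM => //; rewrite /D' scaleN1r normrN.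
- move=> q Bq; have nS : ~ S q by move=> Sq; have : (S `&` B) q by []; rewrite SB.
  split; first by rewrite g2.
  by move=> c' ac' cq; rewrite (g4 c' q ac' cq nS).
move=> p Ap; have cp := Ac _ Ap; have [e1 e2] := kA p Ap.
rewrite (g1 p cp) (g3 p cp) /u /U /k' /D' e1 e2.
by rewrite mulr0 addr0 !scale1r scaler0 mul0mx addr0.
Qed.

(** Four modifications of size [rho / 4]: a smoothing and an affine map near each of [A] and [B].
    Each leaves the map and its derivative on the other set untouched, so what was gained there
    persists. *)
Lemma row_free_dense N (f : C1map M N) c c' A B (rho : nat -> R) : (4 * n + 1 <= N)%N ->
  atlas c -> atlas c' -> compact A -> compact B -> A `<=` cdom c -> B `<=` cdom c' ->
  A `&` B = set0 -> (forall i, 0 < rho i) ->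
  exists g : C1map M N, close d L rho f g /\
    forall p q, A p -> B q -> row_free (tangents g c c' p q).
Proof.
move=> Nn ac ac' cA cB Ac Bc AB0 rho0.
have BA0 : B `&` A = set0 by rewrite setIC.
have clA := compact_closedM cA; have clB := compact_closedM cB.
have r40 i : 0 < rho i / 4 by rewrite divr_gt0.
have [f1 [cl1 ag1 cov1]] := smooth_near f ac cA Ac clB AB0 r40.
have [f2 [cl2 ag2 cov2]] := smooth_near f1 ac' cB Bc clA BA0 r40.
(* These are the rows of [tangents] after the shear. In this form the affine modifications add the
   constant matrix [tau], whereas the last row of [tangents] itself changes by an amount that
   depends on the two points. *)
pose phi (z : M * M) : 'M[R]_(n + (n + 1), N) :=
  col_mx (chart_jacobian f2 c z.1) (col_mx (chart_jacobian f2 c' z.2)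
   ((f2 z.1 - cmap c z.1 *m chart_jacobian f2 c z.1) -
    (f2 z.2 - cmap c' z.2 *m chart_jacobian f2 c' z.2))).
have cov1' : cov n A (fun p => (chart_jacobian f2 c p,
    f2 p - cmap c p *m chart_jacobian f2 c p)).
  apply: cov_reindex cov1 => p Ap; exists p; first exact: Ap.
  by have [e1 e2] := ag2 p Ap; rewrite e1 (e2 c ac (Ac _ Ap)).
have covphi : cov (n + n) (A `*` B) phi.
  apply: (@cov_lip _ _ _ _ _ _ _ _ 2) (cov_pair cov1' cov2) => -[p q] [p' q'] _ _.
  rewrite /phi /=.
  move: (chart_jacobian f2 c p) (chart_jacobian f2 c p') => J1 J1'.
  move: (chart_jacobian f2 c' q) (chart_jacobian f2 c' q') => J2 J2'.
  move: (f2 p - _) (f2 p' - _) (f2 q - _) (f2 q' - _) => w1 w1' w2 w2'.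
  set D := `|((J1, w1), (J2, w2)) - _|.
  have D0 : 0 <= D by exact: normr_ge0.
  have D2 : D <= 2 * D by rewrite ler_peMl // ler1n.
  have [h1 h2] : `|J1 - J1'| <= D /\ `|w1 - w1'| <= D.
    by split; rewrite /D !prod_normE /= !le_max lexx ?orbT.
  have [h3 h4] : `|J2 - J2'| <= D /\ `|w2 - w2'| <= D.
    by split; rewrite /D !prod_normE /= !le_max lexx ?orbT.
  rewrite opp_col_mx add_col_mx opp_col_mx add_col_mx.
  apply: (le_trans (norm_col_mx _ _)); rewrite ge_max (le_trans h1) //=.
  apply: (le_trans (norm_col_mx _ _)); rewrite ge_max (le_trans h3) //=.
  have -> : w1 - w2 - (w1' - w2') = (w1 - w1') - (w2 - w2').
    by apply/rowP => j; rewrite !mxE; ring.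
  by apply: (le_trans (ler_normB _ _)); rewrite mulr_natl mulr2n lerD.
have [tA tA0 hA] := affine_near ac cA Ac clB AB0 r40.
have [tB tB0 hB] := affine_near ac' cB Bc clA BA0 r40.
have t0 : 0 < Num.min tA tB by rewrite lt_min tA0.
(* Here [4 n + 1 <= N] enters: [2 n] parameters and [2 n + 1] rows. *)
have [|tau taut free] := perturb_row_free_le _ t0 covphi; first lia.
set b1 := usubmx tau; set b2 := usubmx (dsubmx tau); set al := dsubmx (dsubmx tau).
have tauE : tau = col_mx b1 (col_mx b2 al) by rewrite !vsubmxK.
have usub m1 m2 (X : 'M[R]_(m1 + m2, N)) : `|usubmx X| <= `|X|.
  by apply: mx_norm_le => // i j; rewrite mxE mx_coef_norm.
have dsub m1 m2 (X : 'M[R]_(m1 + m2, N)) : `|dsubmx X| <= `|X|.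
  by apply: mx_norm_le => // i j; rewrite mxE mx_coef_norm.
move: taut; rewrite le_min => /andP [tauA tauB].
have [||f3 [cl3 ag3 e3]] := hA N f2 al b1.
- by apply: le_trans tauA; apply: le_trans (dsub _ _ _) (dsub _ _ _).
- by apply: le_trans tauA; exact: usub.
have [||f4 [cl4 ag4 e4]] := hB N f3 0 b2.
- by rewrite normr0 ltW.
- by apply: le_trans tauB; apply: le_trans (usub _ _ _) (dsub _ _ _).
exists f4; split.
  have := close_trans (close_trans (close_trans cl1 cl2) cl3) cl4.
  move=> h i p sp; have [h1 h2] := h i p sp.
  have E : rho i / 4 + rho i / 4 + rho i / 4 + rho i / 4 = rho i by field.
  by rewrite E in h1 h2.
move=> p q Ap Bq.
have [a1 a2] := ag4 p Ap; have [a3 a4] := e3 p Ap.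
have [a5 a6] := ag3 q Bq; have [a7 a8] := e4 q Bq.
rewrite /tangents -(a2 c ac (Ac _ Ap)) a4 a8 -(a6 c' ac' (Bc _ Bq)) -a1 a3 a7 -a5.
apply: row_free_shear.
have := free (p, q) (conj Ap Bq); rewrite tauE; exact.
Qed.

End nice.
End density.

(** * Limits of C^1-convergent sequences of maps *)

Section limits.
Context {R : realType}.

Lemma mx_cauchy_lim m n (u : nat -> 'M[R]_(m, n)) :
  (forall e : R, 0 < e -> exists K, forall k l, (K <= k)%N -> (K <= l)%N -> `|u k - u l| <= e) ->
  exists l, forall e : R, 0 < e -> exists K, forall k, (K <= k)%N -> `|u k - l| <= e.
Proof.
move=> hu.
have cu : cvg (u @ \oo).
  apply/cauchy_cvgP; apply: cauchy_exP => e e0.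
  have e20 : 0 < e / 2 by rewrite divr_gt0.
  have [K hK] := hu _ e20; exists (u K).
  exists K => // k /= Kk; rewrite -ball_normE /=.
  by apply: le_lt_trans (hK K k (leqnn _) Kk) _; rewrite ltr_pdivrMr // ltr_pMr ?ltr1n.
exists (lim (u @ \oo)) => e e0.
have /(@cvgrPdist_le _ _ _ (\oo) _ u) /(_ e e0) [K _ hK] := cu.
by exists K => k Kk; rewrite distrC; exact: hK.
Qed.

Lemma norm_le_lim (V : normedModType R) (x : V) (B : R) :
  (forall e : R, 0 < e -> exists2 y, `|y| <= B & `|x - y| <= e) -> `|x| <= B.
Proof.
move=> h; apply/ler_addgt0Pr => e e0; have [y yB xy] := h e e0.
by rewrite -(subrK y x) addrC; exact: normD_le.
Qed.

Lemma subBB (V : zmodType) (x y z : V) : x - z - (x - y) = y - z.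
Proof. by rewrite opprB addrC addrA subrK. Qed.

Lemma half_pow_small (B e : R) : 0 < e -> exists K, forall k, (K <= k)%N ->
  B / 2 ^+ k <= e.
Proof.
move=> e0; pose K := (Num.trunc (`|B| / e)).+1; exists K => k Kk.
have p0 : 0 < 2 ^+ k :> R by rewrite exprn_gt0.
rewrite ler_pdivrMr //; apply: (le_trans (ler_norm _)).
rewrite -ler_pdivrMl // mulrC; apply: (le_trans (ltW (truncnS_gt _))).
rewrite -/K -natrX ler_nat; apply: (leq_trans Kk).
by apply: ltnW; exact: ltn_expl.
Qed.

End limits.

Section limit_map.
Context {R : realType} {n : nat} {M : manifold R n}.
Local Notation chartM := (chart R n (manifold_space M)).
Context (d : nat -> chartM) (L : nat -> set M) (dL : nice_cover d L).
Implicit Types (p q : M).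

Context {N : nat} (f : nat -> C1map M N) (rho : nat -> nat -> R).
Context (rho_half : forall k i, rho k.+1 i <= rho k i / 2).
Context (rho_pos : forall k i, 0 < rho k i).
Context (f_step : forall k, close d L (fun i => rho k i / 2) (f k) (f k.+1)).

(** One step consumes half of the tolerance; all later ones together stay within [rho k.+1], which
    is at most the other half. *)
Lemma close_later k j : close d L (rho k) (f k) (f (k + j)).
Proof.
elim: j k => [|j IH] k i p sp.
  rewrite addn0; have h := ltW (rho_pos k i).
  by split; rewrite subrr normr0.
have [h1 h2] := f_step k sp; have [h3 h4] := IH k.+1 i p sp.
rewrite addnS -addSn.
have E : rho k i / 2 + rho k i / 2 = rho k i by field.
split; rewrite -E.
  exact: distD h1 (le_trans h3 (rho_half k i)).
exact: distD h2 (le_trans h4 (rho_half k i)).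
Qed.

Lemma rho_pow k i : rho k i <= rho 0%N i / 2 ^+ k.
Proof.
elim: k => [|k IH]; first by rewrite expr0 divr1.
apply: (le_trans (rho_half k i)); by rewrite exprSr invfM mulrA ler_wpM2r.
Qed.

Lemma uniform_cauchy a (e : R) : 0 < e -> exists K, forall k l, (K <= k)%N -> (K <= l)%N ->
  forall q, L a q -> `|f k q - f l q| <= e /\
    `|chart_jacobian (f k) (d a) q - chart_jacobian (f l) (d a) q| <= e.
Proof.
move=> e0; have [ad cL Ld hb] := dL.
have [r r0 hr] := close_transfer dL N (ad a) (cL a) (Ld a) e0.
have [m hm] := shell_locally_finite dL (cL a).
have r20 : 0 < r / 2 by rewrite divr_gt0.
have [K hK] := half_pow_small (\sum_(i < m) rho 0%N i) r20.
exists K => k l Kk Kl q Lq; apply: hr q Lq => i p sp Lp.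
have im := hm i p Lp sp.
have rK : rho K i <= r / 2.
  apply: (le_trans (rho_pow K i)); apply: le_trans (hK K (leqnn _)).
  rewrite ler_wpM2r ?invr_ge0 ?exprn_ge0 // (bigD1 (Ordinal im)) //= lerDl.
  by apply: sumr_ge0 => j _; exact: ltW.
have := close_later K (k - K) sp; rewrite subnKC // => -[h1 h2].
have := close_later K (l - K) sp; rewrite subnKC // => -[h3 h4].
have E : r / 2 + r / 2 = r by field.
rewrite distrC in h1; rewrite distrC in h2; rewrite -E; split.
  exact: distD (le_trans h1 rK) (le_trans h3 rK).
exact: distD (le_trans h2 rK) (le_trans h4 rK).
Qed.

(** Locally uniform convergence of the maps and of their Jacobians makes the limit C^1. [J] collects
    the limits of the Jacobians at each point in each chart whose [L a] contains the point. *)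
Lemma limit_C1map : exists g : C1map M N, forall k, close d L (rho k) (f k) g.
Proof.
have [ad cL Ld hb] := dL.
have cover p : exists2 a, nbhs p (L a) & L a p.
  have [a ha _] := hb p setT filterT; exists a => //; exact: nbhs_singleton.
have /choice [g hg] : forall p, exists l, forall e : R, 0 < e ->
    exists K, forall k, (K <= k)%N -> `|f k p - l| <= e.
  move=> p; apply: mx_cauchy_lim => e e0; have [a _ Lp] := cover p.
  have [K hK] := uniform_cauchy a e0; exists K => k l Kk Kl.
  exact: (hK k l Kk Kl p Lp).1.
have /choice [J hJ] : forall z : nat * M, exists l, L z.1 z.2 -> forall e : R, 0 < e ->
    exists K, forall k, (K <= k)%N -> `|chart_jacobian (f k) (d z.1) z.2 - l| <= e.
  move=> [a p]; have [Lp|nLp] := pselect (L a p); last by exists 0.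
  have [|l hl] := @mx_cauchy_lim R _ _ (fun k => chart_jacobian (f k) (d a) p).
    move=> e e0; have [K hK] := uniform_cauchy a e0; exists K => k l Kk Kl.
    exact: (hK k l Kk Kl p Lp).2.
  by exists l.
have unif a (e : R) : 0 < e -> exists K, forall k, (K <= k)%N -> forall q, L a q ->
    `|f k q - g q| <= e /\ `|chart_jacobian (f k) (d a) q - J (a, q)| <= e.
  move=> e0; have [K hK] := uniform_cauchy a e0; exists K => k Kk q Lq; split.
    apply: norm_le_lim => e' e'0; have [K' hK'] := hg q e' e'0.
    exists (f k q - f (maxn K K') q); first exact: (hK k _ Kk (leq_maxl _ _) q Lq).1.
    rewrite subBB; exact: hK' (leq_maxr _ _).
  apply: norm_le_lim => e' e'0; have [K' hK'] := hJ (a, q) Lq e' e'0.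
  exists (chart_jacobian (f k) (d a) q - chart_jacobian (f (maxn K K')) (d a) q).
    exact: (hK k _ Kk (leq_maxl _ _) q Lq).2.
  rewrite subBB; exact: hK' (leq_maxr _ _).
have jac a p : nbhs p (L a) -> has_jac g (d a) p (J (a, p)).
  move=> Lap; have Lp := nbhs_singleton Lap; have cp := Ld _ _ Lp.
  have [r0' [r00 hr0 _]] := compact_chart_ball cp Lap.
  set x := cmap (d a) p in hr0 *; set X := cimg (d a) in hr0 *.
  have ix : X x by exact: cimgP.
  (* The three errors are [n * e1] from the mean value inequality, [e1] from the derivative of
     [f k], and [n * e1] from the convergence of the Jacobians. *)
  move=> e e0; pose e1 := e / (2 * n%:R + 1).
  have k1 : 0 < 2 * n%:R + 1 :> R by rewrite ltr_wpDl // mulr_ge0.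
  have e10 : 0 < e1 by rewrite divr_gt0.
  have [K hK] := unif a e1 e10; have [K2 hK2] := uniform_cauchy a e10.
  pose k := maxn K K2.
  have [r r1 hr] := C1map_has_jac (f k) (ad a) cp e10.
  exists (Num.min r r0') => [|y iy]; first by rewrite lt_min r1.
  rewrite lt_min => /andP [yr yr0].
  have inD z : @halfspace R n z /\ `|z - x| < r0' -> X z /\ L a (cinv (d a) z).
    by move=> [Hz zx]; exact: hr0 Hz (ltW zx).
  have Hx : @halfspace R n x by exact: (cimg_hopen (d a)).1.
  have Hy : @halfspace R n y by exact: (cimg_hopen (d a)).1.
  pose F l z := f l (cinv (d a) z).
  (* The derivative of [f l - f k] is at most [e1] on the half-ball, which contains the segment from
     [x] to [y]. The bound is uniform in [l] and passes to the limit in [mv']. *)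
  have mv l : (K2 <= l)%N -> `|(F l y - F k y) - (F l x - F k x)| <= n%:R * e1 * `|y - x|.
    move=> Kl; have := @mvt_ineq R n N
      (fun z => @halfspace R n z /\ `|z - x| < r0') (fun z => F l z - F k z)
      (fun z => chart_jacobian (f l) (d a) (cinv (d a) z) - chart_jacobian (f k) (d a) (cinv (d a) z))
      0 e1 x y.
    rewrite mulmx0 subr0; apply.
    - move=> t t01; split; first exact: halfspace_convex.
      rewrite addrC addKr normrZ; apply: le_lt_trans yr0.
      by move/andP: (t01) => [t0 t1]; rewrite ger0_norm // ler_piMl.
    - move=> z Dz; have [iz Lz] := inD z Dz; have [cz ez] := cinv_dom iz.
      have h1 := C1map_has_jac (f l) (ad a) cz; have h2 := C1map_has_jac (f k) (ad a) cz.
      rewrite /has_jac ez in h1 h2.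
      apply: (@is_jac_sub _ _ _ _ (cimg (d a))); first by move=> w /inD [].
      apply: is_jac_add; [exact: h1|apply: is_jac_opp; exact: h2].
    - move=> z Dz; have [iz Lz] := inD z Dz; rewrite subr0.
      exact: (hK2 l k Kl (leq_maxr _ _) _ Lz).2.
  have gx : g p = g (cinv (d a) x) by rewrite /x cmapK.
  have mv' : `|(g (cinv (d a) y) - F k y) - (g (cinv (d a) x) - F k x)| <= n%:R * e1 * `|y - x|.
    apply: norm_le_lim => e' e'0; have e'2 : 0 < e' / 2 by rewrite divr_gt0.
    have [K3 hK3] := hg (cinv (d a) y) _ e'2; have [K4 hK4] := hg (cinv (d a) x) _ e'2.
    pose l := maxn K2 (maxn K3 K4).
    exists ((F l y - F k y) - (F l x - F k x)); first by apply: mv; exact: leq_maxl.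
    have -> : (g (cinv (d a) y) - F k y) - (g (cinv (d a) x) - F k x) -
        ((F l y - F k y) - (F l x - F k x)) =
        (F l x - g (cinv (d a) x)) - (F l y - g (cinv (d a) y)).
      by apply/rowP => j; rewrite !mxE; ring.
    apply: (le_trans (ler_normB _ _)); have -> : e' = e' / 2 + e' / 2 by field.
    apply: lerD; [apply: hK4|apply: hK3];
      by rewrite /l !leq_max leqnn ?orbT.
  have hf := hr y iy yr; rewrite -/x in hf.
  have hJk := (hK k (leq_maxl _ _) p Lp).2.
  have e1E : n%:R * e1 * `|y - x| + e1 * `|y - x| + n%:R * `|y - x| * e1 = e * `|y - x|.
    by rewrite /e1; field; rewrite gt_eqF.
  rewrite -e1E /=.
  move: mv' hf hJk; rewrite /F /=; set Jk := chart_jacobian (f k) _ _.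
  move=> mv' hf hJk.
  have -> : g (cinv (d a) y) - g (cinv (d a) x) - (y - x) *m J (a, p) =
      ((g (cinv (d a) y) - f k (cinv (d a) y)) - (g (cinv (d a) x) - f k (cinv (d a) x))) +
      (f k (cinv (d a) y) - f k (cinv (d a) x) - (y - x) *m Jk) +
      (y - x) *m (Jk - J (a, p)).
    rewrite mulmxBr.
    move: ((y - x) *m Jk) ((y - x) *m J (a, p)) => w1 w2.
    by apply/rowP => j; rewrite !mxE; ring.
  apply: normD_le.
    by exact: normD_le.
  by apply: (le_trans (mx_norm_mul _ _)); rewrite ler_wpM2l // mulr_ge0.
have gC1 : is_C1 g.
  apply: is_C1_local => p; have [a Lap Lp] := cover p; have cp := Ld _ _ Lp.
  exists (d a); split=> //; exists (fun q => J (a, q)).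
    have : nbhs p (L a)° by exact: nbhs_interior.
    by apply: filterS => q /jac.
  move=> e e0; have e30 : 0 < e / 3 by rewrite divr_gt0.
  have [K hK] := unif a _ e30.
  have := chart_jacobian_near (f K) (ad a) cp e30.
  apply: filterS2 Lap => q Lq h.
  have E : e / 3 + e / 3 + e / 3 = e by field.
  have h1 := (hK K (leqnn _) q Lq).2; have h2 := (hK K (leqnn _) p Lp).2.
  rewrite distrC in h1; rewrite -E; exact: distD (distD h1 h) h2.
exists (C1Map gC1) => k i p sp /=.
have [Lp _] := sp.
(* [jac] is available only where [L a] is a neighbourhood of the point, and a shell may contain
   boundary points of [L i]. Convergence in the chart [d i] is therefore transferred from a chart
   [d b] with [p] interior to [L b]. *)
have hA e : 0 < e -> exists2 l, (k <= l)%N & `|f l p - g p| <= e /\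
   `|chart_jacobian (f l) (d i) p - chart_jacobian (C1Map gC1) (d i) p| <= e.
  move=> e0.
  have [b Lbp Lbp'] := cover p.
  have [r r0 hr] : exists2 r : R, 0 < r & forall X : 'M[R]_(n, N), `|X| <= r ->
      `|transition (d i) (d b) p *m X| <= e.
    have c0 : 0 < n%:R * `|transition (d i) (d b) p| + 1 by rewrite ltr_wpDl // mulr_ge0.
    exists (e / (n%:R * `|transition (d i) (d b) p| + 1)) => [|X hX]; first by rewrite divr_gt0.
    apply: (le_trans (mx_norm_mul _ _)); apply: (le_trans (ler_wpM2l _ hX)).
      by rewrite mulr_ge0.
    by rewrite mulrCA ger_pMr // ler_pdivrMr // mul1r lerDl.
  have [K1 hK1] := unif b _ e0; have [K2 hK2] := unif b _ r0.
  exists (maxn k (maxn K1 K2)); first exact: leq_maxl.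
  split.
    by apply: (hK1 _ _ _ Lbp').1; rewrite !leq_max leqnn ?orbT.
  have E1 := chart_jacobian_transition (f (maxn k (maxn K1 K2))) (ad i) (ad b) (Ld _ _ Lp) (Ld _ _ Lbp').
  have E2 := chart_jacobian_transition (C1Map gC1) (ad i) (ad b) (Ld _ _ Lp) (Ld _ _ Lbp').
  have E3 : chart_jacobian (C1Map gC1) (d b) p = J (b, p).
    exact: chart_jacobianE (Ld _ _ Lbp') (jac b p Lbp).
  rewrite E1 E2 E3 -mulmxBr; apply: hr.
  by apply: (hK2 _ _ _ Lbp').2; rewrite !leq_max leqnn ?orbT.
split; apply/ler_addgt0Pr => e e0; have [l kl [h1 h2]] := hA e e0;
  have := close_later k (l - k) sp; rewrite subnKC // => -[h3 h4].
  exact: distD h3 h1.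
exact: distD h4 h2.
Qed.

End limit_map.

(** * Maps that satisfy all rank conditions *)

Section generic.
Context {R : realType} {n : nat} {M : manifold R n}.
Local Notation chartM := (chart R n (manifold_space M)).
Context (d : nat -> chartM) (L : nat -> set M) (dL : nice_cover d L) (n_gt0 : (0 < n)%N).

Definition free_pair N (a b : nat) (g : C1map M N) : Prop :=
  L a `&` L b = set0 ->
  forall p q, L a p -> L b q -> row_free (tangents g (d a) (d b) p q).

(** The new tolerance [rho'] protects the condition just gained against all later modifications,
    besides halving the previous tolerance. *)
Lemma free_pair_dense N (a b : nat) (f : C1map M N) (rho : nat -> R) :
  (4 * n + 1 <= N)%N -> (forall i, 0 < rho i) ->
  exists (g : C1map M N) (rho' : nat -> R), [/\ forall i, 0 < rho' i,
    forall i, rho' i <= rho i / 2, close d L (fun i => rho i / 2) f g &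
    forall h, close d L rho' g h -> free_pair a b h].
Proof.
move=> Nn rho0; have [ad cL Ld hb] := dL.
have r20 i : 0 < rho i / 2 by rewrite divr_gt0.
have [L0|nL0] := pselect (L a `&` L b = set0); last first.
  exists f, (fun i => rho i / 2); split=> //; last by move=> h _ /nL0.
  by move=> i p sp; have h := ltW (r20 i); split; rewrite subrr normr0.
have [g [fg free]] := row_free_dense dL n_gt0 f Nn (ad a) (ad b) (cL a) (cL b)
  (Ld a) (Ld b) L0 r20.
have [mu mu0 hmu] := row_free_stable (ad a) (ad b) (cL a) (cL b) (Ld a) (Ld b) free.
have [r1 r10 hr1] := close_transfer dL N (ad a) (cL a) (Ld a) mu0.
have [r2 r20' hr2] := close_transfer dL N (ad b) (cL b) (Ld b) mu0.
exists g, (fun i => Num.min (rho i / 2) (Num.min r1 r2)); split=> //.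
- by move=> i; rewrite !lt_min r20 r10.
- by move=> i; rewrite ge_min lexx.
move=> h gh _; apply: hmu.
  apply: hr1 => i p sp _; have [] := gh i p sp.
  by rewrite !le_min => /and3P [_ h1 _] /and3P [_ h2 _].
apply: hr2 => i p sp _; have [] := gh i p sp.
by rewrite !le_min => /and3P [_ _ h1] /and3P [_ _ h2].
Qed.

(** A category argument carried out by hand: step [k] settles the [k]-th pair, and the limit stays
    within every tolerance set along the way. *)
Lemma generic_map N (f : C1map M N) (rho : nat -> R) : (4 * n + 1 <= N)%N ->
  (forall i, 0 < rho i) ->
  exists g : C1map M N, close d L rho f g /\ forall a b, free_pair a b g.
Proof.
move=> Nn rho0.
(* Numbers that encode no pair are sent to [(0, 0)]. *)
pose pr (k : nat) : nat * nat := odflt (0%N, 0%N) (unpickle k).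
pose st := (C1map M N * (nat -> R))%type.
have /choice [step hstep] : forall z : nat * st, exists z' : st,
    (forall i, 0 < z.2.2 i) -> [/\ forall i, 0 < z'.2 i, forall i, z'.2 i <= z.2.2 i / 2,
      close d L (fun i => z.2.2 i / 2) z.2.1 z'.1 &
      forall h, close d L z'.2 z'.1 h -> free_pair (pr z.1).1 (pr z.1).2 h].
  move=> [k [f0 r]] /=; have [r0|nr] := pselect (forall i, 0 < r i); last by exists (f0, r).
  have [g [r' h]] := free_pair_dense (pr k).1 (pr k).2 f0 Nn r0.
  by exists (g, r').
pose s := fix s k : st := if k is k'.+1 then step (k', s k') else (f, rho).
have pos k i : 0 < (s k).2 i.
  by elim: k i => [|k IH] i; [exact: rho0|have [h _ _ _] := hstep (k, s k) IH; exact: h].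
have [g hg] := limit_C1map dL (f := fun k => (s k).1) (rho := fun k => (s k).2)
  (fun k => let: And4 _ h _ _ := hstep (k, s k) (pos k) in h) pos
  (fun k => let: And4 _ _ h _ := hstep (k, s k) (pos k) in h).
exists g; split; first exact: (hg 0%N).
move=> a b; have [_ _ _ h] := hstep (pickle (a, b), s (pickle (a, b))) (pos _).
have := h g (hg (pickle (a, b)).+1).
by rewrite /pr pickleK.
Qed.

End generic.

(** * Total skewness as a rank condition *)

Section skewness.
Context {R : realType} {n : nat} {M : manifold R n} (n_gt0 : (0 < n)%N).
Local Notation chartM := (chart R n (manifold_space M)).
Implicit Types (c : chartM) (p q : M).

(** Increasing the first coordinate slightly stays in the half-space, so every nonempty chart image
    contains a second point. *)
Lemma other_point p : exists q, q <> p.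
Proof.
have [c ac cp] := chart_at p; have [iH i2] := cimg_hopen c.
have [r r0 hr] := i2 _ (cimgP cp).
pose v : 'rV[R]_n := delta_mx 0 (Ordinal n_gt0).
have v1 : v ord0 (Ordinal n_gt0) = 1 by rewrite mxE !eqxx.
pose y := cmap c p + (r / 2) *: v.
have r2 : 0 < r / 2 by rewrite divr_gt0.
have iy : cimg c y.
  apply: hr.
    move=> j j0; rewrite !mxE addr_ge0 //; first exact: (iH _ (cimgP cp)).
    by apply: mulr_ge0; [exact: ltW|exact: ler0n].
  rewrite /y addrC addKr normrZ (gtr0_norm r2).
  apply: (@le_lt_trans _ _ (r / 2 * 1)); last by rewrite mulr1 ltr_pdivrMr // ltr_pMr ?ltr1n.
  rewrite ler_wpM2l ?(ltW r2) //; apply: mx_norm_le => // i j; rewrite mxE.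
  by case: (_ && _); rewrite ?normr1 ?normr0.
have [cy ey] := cinv_dom iy; exists (cinv c y) => e.
have : y ord0 (Ordinal n_gt0) = cmap c p ord0 (Ordinal n_gt0) by rewrite -{1}ey e.
rewrite !mxE eqxx /= mulr1 => /eqP; rewrite -subr_eq0 addrAC subrr add0r => /eqP h.
by rewrite h ltxx in r2.
Qed.

Lemma row_free_tangentsP N (f : C1map M N) c c' p q :
  row_free (tangents f c c' p q) <->
  forall (a b : 'rV[R]_n) (t : R), a *m chart_jacobian f c p +
    b *m chart_jacobian f c' q + t *: (f p - f q) = 0 -> [/\ a = 0, b = 0 & t = 0].
Proof.
split=> [/row_freeP0 h a b t e|h].
  have /h : row_mx a (row_mx b t%:M) *m tangents f c c' p q = 0.
    by rewrite /tangents !mul_row_col mul_scalar_mx addrA.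
  rewrite -[X in _ = X -> _]row_mx0 => /eq_row_mx [-> ].
  rewrite -[X in _ = X -> _]row_mx0 => /eq_row_mx [-> /rowP /(_ ord0)].
  by rewrite !mxE eqxx mulr1n => ->.
apply/row_freeP0 => w; rewrite -(hsubmxK w) -(hsubmxK (rsubmx w)).
rewrite /tangents !mul_row_col addrA.
rewrite [X in X *m (f p - f q)]mx11_scalar mul_scalar_mx => /h [-> -> e].
rewrite [rsubmx (rsubmx w)]mx11_scalar e; apply/rowP => j; rewrite !mxE.
case: fintype.splitP => k _; rewrite !mxE //.
by case: fintype.splitP => l _; rewrite !mxE // mul0rn.
Qed.

Lemma row_free_col_mx m1 m2 N (A : 'M[R]_(m1, N)) (B : 'M[R]_(m2, N)) :
  row_free (col_mx A B) -> row_free A /\ row_free B.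
Proof.
move=> /row_freeP0 h; split; apply/row_freeP0 => w e.
  have /h : row_mx w 0 *m col_mx A B = 0 by rewrite mul_row_col e mul0mx addr0.
  by rewrite -[X in _ = X -> _]row_mx0 => /eq_row_mx [].
have /h : row_mx 0 w *m col_mx A B = 0 by rewrite mul_row_col e mul0mx addr0.
by rewrite -[X in _ = X -> _]row_mx0 => /eq_row_mx [].
Qed.

Lemma row_free_image_neq0 m N (J : 'M[R]_(m, N)) (v : 'rV[R]_m) :
  row_free J -> v *m J = 0 -> v = 0.
Proof. by move=> /row_freeP0; apply. Qed.

(** Parallel tangent lines make the two directions proportional, and a common point expresses the
    chord through them. Either is a nontrivial relation between the rows, once both directions are
    written in the charts [c] and [c']. *)
Lemma free_skew N (f : C1map M N) c c' p q l1 l2 : atlas c -> atlas c' ->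
  cdom c p -> cdom c' q -> row_free (tangents f c c' p q) ->
  tangent_line f p l1 -> tangent_line f q l2 -> Defs.skew l1 l2.
Proof.
move=> ac ac' cp cq /row_free_tangentsP free.
move=> [c1 [v [ac1 c1p v0 ->]]] [c2 [w [ac2 c2q w0 ->]]].
move: v0 w0; rewrite (chart_jacobian_transition f ac1 ac c1p cp).
rewrite (chart_jacobian_transition f ac2 ac' c2q cq) !mulmxA.
move: (v *m _) (w *m _) free => {}v {}w.
move: (chart_jacobian f c p) (chart_jacobian f c' q) => J1 J2 free v0 w0.
split.
- move=> [u hu].
  have [x [s _ <-] e1] : [set u + x | x in line (f p) (v *m J1)] (f q).
    by rewrite -hu; exists 0 => //; rewrite scale0r addr0.
  have [y [t _ <-] e2] : [set u + x | x in line (f p) (v *m J1)] (f q + w *m J2).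
    by rewrite -hu; exists 1 => //; rewrite scale1r.
  have [|_ e _] := free ((s - t) *: v) w 0.
    rewrite scale0r addr0 -scalemxAl scalerBl.
    have -> : w *m J2 = (u + (f p + t *: (v *m J1))) - (u + (f p + s *: (v *m J1))).
      by rewrite e2 e1 addrC addKr.
    move: (s *: _) (t *: _) => a b; apply/rowP => j; rewrite !mxE; ring.
  by rewrite e mul0mx eqxx in w0.
- apply/seteqP; split=> // z [[s _ <-] [t _ e]].
  have [|_ _ /eqP] := free (s *: v) (- t *: w) 1; last by rewrite oner_eq0.
  rewrite scale1r -!scalemxAl scaleNr.
  have -> : f p = f q + t *: (w *m J2) - s *: (v *m J1) by rewrite e addrK.
  move: (s *: _) (t *: _) => a b; apply/rowP => j; rewrite !mxE; ring.
Qed.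

(** A nontrivial relation with [t = 0] has [a] and [b] nonzero by immersion and gives parallel
    tangent lines; one with [t != 0], divided by [t], gives a common point. *)
Lemma totally_skew_free N (f : C1map M N) : immersion f -> totally_skew f ->
  forall p q c c', p <> q -> atlas c -> atlas c' -> cdom c p -> cdom c' q ->
  row_free (tangents f c c' p q).
Proof.
move=> imm ts p q c c' pq ac ac' cp cq; apply/row_free_tangentsP => a b t e.
have f1 := imm c p ac cp; have f2 := imm c' q ac' cq.
have tl (x : M) cc v : atlas cc -> cdom cc x -> row_free (chart_jacobian f cc x) -> v != 0 ->
    tangent_line f x (line (f x) (v *m chart_jacobian f cc x)).
  move=> acc ccx free v0; exists cc, v; split=> //.
  by apply: contra v0 => /eqP /(row_free_image_neq0 free) ->.
have tp v := tl p c v ac cp f1; have tq v := tl q c' v ac' cq f2.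
move: tp tq e f1 f2; move: (chart_jacobian f c p) (chart_jacobian f c' q) => J1 J2.
move=> tp tq e f1 f2.
pose e0 : 'rV[R]_n := delta_mx 0 (Ordinal n_gt0).
have e00 : e0 != 0.
  apply/eqP => /rowP /(_ (Ordinal n_gt0)); rewrite !mxE !eqxx => /eqP.
  by rewrite oner_eq0.
(* If a coefficient vector vanishes, any tangent line at that point will do, with parameter [0]. *)
have direction (v : 'rV[R]_n) : exists2 v' : 'rV[R]_n, v' != 0 & exists s, v = s *: v'.
  have [->|v0] := eqVneq v 0; first by exists e0 => //; exists 0; rewrite scale0r.
  by exists v => //; exists 1; rewrite scale1r.
have [t0|t0] := eqVneq t 0.
  rewrite t0 scale0r addr0 in e.
  have [a0|a0] := eqVneq a 0.
    rewrite a0 mul0mx add0r in e.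
    by rewrite (row_free_image_neq0 f2 e); split.
  exfalso.
  have b0 : b != 0.
    apply/eqP => b0; rewrite b0 mul0mx addr0 in e.
    by move/eqP: a0; apply; exact: row_free_image_neq0 e.
  have [npar _] := ts _ _ _ _ pq (tp a a0) (tq b b0); apply: npar.
  have bE : b *m J2 = - (a *m J1) by apply/eqP; rewrite -addr_eq0 addrC e.
  exists (f q - f p); apply/seteqP; split=> z.
    move=> [s _ <-]; exists (f p + (- s) *: (a *m J1)).
      by exists (- s).
    by rewrite bE scalerN scaleNr addrA subrK.
  move=> [_ [s _ <-] <-]; exists (- s) => //.
  by rewrite bE scalerN scaleNr opprK addrA subrK.
exfalso.
have [a' a'0 [s aE]] := direction a; have [b' b'0 [r bE]] := direction b.
have [_ disj] := ts _ _ _ _ pq (tp a' a'0) (tq b' b'0).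
have : (line (f p) (a' *m J1) `&` line (f q) (b' *m J2)) (f p + (s / t) *: (a' *m J1)).
  split; first by exists (s / t).
  exists (- (r / t)) => //.
  have : t^-1 *: (a *m J1 + b *m J2 + t *: (f p - f q)) = 0 by rewrite e scaler0.
  rewrite aE bE -!scalemxAl !scalerDr !scalerA mulVf // scale1r ![t^-1 * _]mulrC.
  move: ((s / t) *: _) ((r / t) *: (b' *m J2)) (scaleNr (r / t) (b' *m J2)) => x y.
  move=> -> /eqP; rewrite addr_eq0 => /eqP h.
  apply/eqP; rewrite -subr_eq0; apply/eqP/rowP => j.
  have := congr1 (fun z : 'rV[R]_N => z ord0 j) h; rewrite !mxE => {}h.
  rewrite (_ : f q ord0 j = f p ord0 j + (x ord0 j + y ord0 j)); first by ring.
  by rewrite h; ring.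
by rewrite disj.
Qed.

Lemma skew_dim_lower N : [set: M] !=set0 -> @has_totally_skew_embedding R n M N ->
  (2 * n + 1 <= N)%N.
Proof.
move=> [p _] [f [imm _ _] ts]; have [q qp] := other_point p.
have [c ac cq] := chart_at q; have [c' ac' cp] := chart_at p.
have := totally_skew_free imm ts qp ac ac' cq cp.
rewrite /row_free => /eqP e; have := rank_leq_col (tangents f c c' q p).
rewrite e; lia.
Qed.

Context (d : nat -> chartM) (L : nat -> set M) (dL : nice_cover d L).

Lemma separated_pair p q : p <> q ->
  exists a b, [/\ L a `&` L b = set0, L a p & L b q].
Proof.
move=> pq; have [ad cL Ld hb] := dL.
have : ~ cluster (nbhs p) q by move=> /(@manifold_hausdorff _ _ M).
move=> /existsNP [U /existsNP [V /not_implyP [Up /not_implyP [Vq UV]]]].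
have [a La LU] := hb p U Up; have [b Lb LV] := hb q V Vq.
exists a, b; split; try exact: nbhs_singleton.
apply/seteqP; split=> // x [/LU Ux /LV Vx]; apply: UV; by exists x.
Qed.

Section free_maps.
Context {N : nat} (g : C1map M N) (free : forall a b, free_pair d L a b g).

Lemma free_tangents p q : p <> q -> exists c c', [/\ atlas c, atlas c', cdom c p,
  cdom c' q & row_free (tangents g c c' p q)].
Proof.
have [ad cL Ld hb] := dL.
move=> /separated_pair [a [b [ab Lp Lq]]]; exists (d a), (d b); split=> //.
- exact: Ld.
- exact: Ld.
- exact: free.
Qed.

Lemma free_totally_skew : totally_skew g.
Proof.
move=> p q l1 l2 /free_tangents [c [c' [ac ac' cp cq fr]]].
exact: free_skew ac ac' cp cq fr.
Qed.

Lemma free_injective : injective g.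
Proof.
move=> p q e; apply: contrapT => /free_tangents [c [c' [_ _ _ _]]].
move=> /row_free_col_mx [_ /row_free_col_mx [_]].
have -> : g p - g q = 0 by apply/eqP; rewrite subr_eq0 e.
by move=> /row_freeP0 /(_ 1%:M (mulmx0 _ _)) /eqP; rewrite -mxrank_eq0 mxrank1.
Qed.

(** The Jacobian is a block of rows of [tangents]; [other_point] supplies the second point needed to
    form that matrix. *)
Lemma free_immersion : immersion g.
Proof.
move=> c p ac cp; have [q qp] := other_point p.
have [|c1 [c2 [ac1 ac2 cp1 cq2 fr]]] := @free_tangents p q; first by move=> e; apply: qp.
have [+ _] := row_free_col_mx fr.
rewrite (chart_jacobian_transition g ac1 ac cp1 cp) /row_free => /eqP e.
rewrite eqn_leq rank_leq_row /= -{1}e; exact: mxrankM_maxr.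
Qed.

End free_maps.
End skewness.

(** * Embeddings and the strong topology *)

Section embeddings.
Context {R : realType} {n : nat} {M : manifold R n}.
Local Notation chartM := (chart R n (manifold_space M)).
Implicit Types (c : chartM) (p q : M).

(** For [q] in [C] but outside [U], the distance from [g q] to [g p] is bounded below, by
    compactness and injectivity; for [q] outside [C] it is at least [eta]. *)
Lemma homeo_of_locally_proper N (g : C1map M N) : injective g ->
  (forall p, exists (eta : R) (C : set M), [/\ 0 < eta, compact C &
     forall q, `|g q - g p| < eta -> C q]) ->
  forall U : set M, open U -> exists2 V, open V & g @^-1` V = U.
Proof.
move=> ginj hg U oU.
have key p : U p -> exists2 eta : R, 0 < eta & forall q, `|g q - g p| < eta -> U q.
  move=> Up; have [eta [C [eta0 cC hC]]] := hg p.
  have [||q [Cq nUq]|t t0 ht] := @compact_min_radius _ R (C `&` ~` U)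
    (fun t q => t <= `|g q - g p|).
  - by apply: compact_closedI => //; exact: open_closedC.
  - by move=> b b' q bb; apply: le_trans.
  - have dpos : 0 < `|g q - g p|.
      rewrite normr_gt0 subr_eq0; apply/eqP => /ginj e; apply: nUq; by rewrite e.
    have d2 : 0 < `|g q - g p| / 2 by rewrite divr_gt0.
    exists (`|g q - g p| / 2) => //.
    apply: filterS (C1map_near g q d2) => q' h _.
    have := distD (lexx `|g q - g q'|) (lexx `|g q' - g p|).
    move: h; rewrite distrC; move: `|g q - g q'| `|g q' - g p| `|g q - g p| => x y z; lra.
  exists (Num.min eta t) => [|q]; first by rewrite lt_min eta0.
  rewrite lt_min => /andP [/hC Cq h2]; apply: contrapT => nU.
  by have := ht q (conj Cq nU); rewrite leNgt h2.
exists [set y | exists p (eta : R), `|y - g p| < eta /\ forall q, `|g q - g p| < eta -> U q].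
  rewrite openE => y [p [eta [yp h]]].
  apply/nbhs_ballP; exists (eta - `|y - g p|) => /=; first by rewrite subr_gt0.
  move=> z; rewrite -ball_normE /= => yz; exists p, eta; split=> //.
  have := distD (lexx `|z - y|) (lexx `|y - g p|); rewrite distrC in yz.
  move: yz; move: `|z - y| `|z - g p| `|y - g p| => a b c; lra.
apply/seteqP; split=> [q [p [eta [h1 h2]]]|p Up]; first exact: h2.
by have [eta eta0 h] := key p Up; exists p, eta; split=> //; rewrite subrr normr0.
Qed.

Context (d : nat -> chartM) (L : nat -> set M) (dL : nice_cover d L).

Lemma compact_initial m : exists2 C : set M, compact C & forall j, (j < m)%N -> L j `<=` C.
Proof.
have [_ cL _ _] := dL; elim: m => [|m [C cC hC]]; first by exists set0 => //; exact: compact0.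
exists (C `|` L m); first by apply: compactU.
move=> j; rewrite ltnS leq_eqVlt => /orP [/eqP ->|/hC h] x Lx; [by right|left; exact: h].
Qed.

(* On a shell [f] is close to [g] compared with the distance from its image to
   the image of the complement of a compact set, and the permitted deviation
   tends to [0] at infinity. *)
Lemma embedding_near N (f : C1map M N) : embedding f ->
  exists2 rho : nat -> R, (forall i, 0 < rho i) &
    forall g : C1map M N, close d L rho f g -> injective g ->
    forall U : set M, open U -> exists2 V, open V & g @^-1` V = U.
Proof.
move=> [_ finj fhom]; have [ad cL Ld hb] := dL.
have /choice [dC hdC] : forall i, exists dC : R * set M, [/\ 0 < dC.1, compact dC.2 &
    forall p q, shell L i p -> `|f q - f p| < dC.1 -> dC.2 q].
  move=> i; pose P (S : set M) := exists dC : R * set M, [/\ 0 < dC.1, compact dC.2 &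
    forall p q, S p -> `|f q - f p| < dC.1 -> dC.2 q].
  apply: (@compact_ind _ (shell L i) P); first exact: shell_compact dL i.
  - by exists (1, set0); split=> //; exact: compact0.
  - by move=> S S' SS [dC [h1 h2 h3]]; exists dC; split=> // p q /SS; exact: h3.
  - move=> S S' [dC [h1 h2 h3]] [dC' [h1' h2' h3']].
    exists (Num.min dC.1 dC'.1, dC.2 `|` dC'.2); split=> /=.
    + by rewrite lt_min h1.
    + exact: compactU.
    + by move=> p q [Sp|Sp]; rewrite lt_min => /andP [a1 a2]; [left; exact: h3 Sp _|right; exact: h3' Sp _].
  move=> p _; have [a La _] := hb p setT filterT.
  have [V oV eV] := fhom _ (open_interior (L a)).
  have Vp : V (f p) by have : (L a)° p := La; rewrite -eV.
  have /nbhs_ballP [r /= r0 hr] := open_nbhs_nbhs (conj oV Vp).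
  have r2 : 0 < r / 2 by rewrite divr_gt0.
  exists [set p' | `|f p' - f p| <= r / 2]; first exact: C1map_near.
  exists (r / 2, L a); split=> //= p' q [h1 _] h2; apply: interior_subset; rewrite -eV.
  apply: hr; rewrite -ball_normE /= distrC.
  have E : r = r / 2 + r / 2 by field.
  rewrite E -(subrK (f p') (f q)) -addrA; apply: le_lt_trans (ler_normD _ _) _.
  exact: ltr_leD.
exists (fun i => Num.min ((dC i).1 / 4) i.+1%:R^-1).
  by move=> i; have [h _ _] := hdC i; rewrite lt_min; apply/andP; split; [exact: divr_gt0|rewrite invr_gt0 ltr0Sn].
move=> g fg ginj; apply: homeo_of_locally_proper => // p.
have [i sp] := shell_cover dL p; have [d0 cC hC] := hdC i.
set e := (dC i).1 in d0 hC.
(* For [j >= J] the deviation [1 / j.+1] is at most [e / 4], and three such distances lead from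
   [f q] through [g q] and [g p] to [f p]. The sets [L j] with [j < J] lie in a compact set. *)
pose J := (Num.trunc (4 / e)).+1.
have [C' cC' hC'] := compact_initial J.
exists (e / 4), ((dC i).2 `|` C'); split; [by rewrite divr_gt0|exact: compactU|].
move=> q gqp; have [j sq] := shell_cover dL q.
have [fp _] := fg i p sp; have [fq _] := fg j q sq.
move: fp fq; rewrite !le_min -/e => /andP [fp _] /andP [_ fq].
have [jJ|Jj] := ltnP j J; first by right; apply: (hC' j jJ); have [] := sq.
left; apply: hC sp _.
have je : j.+1%:R^-1 <= e / 4.
  rewrite invf_ple ?posrE // ?divr_gt0 // invf_div.
  apply: (le_trans (ltW (truncnS_gt _))); rewrite -/J ler_nat.
  exact: leqW.
rewrite distrC in fp.
have h := distD (le_trans fq je) (distD (ltW gqp) fp).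
by apply: le_lt_trans h _; lra.
Qed.

Lemma finite_min_radius (I : Type) (F : set I) (Q : I -> R -> Prop) : finite_set F ->
  (forall a r r', r' <= r -> Q a r -> Q a r') ->
  (forall a, F a -> exists2 r : R, 0 < r & Q a r) ->
  exists2 r : R, 0 < r & forall a, F a -> Q a r.
Proof.
move=> [m /card_eqPle [/pcard_leP [h] _]] Qm hQ.
have /choice [r hr] : forall k : nat, exists r : R, 0 < r /\
    forall a, F a -> h a = k -> Q a r.
  move=> k; have [[a [Fa ha]]|nx] := pselect (exists a, F a /\ h a = k); last first.
    by exists 1; split=> // a Fa ha; exfalso; apply: nx; exists a.
  have [r r0 Qr] := hQ a Fa; exists r; split=> // b Fb hbk.
  have -> // : b = a.
  have hinj : {in F &, injective h} by exact: inj.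
  by apply: hinj; rewrite ?inE //; exact: etrans hbk (esym ha).
(* [s^-1] lies below every [r k] with [k < m], so the sum plays the part of a minimum. *)
pose s := 1 + \sum_(k < m) (r k)^-1.
have i0 k : 0 < (r k)^-1 by rewrite invr_gt0; have [] := hr k.
have s0 : 0 < s by rewrite ltr_pwDl // sumr_ge0 // => k _; exact: ltW.
exists s^-1 => [|a Fa]; first by rewrite invr_gt0.
have hm : (h a < m)%N by have := @funS _ _ F `I_m h a Fa.
have [r0 hQr] := hr (h a).
apply: Qm (hQr a Fa erefl).
rewrite invf_ple ?posrE // /s (bigD1 (Ordinal hm)) //= addrCA lerDl addr_ge0 //.
by apply: sumr_ge0 => k _; exact: ltW.
Qed.

(** Local finiteness leaves finitely many charts of the family over each shell. There the strict
    inequalities satisfied by [f], which need not be the centre of [B], leave a margin that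
    compactness makes uniform. *)
Lemma strong_control N (f : C1map M N) (B : set (C1map M N)) : strong_base B -> B f ->
  exists2 rho : nat -> R, (forall i, 0 < rho i) &
    forall g : C1map M N, close d L rho f g -> B g.
Proof.
move=> [f' [I [c [K [e [ac lf cK e0 ->]]]]]] Bf; have [ad cL Ld hb] := dL.
pose good (i : nat) (a : I) (r : R) := forall p (g : C1map M N), shell L i p -> K a p ->
  `|f p - g p| <= r -> `|chart_jacobian f (d i) p - chart_jacobian g (d i) p| <= r ->
  `|f' p - g p| < e a /\ `|chart_jacobian f' (c a) p - chart_jacobian g (c a) p| < e a.
suff /choice [rho hrho] : forall i, exists r : R, 0 < r /\ forall a, good i a r.
  exists rho => [i|g fg a p Kp]; first by have [] := hrho i.
  have [i sp] := shell_cover dL p; have [h1 h2] := fg i p sp.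
  exact: (hrho i).2.
move=> i.
have finF : finite_set [set a | cdom (c a) `&` shell L i !=set0].
  apply: (@compact_ind _ (shell L i) (fun S => finite_set [set a | cdom (c a) `&` S !=set0])).
  - exact: shell_compact dL i.
  - by rewrite (_ : mkset _ = set0) //; apply/seteqP; split=> // a [x [_ []]].
  - move=> S S' SS; apply: sub_finite_set => a [x [cx Sx]]; exists x; split=> //; exact: SS.
  - move=> S S' fS fS'; have fU := conj fS fS'; rewrite -finite_setU in fU; apply: sub_finite_set fU.
    by move=> a [x [cx [Sx|Sx]]]; [left|right]; exists x.
  - move=> p _; have [W Wp fW] := lf p; exists W => //.
    by apply: sub_finite_set fW => a [x [cx [Wx _]]]; exists x.
have [|a [x [cx sx]]|r r0 hr] := finite_min_radius (Q := good i) finF.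
- by move=> a r r' rr h p g sp Kp h1 h2; apply: h => //; [exact: le_trans rr|exact: le_trans rr].
- pose Q (r : R) p := forall (g : C1map M N), K a p -> shell L i p ->
    `|f p - g p| <= r -> `|chart_jacobian f (d i) p - chart_jacobian g (d i) p| <= r ->
    `|f' p - g p| < e a /\ `|chart_jacobian f' (c a) p - chart_jacobian g (c a) p| < e a.
  have [cKa Ka] := cK a.
  have [|||r r0 hr] := @compact_min_radius _ R (shell L i `&` K a) Q.
  + by apply: compact_closedI; [exact: shell_compact dL i|exact: compact_closedM].
  + move=> b b' p bb h g Kp sp h1 h2; apply: h => //; [exact: le_trans bb|exact: le_trans bb].
  + move=> p [sp Kp]; have cp := Ka _ Kp; have [Lp _] := sp.
    have [m1 m2] := Bf a p Kp.
    set u := `|f' p - f p| in m1; set v := `|chart_jacobian f' (c a) p - chart_jacobian f (c a) p| in m2.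
    pose m := Num.min (e a - u) (e a - v).
    have m0 : 0 < m by rewrite lt_min !subr_gt0 m1.
    have mu : u + m <= e a by rewrite -lerBrDl ge_min lexx.
    have mv : v + m <= e a by rewrite -lerBrDl ge_min lexx orbT.
    have m8 : 0 < m / 8 by rewrite divr_gt0.
    pose t := `|transition (c a) (d i) p| + 1.
    have t0 : 0 < t by rewrite ltr_wpDl.
    have nt : 0 < n%:R * t + 1 by rewrite ltr_wpDl // mulr_ge0 // ltW.
    pose r := m / 8 / (n%:R * t + 1).
    have r0 : 0 < r by rewrite divr_gt0.
    have rm : r <= m / 8 by rewrite ler_pdivrMr // ler_peMr ?(ltW m8) // lerDr mulr_ge0 // ltW.
    have ntr : n%:R * t * r <= m / 8.
      by rewrite /r mulrCA ger_pMr // ler_pdivrMr // mul1r lerDl.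
    have fin y z : y + m <= e a -> z <= m / 8 + y + m / 8 + m / 8 -> z < e a by lra.
    exists r => //.
    apply: filterS2 (filterI (C1map_near f' p m8) (C1map_near f p m8))
      (filterI (filterI (chart_jacobian_near f' (ac a) cp m8) (chart_jacobian_near f (ac a) cp m8))
        (filterI (filterI (cdom_near cp) (cdom_near (Ld _ _ Lp)))
         (transition_near (ac a) (ad i) cp (Ld _ _ Lp) ltr01)))
       => q [q1 q2] [[q3 q4] [[cq dq] q5]] _ g Kq sq h1 h2.
    split.
      apply: fin mu _; rewrite distrC in q2.
      exact: distD (distD (distD q1 (lexx u)) q2) (le_trans h1 rm).
    apply: fin mv _; rewrite distrC in q4.
    apply: distD (distD (distD q3 (lexx v)) q4) _.
    rewrite (chart_jacobian_transition f (ac a) (ad i) cq dq).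
    rewrite (chart_jacobian_transition g (ac a) (ad i) cq dq) -mulmxBr.
    apply: (le_trans (mx_norm_mul _ _)); apply: le_trans ntr.
    apply: ler_pM => //.
    rewrite ler_wpM2l //.
    exact: norm_leD q5.
  by exists r => // p g sp Kp; apply: hr.
exists r; split=> // a p g sp Kp; apply: hr => //; exists p; split=> //.
by have [_] := cK a; apply.
Qed.

Lemma open_strongP N (A : set (C1map M N)) : open A <->
  exists2 D : set (set (C1map M N)), D `<=` finI_from (@strong_base _ _ M N) id &
    \bigcup_(B in D) B = A.
Proof. by []. Qed.

Lemma open_control N (f : C1map M N) (A : set (C1map M N)) : open A -> A f ->
  exists2 rho : nat -> R, (forall i, 0 < rho i) &
    forall g : C1map M N, close d L rho f g -> A g.
Proof.
move=> /open_strongP [D hD <-] [B DB Bf].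
have [E hE eB] := hD B DB.
suff : exists2 rho : nat -> R, (forall i, 0 < rho i) &
    forall g : C1map M N, close d L rho f g -> forall X, X \in finmap.enum_fset E -> X g.
  move=> [rho rho0 h]; exists rho => // g fg; exists B => //; rewrite -eB => X XE.
  exact: h g fg X XE.
have : forall X, X \in finmap.enum_fset E -> strong_base X /\ X f.
  move=> X XE; split; first by have := hE X XE; rewrite inE.
  by have : B f by []; rewrite -eB; apply.
move: (finmap.enum_fset E) => s {E hE eB}.
elim: s => [|X s IH] hs; first by exists (fun=> 1).
have [|rho rho0 h] := IH; first by move=> Y Ys; apply: hs; rewrite inE Ys orbT.
have [sX Xf] := hs X (mem_head _ _).
have [rho' rho'0 h'] := strong_control sX Xf.
exists (fun i => Num.min (rho i) (rho' i)); first by move=> i; rewrite lt_min rho0 rho'0.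
move=> g fg.
have fg1 : close d L rho f g.
  by move=> i p sp; have [] := fg i p sp; rewrite !le_min => /andP [-> _] /andP [-> _].
have fg2 : close d L rho' f g.
  by move=> i p sp; have [] := fg i p sp; rewrite !le_min => /andP [_ ->] /andP [_ ->].
move=> Y; rewrite inE => /orP [/eqP ->|Ys]; first exact: h'.
exact: h.
Qed.

Lemma open_strong_base N (B : set (C1map M N)) : strong_base B -> open B.
Proof.
move=> sB; apply/open_strongP; exists [set B]; last by rewrite bigcup_set1.
move=> _ ->; exists (finmap.fset1 B).
  by move=> X /finmap.fset1P ->; apply/asboolP.
apply/seteqP; split=> f; first by apply; exact/finmap.fset1P.
by move=> Bf X /finmap.fset1P ->.
Qed.

(** By [row_free_stable] the condition survives small changes on [L a] and [L b], so a basic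
    neighbourhood with two charts, indexed by [bool], is enough. *)
Lemma free_pair_open N a b : open (@free_pair _ _ M d L N a b : set (C1map M N)).
Proof.
have [ad cL Ld hb] := dL.
have [L0|nL0] := pselect (L a `&` L b = set0); last first.
  have -> : (free_pair d L a b : set (C1map M N)) = setT by apply/seteqP; split=> // f _ /nL0.
  exact: openT.
have key f : free_pair d L a b f -> exists B : set (C1map M N),
    [/\ strong_base B, B f & B `<=` free_pair d L a b].
  move=> /(_ L0) free.
  have [mu mu0 h] := row_free_stable (ad a) (ad b) (cL a) (cL b) (Ld a) (Ld b) free.
  pose I := bool; pose c (i : I) := if i then d a else d b.
  pose K (i : I) := if i then L a else L b; pose e (i : I) := mu.
  exists (strong_nbhd f c K e); split.
  - exists f, I, c, K, e; split=> //.
    + by case; exact: ad.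
    + by move=> p; exists setT; [exact: filterT|exact: finite_finset].
    + by case; split; try exact: cL; exact: Ld.
  - by move=> i p _; rewrite !subrr !normr0.
  - move=> g fg _; apply: h => p Lp.
      by have [h1 h2] := fg true p Lp; split; exact: ltW.
    by have [h1 h2] := fg false p Lp; split; exact: ltW.
rewrite openE => f /key [B [sB Bf BF]].
by apply: filterS BF _; apply: open_nbhs_nbhs; split=> //; exact: open_strong_base.
Qed.

Context (n_gt0 : (0 < n)%N).

(** Immersion and injectivity come from the rank conditions for all pairs at once; only the
    homeomorphism onto the image is inherited from [f] by closeness. *)
Lemma generic_embedding N (f : C1map M N) (rho : nat -> R) : (4 * n + 1 <= N)%N ->
  embedding f -> (forall i, 0 < rho i) ->
  exists g : C1map M N, [/\ close d L rho f g, embedding g & forall a b, free_pair d L a b g].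
Proof.
move=> Nn ef rho0; have [rho' rho'0 he] := embedding_near ef.
have m0 i : 0 < Num.min (rho i) (rho' i) by rewrite lt_min rho0 rho'0.
have [g [fg free]] := generic_map dL n_gt0 f Nn m0.
exists g; split=> //.
  by move=> i p sp; have [] := fg i p sp; rewrite !le_min => /andP [-> _] /andP [-> _].
have ginj := free_injective dL free.
split=> //; first by apply: (free_immersion n_gt0 dL free).
apply: he => //.
by move=> i p sp; have [] := fg i p sp; rewrite !le_min => /andP [_ ->] /andP [_ ->].
Qed.

Lemma totally_skew_generic N : (4 * n + 1 <= N)%N ->
  exists2 G : set (set_type (embeddings M N)), Gdelta_dense G &
    G `<=` [set f | totally_skew (set_val f)].
Proof.
move=> Nn.
pose pr (k : nat) : nat * nat := odflt (0%N, 0%N) (unpickle k).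
pose F (k : nat) : set (set_type (embeddings M N)) :=
  [set f | free_pair d L (pr k).1 (pr k).2 (set_val f)].
exists (\bigcap_k F k); last first.
  move=> f Ff; apply: (free_totally_skew dL) => a b.
  by have := Ff (pickle (a, b)) I; rewrite /F /= /pr pickleK.
exists F => // k; split.
  by exists (free_pair d L (pr k).1 (pr k).2) => //; exact: free_pair_open.
(* [O] is the trace of an open set [A] of C^1 maps; a tolerance neighbourhood of [f] inside [A]
   contains an embedding satisfying all the conditions. *)
move=> O [f Of] [A oA eA].
have Af : A (set_val f) by have : O f by []; rewrite -eA.
have [rho rho0 hA] := open_control oA Af.
have ef : embedding (set_val f) by have := set_valP f.
have [g [fg eg free]] := generic_embedding Nn ef rho0.
have gE : g \in embeddings M N by rewrite inE.
exists (SigSub gE); split; first by rewrite -eA; exact: hA.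
exact: free.
Qed.

End embeddings.

(** * Existence of totally skew embeddings *)

Section existence.
Context {R : realType} {n : nat} {M : manifold R n} (n_gt0 : (0 < n)%N).
Local Notation chartM := (chart R n (manifold_space M)).
Implicit Types (c : chartM) (p q : M).

Lemma distDD (V : normedZmodType R) (x x' y y' : V) (a b : R) :
  `|x - x'| <= a -> `|y - y'| <= b -> `|x + y - (x' + y')| <= a + b.
Proof.
move=> h1 h2; rewrite opprD addrACA; exact: normD_le.
Qed.

Lemma C1map_cst N (b : 'rV[R]_N) : exists f : C1map M N, forall p, f p = b.
Proof.
have h : is_C1 (fun _ : M => b).
  apply: is_C1_local => p; have [c ac cp] := chart_at p; exists c; split=> //.
  exists (fun=> 0); last by move=> e e0; apply: nearW => q; rewrite subrr normr0 ltW.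
  by apply: nearW => q; exact: is_jac_cst.
by exists (C1Map h).
Qed.

Lemma C1map_add N (f g : C1map M N) : exists h : C1map M N, forall p, h p = f p + g p.
Proof.
have h : is_C1 (fun p : M => f p + g p).
  apply: is_C1_local => p; have [c ac cp] := chart_at p; exists c; split=> //.
  exists (fun q => chart_jacobian f c q + chart_jacobian g c q).
    apply: filterS (cdom_near cp) => q cq.
    by apply: has_jac_add; exact: C1map_has_jac.
  move=> e e0; have e20 : 0 < e / 2 by rewrite divr_gt0.
  apply: filterS2 (chart_jacobian_near f ac cp e20) (chart_jacobian_near g ac cp e20) => q h1 h2.
  have E : e / 2 + e / 2 = e by field.
  rewrite -E; exact: (distDD h1 h2).
by exists (C1Map h).
Qed.

Lemma C1map_cutoff N (f : C1map M N) c (A : set M) : atlas c -> compact A -> A `<=` cdom c ->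
  exists (k : M -> R) (S : set M) (g : C1map M N), [/\ compact S,
    forall p, 0 <= k p, forall p, A p -> k p = 0, forall p, ~ S p -> k p = 1 &
    forall p, g p = k p *: f p].
Proof.
move=> ac cA Ac.
have [k [D [S [C [[gk cD] kC [cS Sc _] kA kS]]]]] :=
  cutoff_exists n_gt0 ac cA Ac closed0 (setI0 A).
(* The product [k f] is obtained as [f + (k - 1) f], whose second summand vanishes off [S] and so
   can be extended by zero. *)
pose a x := -1 + 1 * k x.
pose u x := a x *: (f \o cinv c) x.
have cF : C1w (cimg c) (f \o cinv c) (jacobian_within (cimg c) (f \o cinv c)).
  by apply/C1_onP; exact: (C1mapP f ac).
have cD' : cont_on (cimg c) (fun x => 1 *: D x).
  by apply: cont_on_scale; [exact: cont_on_cst|exact: cont_on_sub cD].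
have cu := @C1w_scale _ _ _ _ a (fun x => 1 *: D x) _ _
  (fun x => is_grad_affine_comp (-1) 1 (gk (cimg c) x))
  cD' cF.
have [|g [g1 g2 _ _]] := @add_extend _ _ _ _ f c u _ S ac cu cS Sc.
  by move=> p cp nS; rewrite /u /a (kS p cp nS).1 mul1r addNr scale0r.
pose k' p : R := if `[< S p >] then k (cmap c p) else 1.
exists k', S, g; split=> //.
- by move=> p; rewrite /k'; case: asboolP => // _; have [/andP []] := kC (cmap c p).
- move=> p Ap; rewrite /k'; case: asboolP => Sp; first exact: (kA p Ap).1.
  have := (kA p Ap).1; rewrite (kS p (Ac _ Ap) Sp).1 => /eqP.
  by rewrite oner_eq0.
- by move=> p nS; rewrite /k' asboolF.
- move=> p; rewrite /k'; case: asboolP => Sp; last by rewrite g2 // scale1r.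
  rewrite (g1 p (Sc _ Sp)) /u /a /= cmapK; last exact: Sc.
  by rewrite mul1r scalerDl scaleN1r addrA subrr add0r.
Qed.

Context (d : nat -> chartM) (L : nat -> set M) (dL : nice_cover d L).

(* With [k_i] vanishing on [L i] and equal to [1] outside the compact set [S i],
   the sum of the products [k_0 ... k_(i-1)] is locally finite and at least [m]
   outside the union of the [S j] for [j < m]. *)
Lemma proper_map N : (0 < N)%N -> exists f : C1map M N, forall B : R,
  exists2 C : set M, compact C & forall p, `|f p| < B -> C p.
Proof.
move=> N0; have [ad cL Ld hb] := dL.
have /choice [step hstep] : forall z : nat * C1map M N, exists w : (M -> R) * set M * C1map M N,
    [/\ compact w.1.2, forall p, 0 <= w.1.1 p, forall p, L z.1 p -> w.1.1 p = 0,
      forall p, ~ w.1.2 p -> w.1.1 p = 1 & forall p, w.2 p = w.1.1 p *: z.2 p].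
  move=> [i f]; have [k [S [g h]]] := C1map_cutoff f (ad i) (cL i) (Ld i).
  by exists (k, S, g).
have [f1 f1E] := C1map_cst (const_mx 1 : 'rV[R]_N).
pose t := fix t i : C1map M N := if i is j.+1 then (step (j, t j)).2 else f1.
pose S i := (step (i, t i)).1.2.
have tP i : exists2 tau : M -> R, (forall p, t i p = tau p *: const_mx 1) &
    [/\ forall p, 0 <= tau p, forall p j, (j < i)%N -> L j p -> tau p = 0 &
        forall p, (forall j, (j < i)%N -> ~ S j p) -> tau p = 1].
  elim: i => [|i [tau h1 [h2 h3 h4]]].
    by exists (fun=> 1) => [p|]; [rewrite scale1r; exact: f1E|split].
  have [_ k0 kL kS kE] := hstep (i, t i).
  exists (fun p => (step (i, t i)).1.1 p * tau p).
    by move=> p; rewrite /= kE /= h1 scalerA.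
  split.
  - by move=> p; rewrite mulr_ge0.
  - move=> p j; rewrite ltnS leq_eqVlt => /orP [/eqP ->|ji] Lp; first by rewrite kL ?mul0r.
    by rewrite (h3 p j ji Lp) mulr0.
  - move=> p nS; rewrite kS; last exact: nS.
    by rewrite mul1r h4 // => j ji; apply: nS; exact: ltnW.
have /choice [sum hsum] : forall m, exists s : C1map M N, forall p, s p = \sum_(i < m) t i p.
  elim=> [|m [s hs]].
    by have [z zE] := C1map_cst (0 : 'rV[R]_N); exists z => p; rewrite big_ord0 zE.
  have [s' s'E] := C1map_add s (t m); exists s' => p.
  by rewrite big_ord_recr /= s'E hs.
have stable a m p : L a p -> (a < m)%N -> sum m p = sum a.+1 p.
  move=> Lp; elim: m => // m IH; rewrite ltnS leq_eqVlt => /orP [/eqP ->//|am].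
  rewrite -IH // !hsum big_ord_recr /=.
  have [tau tE [_ t0 _]] := tP m; by rewrite tE (t0 p a am Lp) scale0r addr0.
have /choice [a aP] : forall p, exists a, nbhs p (L a).
  by move=> p; have [a h _] := hb p setT filterT; exists a.
pose f p := sum (a p).+1 p.
have fE b p : L b p -> f p = sum b.+1 p.
  move=> Lb; have La : L (a p) p by exact: nbhs_singleton.
  rewrite /f -(stable (a p) (maxn (a p) b).+1 p La); last by rewrite ltnS leq_maxl.
  by apply: stable => //; rewrite ltnS leq_maxr.
have fC1 : is_C1 f.
  apply: is_C1_local => p; have La := aP p; have cp := Ld _ _ (nbhs_singleton La).
  exists (d (a p)); split=> //.
  exists (fun q => chart_jacobian (sum (a p).+1) (d (a p)) q).
    have La' : nbhs p (L (a p))° by exact: nbhs_interior.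
    apply: filterS2 (cdom_near cp) La' => q cq Lq.
    apply: (@has_jac_local _ _ _ _ _ (sum (a p).+1)) => //; last exact: C1map_has_jac.
    by apply: filterS Lq => x; exact: fE.
  by move=> e e0; exact: chart_jacobian_near.
exists (C1Map fC1) => B /=.
pose m := (Num.trunc `|B|).+1.
have Bm : B <= m%:R by apply: (le_trans (ler_norm _)); apply/ltW; rewrite truncnS_gt.
have [C cC hC] : exists2 C : set M, compact C & forall j, (j < m)%N -> S j `<=` C.
  elim: m {Bm} => [|m [C cC hC]]; first by exists set0 => //; exact: compact0.
  exists (C `|` S m); first by apply: compactU => //; have [] := hstep (m, t m).
  move=> j; rewrite ltnS leq_eqVlt => /orP [/eqP ->|/hC h] x Sx; [by right|left; exact: h].
exists C => // p fB; apply: contrapT => nC.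
have : m%:R <= `|f p|.
  (* Enough terms to include the first [m], which equal [1] in every coordinate off [C], and all
     those that may be nonzero at [p]. *)
  pose l := maxn m (a p).+1.
  have -> : f p = sum l p.
    by rewrite /f (stable (a p) l p) //; [exact: nbhs_singleton|exact: leq_maxr].
  apply: le_trans (mx_coef_norm _ ord0 (Ordinal N0)); apply: le_trans (ler_norm _).
  rewrite hsum summxE.
  have -> : m%:R = \sum_(i < l) (if (i < m)%N then 1 else 0) :> R.
    rewrite -big_mkcond /= (big_ord_narrow (leq_maxl _ _)) /=.
    by rewrite sumr_const card_ord.
  apply: ler_sum => i _; have [tau tE [t0 _ t1]] := tP i.
  rewrite tE !mxE mulr1; case: ltnP => im; last exact: t0.
  rewrite t1 // => j ji Sj; apply: nC; apply: hC Sj; exact: ltn_trans im.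
by rewrite leNgt (lt_le_trans fB).
Qed.

(** The tolerance [1] on all shells keeps a perturbation of a proper map proper, which replaces
    closeness to a given embedding. *)
Lemma totally_skew_exists N : (4 * n + 1 <= N)%N -> @has_totally_skew_embedding R n M N.
Proof.
move=> Nn; have N0 : (0 < N)%N by lia.
have [f0 hf0] := proper_map N0.
have [g [fg free]] := generic_map dL n_gt0 f0 Nn (fun=> ltr01).
have ginj := free_injective dL free.
exists g; last exact: (free_totally_skew dL free).
split=> //; first exact: (free_immersion n_gt0 dL free).
apply: homeo_of_locally_proper => // p.
(* If [|g q - g p| < 1], then [|f0 q| <= |g p| + 2], since [g] is within [1] of [f0]. *)
have [C cC hC] := hf0 (`|g p| + 2 + 1); exists 1, C; split=> // q qp; apply: hC.
have [i sq] := shell_cover dL q; have [h _] := fg i q sq.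
have := norm_leD (distD h (ltW qp)); rewrite addrA => h'.
by apply: le_lt_trans h' _; lra.
Qed.

End existence.

(** * Closed manifolds *)

Section extrema.
Context {R : realType}.

(** Upper semicontinuity along [K] suffices. Without a maximum, finitely many strict local bounds by
    values of [phi] would yield one value strictly above all of [phi] on [K], including itself. *)
Lemma compact_max (T : topologicalType) (K : set T) (phi : T -> R) : compact K -> K !=set0 ->
  (forall p, K p -> forall e : R, 0 < e -> \forall q \near p, K q -> phi q < phi p + e) ->
  exists2 p, K p & forall q, K q -> phi q <= phi p.
Proof.
move=> cK [p0 Kp0] hphi; apply: contrapT => nmax.
have up p : K p -> exists2 p', K p' & phi p < phi p'.
  move=> Kp; apply: contrapT => nup; apply: nmax; exists p => // q Kq.
  by rewrite leNgt; apply/negP => lt; apply: nup; exists q.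
have [p Kp h] : exists2 p, K p & forall q, K q -> phi q < phi p.
  apply: (@compact_ind _ K (fun S => exists2 p, K p & forall q, S q -> phi q < phi p)) => //.
  - by exists p0.
  - by move=> S S' SS [p Kp h]; exists p => // q /SS; exact: h.
  - move=> S S' [p Kp h] [p' Kp' h']; have [pp|pp] := leP (phi p) (phi p').
      by exists p' => // q [/h lt|/h' //]; exact: lt_le_trans pp.
    by exists p => // q [/h //|/h' lt]; exact: lt_trans pp.
  - move=> p Kp; have [p' Kp' lt] := up p Kp.
    have e0 : 0 < phi p' - phi p by rewrite subr_gt0.
    exists [set q | K q -> phi q < phi p + (phi p' - phi p)]; first exact: hphi.
    by exists p' => // q [hq Kq]; have := hq Kq; rewrite addrC subrK.
by have := h p Kp; rewrite ltxx.
Qed.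

Context {m : nat}.

Definition dot (a b : 'rV[R]_m) : R := (a *m b^T) ord0 ord0.

Lemma dotBl a a' b : dot (a - a') b = dot a b - dot a' b.
Proof. by rewrite /dot mulmxBl !mxE. Qed.

Lemma dotDl a a' b : dot (a + a') b = dot a b + dot a' b.
Proof. by rewrite /dot mulmxDl !mxE. Qed.

Lemma dotBr a b b' : dot a (b - b') = dot a b - dot a b'.
Proof. by rewrite /dot linearB /= mulmxBr !mxE. Qed.

Lemma dotZl t a b : dot (t *: a) b = t * dot a b.
Proof. by rewrite /dot -scalemxAl mxE. Qed.

Lemma dotZr t a b : dot a (t *: b) = t * dot a b.
Proof. by rewrite /dot linearZ /= -scalemxAr mxE. Qed.

Lemma dot_le a b : `|dot a b| <= m%:R * `|a| * `|b|.
Proof.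
apply: (le_trans (mx_coef_norm _ _ _)); apply: (le_trans (mx_norm_mul _ _)).
by rewrite ler_wpM2l ?mulr_ge0 //; exact: mul_rowT_le.
Qed.

Lemma dot_gt0 a : a != 0 -> 0 < dot a a.
Proof.
move=> a0; have [j aj] : exists j, a ord0 j != 0.
  apply: contrapT => na; move/eqP: a0; apply; apply/rowP => j; rewrite mxE.
  by apply/eqP; apply: contrapT => /negP aj; apply: na; exists j.
rewrite /dot mxE (bigD1 j) //= mxE; apply: ltr_pwDl; first by rewrite -expr2 exprn_even_gt0.
by apply: sumr_ge0 => i _; rewrite mxE -expr2 sqr_ge0.
Qed.

End extrema.

(** * Box dimension of the image of a compact set *)

Section cov_manifold.
Context {R : realType} {n : nat} {M : manifold R n}.

Lemma cov_setU (T : Type) (V : normedModType R) k (S S' : set T) (phi : T -> V) :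
  cov k S phi -> cov k S' phi -> cov k (S `|` S') phi.
Proof.
move=> h h'.
have := @cov_fin R bool T V k (fun b => if b then S else S') (fun=> phi)
  (fun b => if b return cov k (if b then S else S') phi then h else h').
by apply: cov_reindex => x [Sx|Sx]; [exists (true, x)|exists (false, x)].
Qed.

(** In a chart, on a small convex half-ball, the mean value inequality makes the map Lipschitz;
    compactness reduces to finitely many such pieces. *)
Lemma C1map_cov N (f : C1map M N) (K : set M) : compact K -> cov n K f.
Proof.
move=> cK; apply: (@compact_ind _ K (fun S => cov n S f)) => //.
- by exists 0%N => k; exists (fun=> 0%N); split.
- by move=> S S' SS; exact: cov_sub.
- by move=> S S'; exact: cov_setU.
move=> p _; have [c ac cp] := chart_at p.
pose F := f \o cinv c; pose G := jacobian_within (cimg c) F.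
have [h1 h2] : C1w (cimg c) F G by apply/C1_onP; exact: (C1mapP f ac).
have ix := cimgP cp.
have [r r0 hr] := h2 _ ix 1 ltr01.
have [iH i2] := cimg_hopen c; have [r' r'0 hr'] := i2 _ ix.
set x := cmap c p in ix r r0 hr r' r'0 hr' *.
pose t := Num.min r r'; have t0 : 0 < t by rewrite lt_min r0.
pose Y := [set y | @halfspace R n y /\ `|y - x| < t].
have YX y : Y y -> cimg c y /\ `|G y - G x| <= 1.
  move=> [Hy]; rewrite lt_min => /andP [yr yr'].
  by have iy := hr' y Hy yr'; split=> //; exact: hr.
exists [set q | cdom c q /\ `|cmap c q - x| < t].
  by apply: filterS2 (cdom_near cp) (cmap_near cp t0) => q.
have cY : cov n Y id.
  have := @cov_mx R 1 n Y (`|x| + t); rewrite mul1n; apply => y [_ yt].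
  exact: norm_leD (ltW yt).
have cF : cov n Y F.
  apply: (cov_lip (L := n%:R * `|G x| + n%:R)) cY => y z Yy Yz.
  have := @mvt_ineq R n N Y F G (G x) 1 z y.
  rewrite mulr1 => /(_ _ _ _) h.
  have {}h : `|F y - F z - (y - z) *m G x| <= n%:R * `|y - z|.
    apply: h => [s s01|w /YX [iw _]|w /YX []//]; last first.
      by apply: is_jac_sub (h1 w iw) => v /YX [].
    split; first exact: halfspace_convex Yz.1 Yy.1 s01.
    have -> : z + s *: (y - z) - x = (1 - s) *: (z - x) + s *: (y - x).
      by apply/rowP => j; rewrite !mxE; ring.
    move/andP: s01 => [s0 s1].
    apply: le_lt_trans (ler_normD _ _) _; rewrite !normrZ !ger0_norm ?subr_ge0 //.
    have [_ zt] := Yz; have [_ yt] := Yy.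
    have mt : Num.max `|z - x| `|y - x| < t by rewrite gt_max zt.
    have am : `|z - x| <= Num.max `|z - x| `|y - x| by rewrite le_max lexx.
    have bm : `|y - x| <= Num.max `|z - x| `|y - x| by rewrite le_max lexx orbT.
    apply: le_lt_trans mt; set mm := Num.max _ _ in am bm *.
    set a := `|z - x| in am *; set b := `|y - x| in bm *.
    have h1' : (1 - s) * a <= (1 - s) * mm by rewrite ler_wpM2l // subr_ge0.
    have h2' : s * b <= s * mm by rewrite ler_wpM2l.
    by move: h1' h2'; rewrite mulrBl mul1r [(1 - s) * mm]mulrBl mul1r; lra.
  rewrite -(subrK ((y - z) *m G x) (F y - F z)).
  apply: (le_trans (ler_normD _ _)); rewrite mulrDl addrC; apply: lerD; last exact: h.
  by apply: (le_trans (mx_norm_mul _ _)); rewrite mulrAC.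
apply: cov_reindex cF => q [[cq qt] _]; exists (cmap c q); last by rewrite /F /= cmapK.
by split=> //; exact: iH (cimgP cq).
Qed.

End cov_manifold.

(** * Supporting hyperplanes of a closed manifold *)

Section closed_case.
Context {R : realType} {n : nat} {M : manifold R n} (n_gt0 : (0 < n)%N).
Local Notation chartM := (chart R n (manifold_space M)).
Context (cM : closed_manifold M) (M_neq0 : [set: M] !=set0).
Implicit Types (c : chartM) (p q : M).

Lemma mul_col_mx0 m1 m2 k (A : 'M[R]_(m1, k)) (B : 'M[R]_(m2, k)) (l : 'cV[R]_k) :
  A *m l = 0 -> B *m l = 0 -> col_mx A B *m l = 0.
Proof. by move=> h1 h2; rewrite mul_col_mx h1 h2 col_mx0. Qed.

(** With empty boundary the first coordinate of a chart image point is positive, so a small full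
    ball stays inside the half-space. *)
Lemma interior_chart c p : atlas c -> cdom c p ->
  exists2 r : R, 0 < r & forall y, `|y - cmap c p| < r -> cimg c y.
Proof.
move=> ac cp; have [_ _ bd] := cM.
have [iH i2] := cimg_hopen c; have [r r0 hr] := i2 _ (cimgP cp).
pose i0 : 'I_n := Ordinal n_gt0.
have x0 : 0 < cmap c p ord0 i0.
  rewrite lt_neqAle (iH _ (cimgP cp) i0 erefl) andbT eq_sym; apply/eqP => x0.
  have : manifold_boundary p by exists c; split=> //; exists i0.
  by rewrite bd.
exists (Num.min r (cmap c p ord0 i0)) => [|y]; first by rewrite lt_min r0.
rewrite lt_min => /andP [yr yx]; apply: hr => // i ii0.
have -> : i = i0 by apply: val_inj.
have := le_lt_trans (mx_coef_norm _ ord0 i0) yx; rewrite !mxE ltr_norml => /andP [h _].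
lra.
Qed.

(** Displacements [t] and [- t] along each coordinate are both admissible, so the derivative of the
    functional is neither positive nor negative. *)
Lemma critical_at_max N (f : C1map M N) (l : 'cV[R]_N) c p : atlas c -> cdom c p ->
  (forall q, (f q *m l) ord0 ord0 <= (f p *m l) ord0 ord0) ->
  chart_jacobian f c p *m l = 0.
Proof.
move=> ac cp pmax; have [r r0 hr] := interior_chart ac cp.
have hj := C1map_has_jac f ac cp; move: hj; set J := chart_jacobian f c p => hj.
apply/row_matrixP => i; rewrite row0 row_mul rowE.
set v : 'rV[R]_n := delta_mx 0 i.
have v1 : `|v| <= 1.
  by apply: mx_norm_le => // a b; rewrite mxE; case: (_ && _); rewrite ?normr1 ?normr0.
rewrite [LHS]mx11_scalar; set a := (_ *m l) ord0 ord0.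
suff -> : a = 0 by apply/rowP => j; rewrite !mxE mul0rn.
apply/eqP; rewrite -normr_le0; apply/ler_addgt0Pr => e e0; rewrite add0r.
have k0 : 0 < N%:R * `|l| + 1 by rewrite ltr_wpDl // mulr_ge0.
have [s s0 hs] := hj _ (divr_gt0 e0 k0).
pose t := Num.min r s / 2.
have m0 : 0 < Num.min r s by rewrite lt_min r0.
have t0 : 0 < t by rewrite divr_gt0.
have [tr ts] : t < r /\ t < s by apply/andP; rewrite -lt_min /t; lra.
have key (u : R) : `|u| = t -> u * a <= e * t.
  move=> ut; set y := cmap c p + u *: v.
  have yx : `|y - cmap c p| <= t.
    by rewrite /y addrC addKr normrZ ut ler_piMr // ltW.
  have iy := hr y (le_lt_trans yx tr); have := hs y iy (le_lt_trans yx ts).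
  rewrite /= cmapK // => h.
  have yE : y - cmap c p = u *: v by rewrite /y addrC addKr.
  have h2 : `|f (cinv c y) - f p - (y - cmap c p) *m J| <= e / (N%:R * `|l| + 1) * t.
    by apply: (le_trans h); rewrite ler_wpM2l // divr_ge0 // ltW.
  have h3 : `|((f (cinv c y) - f p - (y - cmap c p) *m J) *m l) ord0 ord0| <= e * t.
    apply: (le_trans (mx_coef_norm _ _ _)); apply: (le_trans (mx_norm_mul _ _)).
    rewrite mulrAC; apply: (le_trans (ler_wpM2l _ h2)); first by rewrite mulr_ge0.
    rewrite mulrA ler_wpM2r ?(ltW t0) // mulrCA ger_pMr // ler_pdivrMr // mul1r lerDl //.
  have E : ((f (cinv c y) - f p - (y - cmap c p) *m J) *m l) ord0 ord0 =
      (f (cinv c y) *m l) ord0 ord0 - (f p *m l) ord0 ord0 - u * a.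
    by rewrite yE !mulmxBl -!scalemxAl /a !mxE.
  have := pmax (cinv c y); rewrite E ler_norml in h3; move/andP: h3 => [h3 _].
  move: h3; move: (u * a) (e * t) ((f (cinv c y) *m l) ord0 ord0) ((f p *m l) ord0 ord0).
  by move=> *; lra.
have k1 := key t (gtr0_norm t0); have := key (- t); rewrite normrN (gtr0_norm t0) => /(_ erefl) k2.
have : t * `|a| <= t * e.
  rewrite [t * e]mulrC -[X in X * _](gtr0_norm t0) -normrM ler_norml; apply/andP; split.
    by rewrite lerNl -mulNr.
  exact: k1.
by rewrite ler_pM2l.
Qed.

Section skew_codim.
Context (f : C1map M (2 * n + 1)) (imm : immersion f) (tsf : totally_skew f).

Lemma two_maxima (l : 'cV[R]_(2 * n + 1)) p q : p <> q ->
  (forall z, (f z *m l) ord0 ord0 <= (f p *m l) ord0 ord0) ->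
  (forall z, (f z *m l) ord0 ord0 <= (f q *m l) ord0 ord0) -> l = 0.
Proof.
move=> pq pmax qmax.
have [c ac cp] := chart_at p; have [c' ac' cq] := chart_at q.
have J1 := critical_at_max ac cp pmax; have J2 := critical_at_max ac' cq qmax.
have e : (f p - f q) *m l = 0.
  rewrite [LHS]mx11_scalar mulmxBl; apply/rowP => j.
  have : (f p *m l) ord0 ord0 = (f q *m l) ord0 ord0 by apply/le_anti; rewrite pmax qmax.
  by rewrite !mxE => ->; rewrite subrr mul0rn.
have free := totally_skew_free n_gt0 imm tsf pq ac ac' cp cq.
(* In dimension [2 n + 1] the matrix [tangents] is square, so independent rows span the whole space
   and [l], which annihilates them, is zero. *)
have : row_full (tangents f c c' p q).
  by move: free; rewrite /row_free /row_full => /eqP ->; apply/eqP; lia.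
move=> /row_fullP [B BA].
have A0 : tangents f c c' p q *m l = 0 := mul_col_mx0 J1 (mul_col_mx0 J2 e).
move: (tangents f c c' p q) BA A0 => A BA A0.
by rewrite -(mul1mx l) -BA -mulmxA A0 mulmx0.
Qed.

Let P q : 'rV[R]_(2 * n) := lsubmx (f q).
Let z q : R := rsubmx (f q) ord0 ord0.

Lemma functionalE q (u : 'rV[R]_(2 * n)) (t : R) :
  (f q *m col_mx u^T t%:M) ord0 ord0 = dot (P q) u + t * z q.
Proof.
rewrite -{1}(hsubmxK (f q)) mul_row_col mxE; congr (_ + _).
by rewrite mul_mx_scalar mxE.
Qed.

Lemma P_near p (e : R) : 0 < e -> \forall q \near p, `|P q - P p| <= e.
Proof.
move=> e0; apply: filterS (C1map_near f p e0) => q; apply: le_trans.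
by rewrite -linearB /=; apply: mx_norm_le => // i j; rewrite mxE mx_coef_norm.
Qed.

Lemma z_near p (e : R) : 0 < e -> \forall q \near p, `|z q - z p| <= e.
Proof.
move=> e0; apply: filterS (C1map_near f p e0) => q; apply: le_trans.
have -> : z q - z p = (rsubmx (f q - f p)) ord0 ord0 by rewrite /z !mxE.
by rewrite mxE mx_coef_norm.
Qed.

Lemma dot_near (u v : 'rV[R]_(2 * n)) p (e : R) : 0 < e ->
  \forall q \near p, `|dot (P q - v) u - dot (P p - v) u| <= e.
Proof.
move=> e0; have k0 : 0 < (2 * n)%:R * `|u| + 1 by rewrite ltr_wpDl // mulr_ge0.
apply: filterS (P_near p (divr_gt0 e0 k0)) => q h.
rewrite -dotBl opprB addrA subrK; apply: (le_trans (dot_le _ _)).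
rewrite mulrAC; apply: (le_trans (ler_wpM2l _ h)); first by rewrite mulr_ge0.
by rewrite mulrCA ger_pMr // ler_pdivrMr // mul1r lerDl.
Qed.

(** Otherwise the functional [(u, 0)] is constant on the image, and any two distinct points are
    maxima of it. *)
Lemma spread (u : 'rV[R]_(2 * n)) : u != 0 -> exists p q, dot (P p) u <> dot (P q) u.
Proof.
move=> u0; apply: contrapT => nh.
have [p0 _] := M_neq0; have [q0 q0p] := other_point n_gt0 p0.
have eqd p q : dot (P p) u = dot (P q) u.
  by apply: contrapT => h; apply: nh; exists p, q.
have mx p : forall y, (f y *m col_mx u^T (0 : R)%:M) ord0 ord0 <= (f p *m col_mx u^T 0%:M) ord0 ord0.
  by move=> y; rewrite !functionalE !mul0r !addr0 (eqd y p).
have := two_maxima q0p (mx q0) (mx p0).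
rewrite -[X in _ = X -> _]col_mx0 => /eq_col_mx [uT _].
by move/eqP: u0; apply; rewrite -(trmxK u) uT trmx0.
Qed.

Let sphere : set 'rV[R]_(2 * n) := [set u | `|u| = 1].

Lemma sphere_compact : compact sphere.
Proof.
apply: bounded_closed_compact.
  exists 1; split=> // b b1 u /= ->; exact: ltW.
have -> : sphere = (fun u : 'rV[R]_(2 * n) => `|u|) @^-1` [set 1] by [].
by apply: closed_comp; [move=> u _; exact: norm_continuous|exact: closed_eq].
Qed.

Lemma dot_near_dir (w u : 'rV[R]_(2 * n)) (e : R) : 0 < e ->
  \forall v \near u, `|dot w v - dot w u| <= e.
Proof.
move=> e0; have k0 : 0 < (2 * n)%:R * `|w| + 1 by rewrite ltr_wpDl // mulr_ge0.
apply/nbhs_ballP; exists (e / ((2 * n)%:R * `|w| + 1)) => [|v] /=; first by rewrite divr_gt0.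
rewrite -ball_normE /= distrC => h; rewrite -dotBr; apply: (le_trans (dot_le _ _)).
apply: (le_trans (ler_wpM2l _ (ltW h))); first by rewrite mulr_ge0.
by rewrite mulrCA ger_pMr // ler_pdivrMr // mul1r lerDl.
Qed.

(** By compactness of the unit sphere, finitely many points [s] suffice to distinguish values in
    every direction. About their barycentre [x0] the values of a direction sum to zero without all
    vanishing, so one is positive; compactness again makes this uniform. *)
Lemma interior_center : exists (x0 : 'rV[R]_(2 * n)) (r : R), 0 < r /\
  forall u, `|u| = 1 -> exists p, r <= dot (P p - x0) u.
Proof.
have [s hs] : exists s : seq M, forall u, sphere u -> exists p q,
    [/\ p \in s, q \in s & dot (P p) u <> dot (P q) u].
  apply: (@compact_ind _ sphere (fun S => exists s : seq M, forall u, S u -> exists p q,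
    [/\ p \in s, q \in s & dot (P p) u <> dot (P q) u])); first exact: sphere_compact.
  - by exists [::].
  - by move=> S S' SS [s h]; exists s => u /SS; exact: h.
  - move=> S S' [s h] [s' h']; exists (s ++ s') => u [Su|Su].
      by have [p [q [ps qs e]]] := h u Su; exists p, q; rewrite !mem_cat ps qs.
    by have [p [q [ps qs e]]] := h' u Su; exists p, q; rewrite !mem_cat ps qs !orbT.
  move=> u u1; have u0 : u != 0 by rewrite -normr_gt0 u1 ltr01.
  have [p [q pq]] := spread u0.
  have a0 : 0 < `|dot (P p - P q) u|.
    by rewrite normr_gt0 dotBl subr_eq0; apply/eqP.
  have a2 : 0 < `|dot (P p - P q) u| / 2 by rewrite divr_gt0.
  exists [set v | `|dot (P p - P q) v - dot (P p - P q) u| <= `|dot (P p - P q) u| / 2].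
    exact: dot_near_dir.
  exists [:: p; q] => v [/= hv _]; exists p, q; split; rewrite ?inE ?eqxx ?orbT // => e.
  move: hv; rewrite [dot _ v]dotBl e subrr sub0r normrN.
  by rewrite leNgt ltr_pdivrMr // ltr_pMr // ltr1n.
pose x0 := (size s)%:R^-1 *: \sum_(p <- s) P p.
have pos u : sphere u -> exists p, 0 < dot (P p - x0) u.
  move=> u1; have [p [q [ps qs e]]] := hs u u1.
  have s0 : (0 < size s)%N by case: (s) ps.
  have sum0 : \sum_(p <- s) dot (P p - x0) u = 0.
    have dsum (t : seq M) : dot (\sum_(p <- t) P p) u = \sum_(p <- t) dot (P p) u.
      elim: t => [|y t IH]; first by rewrite !big_nil /dot mul0mx mxE.
      by rewrite !big_cons dotDl IH.
    under eq_bigr do rewrite dotBl.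
    rewrite sumrB big_const_seq count_predT iter_addr addr0 /x0 dotZl dsum.
    by rewrite -[X in _ - X]mulr_natl mulrA mulfV ?mul1r ?subrr // pnatr_eq0 -lt0n.
  apply: contrapT => npos; apply: e.
  have le0 y : dot (P y - x0) u <= 0.
    by rewrite leNgt; apply/negP => lt; apply: npos; exists y.
  have eq0 y : y \in s -> dot (P y) u = dot x0 u.
    move=> ys; have : \sum_(p <- s) - dot (P p - x0) u = 0 by rewrite sumrN sum0 oppr0.
    move/eqP; rewrite psumr_eq0; last by move=> i _; rewrite oppr_ge0.
    by move=> /allP /(_ y ys) /=; rewrite oppr_eq0 dotBl subr_eq0 => /eqP.
  by rewrite !eq0.
exists x0.
have [||u u1|r r0 h] := @compact_min_radius _ R sphere
  (fun r u => exists p, r <= dot (P p - x0) u).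
- exact: sphere_compact.
- by move=> b b' u bb [p h]; exists p; apply: le_trans h.
- have [p p0] := pos u u1; have p2 : 0 < dot (P p - x0) u / 2 by rewrite divr_gt0.
  exists (dot (P p - x0) u / 2) => //.
  apply: filterS (dot_near_dir (P p - x0) u p2) => v hv _; exists p.
  by move: hv; rewrite ler_norml => /andP [h1 _]; move: h1; lra.
by exists r; split=> // u /h.
Qed.

(* The last clause says that [x] is in the interior of the convex hull of the
   projection. *)
Lemma hidden_point : exists (x : 'rV[R]_(2 * n)) (r : R), [/\ 0 < r,
  forall p, P p <> x & forall u, exists p, r * `|u| <= dot (P p - x) u].
Proof.
have [x0 [r [r0 hr]]] := interior_center.
have n20 : 0 < (2 * n)%:R :> R by rewrite ltr0n; lia.
(* [|dot tau v| <= 2 n |tau| |v|], so a shift by [tau] of this size changes the value in a unit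
   direction by at most [r / 2]. *)
pose eps := r / 2 / (2 * n)%:R.
have eps0 : 0 < eps by rewrite !divr_gt0.
have [tau te htau] : exists2 tau : 'rV[R]_(2 * n), `|tau| <= eps & forall p, P p - x0 <> tau.
  apply: contrapT => nh.
  have cf : cov n [set: M] (fun p => P p - x0).
    have [cpt _ _] := cM.
    apply: (cov_lip (L := 1)) (C1map_cov f cpt) => p q _ _.
    rewrite opprB addrA subrK mul1r /P -linearB /=.
    by apply: mx_norm_le => // i j; rewrite mxE mx_coef_norm.
  apply: (not_cov _ eps0 _ cf); first lia.
  move=> tau te; apply: contrapT => np; apply: nh; exists tau => // p e.
  by apply: np; exists p.
exists (x0 + tau), (r / 2); split=> [|p e|u]; first by rewrite divr_gt0.
  by apply: (htau p); rewrite e addrC addKr.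
have [->|u0] := eqVneq u 0.
  have [p _] := M_neq0; exists p.
  by rewrite normr0 mulr0 /dot trmx0 mulmx0 mxE.
have nu0 : 0 < `|u| by rewrite normr_gt0.
pose v := `|u|^-1 *: u.
have v1 : `|v| = 1 by rewrite /v normrZ ger0_norm ?invr_ge0 // mulVf // gt_eqF.
have [p hp] := hr v v1; exists p.
have uE : u = `|u| *: v by rewrite /v scalerA divff ?scale1r // gt_eqF.
rewrite [X in dot _ X]uE dotZr [leLHS]mulrC ler_pM2l //.
have -> : P p - (x0 + tau) = (P p - x0) - tau by rewrite opprD addrA.
rewrite dotBl.
have : dot tau v <= r / 2.
  apply: (le_trans (ler_norm _)); apply: (le_trans (dot_le _ _)); rewrite v1 mulr1.
  apply: (le_trans (ler_wpM2l _ te)) => //.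
  by rewrite /eps mulrC divfK // gt_eqF.
lra.
Qed.

(* Minimize over [u] the height at which the supporting hyperplane of slope [u]
   passes over the hidden point [x].  If the minimizer had a single contact
   point [q0], tilting it in the direction of [P q0 - x] would decrease the
   height. *)
Lemma no_totally_skew_codim : False.
Proof.
have [x [r [r0 Px hr]]] := hidden_point.
have [cpt _ _] := cM.
(* Height over [x] of the hyperplane through [f q] with normal [(u, 1)]; the maximum over [q]
   belongs to the supporting hyperplane. *)
pose h (u : 'rV[R]_(2 * n)) q := z q + dot (P q - x) u.
have h_near u p (e : R) : 0 < e -> \forall q \near p, `|h u q - h u p| <= e.
  move=> e0; have e20 : 0 < e / 2 by rewrite divr_gt0.
  apply: filterS2 (z_near p e20) (dot_near u x p e20) => q h1 h2.
  have -> : e = e / 2 + e / 2 by field.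
  rewrite /h opprD addrACA; exact: normD_le.
have /choice [qm hqm] : forall u, exists q, forall q', h u q' <= h u q.
  move=> u; have [|q _ hq] := @compact_max R M setT (h u) cpt M_neq0; last first.
    by exists q => q'; exact: hq.
  move=> p _ e e0; have e20 : 0 < e / 2 by rewrite divr_gt0.
  apply: filterS (h_near u p _ e20) => q; rewrite ler_norml => /andP [_ hh] _; lra.
have [D D0 hD] : exists2 D : R, 0 < D & forall q, [set: M] q -> `|P q - x| <= D.
  apply: (compact_norm_bound (phi := fun q => P q - x)) => // p _.
  by apply: filterS (P_near p ltr01) => q; rewrite opprB addrA subrK.
have [Z Z0 hZ] : exists2 Z : R, 0 < Z & forall q, [set: M] q -> `|z q| <= Z.
  by apply: compact_norm_bound => // p _; exact: z_near.
pose phi u := h u (qm u).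
pose K := (2 * n)%:R * D + 1.
have K0 : 0 < K by rewrite ltr_wpDl // mulr_ge0 // ltW.
have phi_lip u v : phi v <= phi u + K * `|v - u|.
  apply: (@le_trans _ _ (h u (qm v) + K * `|v - u|)); last by rewrite lerD2r.
  have -> : phi v = h u (qm v) + dot (P (qm v) - x) (v - u).
    by rewrite dotBr /phi /h; ring.
  rewrite lerD2l; apply: (le_trans (ler_norm _)); apply: (le_trans (dot_le _ _)).
  rewrite ler_wpM2r //; apply: (@le_trans _ _ ((2 * n)%:R * D)); last by rewrite lerDl.
  by rewrite ler_wpM2l //; exact: hD.
(* [phi u >= r * |u| - Z] exceeds [phi 0 <= Z] as soon as [r * |u| >= 2 * Z + 1]. *)
pose rho := (2 * Z + 1) / r.
have rho0 : 0 < rho by rewrite divr_gt0 // ltr_wpDl // mulr_ge0 // ltW.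
have coercive u : rho <= `|u| -> phi 0 < phi u.
  move=> hu; have [p hp] := hr u.
  have p0 : phi 0 <= Z.
    rewrite /phi /h /dot trmx0 mulmx0 mxE addr0.
    by apply: (le_trans (ler_norm _)); exact: hZ.
  have pu : - Z + r * `|u| <= phi u.
    apply: le_trans (hqm u p); rewrite /h; apply: lerD => //.
    by have := hZ p I; rewrite ler_norml => /andP [].
  have ru : 2 * Z + 1 <= r * `|u| by rewrite -ler_pdivrMl // mulrC.
  lra.
(* The minimizer has norm less than [rho]; the additional [1] leaves room for the tilted slope. *)
pose ball1 : set 'rV[R]_(2 * n) := [set u | `|u| <= rho + 1].
have cball : compact ball1.
  apply: bounded_closed_compact.
    by exists (rho + 1); split=> [|b b1 u /= hu]; [exact: num_real|exact: le_trans hu (ltW b1)].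
  have -> : ball1 = (fun u : 'rV[R]_(2 * n) => `|u|) @^-1` [set t | t <= rho + 1] by [].
  by apply: closed_comp; [move=> u _; exact: norm_continuous|exact: closed_le].
have ball0 : ball1 0 by rewrite /ball1 /= normr0 addr_ge0 // ltW.
have [|u ub umax] := @compact_max R _ ball1 (fun u => - phi u) cball (ex_intro _ 0 ball0).
  move=> v _ e e0; have e2 : 0 < e / 2 / K by rewrite !divr_gt0.
  apply/nbhs_ballP; exists (e / 2 / K) => //= w; rewrite -ball_normE /= => vw _.
  have := phi_lip w v; have : K * `|v - w| < e / 2 by rewrite mulrC -ltr_pdivlMr.
  lra.
have umin v : ball1 v -> phi u <= phi v by move=> /umax; rewrite lerN2.
have ur : `|u| < rho.
  by rewrite ltNge; apply/negP => /coercive; rewrite ltNge umin.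
set q0 := qm u; pose dd := P q0 - x.
have dd0 : dd != 0 by rewrite subr_eq0; apply/eqP; exact: Px.
have ndd : 0 < `|dd| by rewrite normr_gt0.
have pdd : 0 < dot dd dd by exact: dot_gt0.
have uniq q : q <> q0 -> h u q < phi u.
  move=> qq0; rewrite lt_neqAle hqm andbT; apply/eqP => e.
  pose l := col_mx u^T (1 : R)%:M.
  have lE y : (f y *m l) ord0 ord0 = h u y + dot x u.
    by rewrite /l functionalE mul1r /h dotBl; ring.
  have mq y : (f y *m l) ord0 ord0 <= (f q *m l) ord0 ord0.
    by rewrite !lE lerD2r e; exact: hqm.
  have mq0 y : (f y *m l) ord0 ord0 <= (f q0 *m l) ord0 ord0.
    by rewrite !lE lerD2r; exact: hqm.
  have := two_maxima qq0 mq mq0; rewrite -[X in _ = X -> _]col_mx0 => /eq_col_mx [_].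
  by move=> /rowP /(_ ord0); rewrite !mxE eqxx => /eqP; rewrite oner_eq0.
(* On [U], which contains [q0], the tilt lowers every height. Off [U] there is no contact point, and
   compactness gives a gap [eta] below the maximum. *)
pose U : set M := [set q | 0 < dot (P q - x) dd].
have oU : open U.
  rewrite openE => q Uq; have q2 : 0 < dot (P q - x) dd / 2 by rewrite divr_gt0.
  apply: filterS (dot_near dd x q q2) => q'; rewrite ler_norml => /andP [h1 _].
  by rewrite /U /=; lra.
have [||q [_ nUq]|eta eta0 heta] := @compact_min_radius _ R ([set: M] `&` ~` U)
  (fun eta q => h u q <= phi u - eta).
- by apply: compact_closedI => //; exact: open_closedC.
- by move=> b b' q bb hh; apply: (le_trans hh); rewrite lerD2l lerN2.
- have qlt : h u q < phi u by apply: uniq => e; apply: nUq; rewrite e.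
  have g0 : 0 < (phi u - h u q) / 2 by rewrite divr_gt0 // subr_gt0.
  exists ((phi u - h u q) / 2) => //.
  apply: filterS (h_near u q _ g0) => q'; rewrite ler_norml => /andP [_ hh] _; lra.
have E0 : 0 < K * `|dd| by rewrite mulr_gt0.
(* The first bound keeps the rise off [U] within [eta / 2]; the second keeps the new slope within
   distance [1] of [u]. *)
pose t := Num.min (eta / 2 / (K * `|dd|)) (1 / `|dd|).
have t0 : 0 < t by rewrite lt_min !divr_gt0.
have [t1 t2] : t * (K * `|dd|) <= eta / 2 /\ t * `|dd| <= 1.
  by split; rewrite -ler_pdivlMr // /t ge_min lexx ?orbT.
have hv q : h (u - t *: dd) q = h u q - t * dot (P q - x) dd.
  by rewrite /h dotBr dotZr; ring.
have lt_phi q : h (u - t *: dd) q < phi u.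
  rewrite hv; have [Uq|nUq] := pselect (U q).
    have : 0 < t * dot (P q - x) dd by rewrite mulr_gt0.
    have := hqm u q; rewrite -/(phi u); lra.
  have := heta q (conj I nUq).
  have : - (t * dot (P q - x) dd) <= eta / 2.
    apply: le_trans t1; rewrite -mulrN ler_pM2l //.
    apply: (le_trans (ler_norm _)); rewrite normrN; apply: (le_trans (dot_le _ _)).
    rewrite ler_wpM2r //; apply: (@le_trans _ _ ((2 * n)%:R * D)); last by rewrite lerDl.
    by rewrite ler_wpM2l //; exact: hD.
  lra.
have vb : ball1 (u - t *: dd).
  rewrite /ball1 /=; apply: (le_trans (ler_normB _ _)); rewrite normrZ gtr0_norm //.
  by apply: lerD => //; exact: ltW.
by have := umin _ vb; rewrite leNgt lt_phi.
Qed.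

End skew_codim.
End closed_case.

Theorem theorem1p1 (R : realType) (n : nat) (n_ge1 : (1 <= n)%N)
    (M : manifold R n) (M_neq0 : [set: M] !=set0) :
  [/\ exists2 N : nat, is_skew_dimension M N &
        (2 * n + 1 <= N <= 4 * n + 1)%N,
      exists2 G : set (set_type (embeddings M (4 * n + 1))),
        Gdelta_dense G &
        G `<=` [set f | totally_skew (set_val f)] &
      closed_manifold M ->
        forall N : nat, is_skew_dimension M N -> (2 * n + 2 <= N)%N].
Proof.
have [d [L dL]] := nice_cover_exists M_neq0.
have ex := totally_skew_exists n_ge1 dL (leqnn _).
have lower N : @has_totally_skew_embedding R n M N -> (2 * n + 1 <= N)%N.
  exact: skew_dim_lower.
split.
- have exb : exists N, `[< @has_totally_skew_embedding R n M N >].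
    by exists (4 * n + 1)%N; apply/asboolP.
  case: (ex_minnP exb) => N /asboolP skN Nmin.
  exists N; first by split=> // N' /asboolP; exact: Nmin.
  by rewrite lower //= Nmin //; apply/asboolP.
- exact: (totally_skew_generic dL n_ge1 (leqnn _)).
- move=> cM N [skN _]; have := lower N skN; rewrite leq_eqVlt => /orP [/eqP e|]; last first.
    by rewrite -addn1 -addnA.
  exfalso; move: skN; rewrite -e => -[f [imm _ _] ts].
  exact: (no_totally_skew_codim n_ge1 cM M_neq0 imm ts).
Qed.
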